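(* Let $(\rho,w)$ be an admissible multiplier system of rank $d$ with $\rho(T)$ diagonal, and let $\Lambda$ be a bijective exponent. (a) $\mathcal{M}^!_w(\rho)$ is a free $\mathbb{C}[J]$-module of rank $d$, freely generated by $\mathbb{X}^{(1;0)},\dots,\mathbb{X}^{(d;0)}$. (b) Let $\Xi(\tau)=q^\Lambda(1_d+\chi q+\sum_{n\ge2}\Xi_{(n)}q^n)$ be the $d\times d$ matrix whose $j$-th column is $\mathbb{X}^{(j;0)}$. Then $$\frac{E_4(\tau)E_6(\tau)}{\Delta(\tau)}\mathrm{D}_w\Xi(\tau)=\Xi(\tau)\{(J(\tau)-984)\Lambda_w+\chi_w+[\Lambda_w,\chi_w]\},$$ where $\Lambda_w=\Lambda-\frac{w}{12}1_d$, $\chi_w=\chi+2w1_d$ and $[A,B]=AB-BA$ (applied column-wise, $\mathrm{D}_w$ acts on each column). (c) Assume $w=0$. The multivalued function $\widetilde\Xi(z)=\Xi(\tau(z))$, where $z(\tau)=J(\tau)/1728$, satisfies the Fuchsian differential equation $$\frac{\mathrm{d}}{\mathrm{d}z}\widetilde\Xi(z)=\widetilde\Xi(z)\Big(\frac{\mathcal{A}_2}{z-1}+\frac{\mathcal{A}_3}{z}\Big),$$ $$\mathcal{A}_2=-\frac{31}{72}\Lambda-\frac{1}{1728}(\chi+[\Lambda,\chi]),\qquad \mathcal{A}_3=-\frac{41}{72}\Lambda+\frac{1}{1728}(\chi+[\Lambda,\chi]).$$ Moreover $\mathcal{A}_2,\mathcal{A}_3$ are diagonalisable, with eigenvalues in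 $\{0,\frac12\}$ and in $\{0,\frac13,\frac23\}$ respectively.
   Context: $\Gamma=\mathrm{SL}_2(\mathbb{Z})$, $T=\begin{pmatrix}1&1\\0&1\end{pmatrix}$, $q=e^{2\pi\mathrm{i}\tau}$, complex powers $z^w=|z|^we^{\mathrm{i}w\mathrm{Arg}z}$ with $-\pi\le\mathrm{Arg}z<\pi$. An admissible multiplier system $(\rho,w)$ of rank $d$: $w\in\mathbb{C}$, $\rho:\Gamma\to\mathrm{GL}_d(\mathbb{C})$ with $\widetilde\rho_w(\gamma,\tau)=\rho(\gamma)(c\tau+d)^w$ satisfying $\widetilde\rho_w(\gamma_1\gamma_2,\tau)=\widetilde\rho_w(\gamma_1,\gamma_2\tau)\widetilde\rho_w(\gamma_2,\tau)$, $\rho(1_2)=1_d=e^{-\pi\mathrm{i}w}\rho(-1_2)$. $\mathcal{M}^!_w(\rho)$: holomorphic $\mathbb{X}:\mathbb{H}\to\mathbb{C}^d$ with $\mathbb{X}(\gamma\tau)=\widetilde\rho_w(\gamma,\tau)\mathbb{X}(\tau)$, meromorphic at the cusps. An exponent is a diagonal $\lambda$ with $e^{2\pi\mathrm{i}\lambda}=\rho(T)$; $q^\lambda=\mathrm{diag}(e^{2\pi\mathrm{i}\tau\lambda_{jj}})$; each $\mathbb{X}\in\mathcal{M}^!_w(\rho)$ expands as $q^\lambda\sum_{n\in\mathbb{Z}}\mathbb{X}_{(n)}q^n$ (finitely many nonzero $n<0$). Principal part map $\mathcal{P}_\lambda(\mathbb{X})=\sum_{n\le0}\mathbb{X}_{(n)}q^n\in\mathbb{C}^d[q^{-1}]$;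 $\lambda$ is bijective if $\mathcal{P}_\lambda:\mathcal{M}^!_w(\rho)\to\mathbb{C}^d[q^{-1}]$ is a linear isomorphism. For bijective $\Lambda$, $\mathbb{X}^{(j;n)}=\mathcal{P}_\Lambda^{-1}(q^{-n}e_j)$, where $e_j$ is the $j$-th standard basis vector. $E_2=1-24q-\cdots$, $E_4=1+240q+\cdots$, $E_6=1-504q-\cdots$ are the normalised Eisenstein series, $\Delta=\eta^{24}$, $J=E_4^3/\Delta=q^{-1}+744+196884q+\cdots$. $\mathrm{D}_w=\frac{1}{2\pi\mathrm{i}}\frac{\mathrm{d}}{\mathrm{d}\tau}-\frac{w}{12}E_2$. *)

(* Defs.v *)
From HB Require Import structures.
From mathcomp Require Import all_boot all_order all_algebra.
From mathcomp Require Import complex.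
From mathcomp Require Import all_classical all_reals all_analysis.

Set Implicit Arguments.
Unset Strict Implicit.
Unset Printing Implicit Defensive.

Import Order.TTheory GRing.Theory Num.Theory.
Import numFieldNormedType.Exports.

Local Open Scope classical_set_scope.
Local Open Scope ring_scope.

(* R[i], packed as a numClosedFieldType so that the library's topology and
   derivative over a numFieldType apply: limits are limits for the modulus and
   [derivable f z 1] and [derive1 f z] are
   complex differentiability and the complex derivative. *)
Definition cplx (R : realType) : numClosedFieldType := R[i].

Section ComplexFunctions.
Variable R : realType.
Local Notation C := (cplx R).

Definition iunit : C := Complex 0 1.
Definition ofreal (x : R) : C := Complex x 0.
Definition twopii : C := ofreal (2 * pi) * iunit.

Definition cexp (z : C) : C :=
  ofreal (expR (complex.Re z))
  * Complex (cos (complex.Im z)) (sin (complex.Im z)).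

Definition cmod (z : C) : R := complex.Re `|z|.

(* The argument in [-pi, pi[; the value at z = 0 is irrelevant. *)
Definition Arg (z : C) : R :=
  let t := acos (complex.Re z / cmod z) in
  if (0 < complex.Im z) || ((complex.Im z == 0) && (0 <= complex.Re z))
  then t else - t.

(* z^w = |z|^w e^{i w Arg z}, only used for z != 0. *)
Definition cpow (z w : C) : C :=
  cexp (w * (ofreal (ln (cmod z)) + iunit * ofreal (Arg z))).

Definition upper : set C := [set tau | 0 < complex.Im tau].

Definition qpar (tau : C) : C := cexp (twopii * tau).

Definition mxderive m n (F : C -> 'M[C]_(m, n)) (tau : C) : 'M[C]_(m, n) :=
  \matrix_(i, j) derive1 (fun z => F z i j) tau.

Definition holomorphic_on (D : set C) m n (F : C -> 'M[C]_(m, n)) :=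
  forall tau, D tau -> forall i j, derivable (fun z => F z i j) tau 1.

End ComplexFunctions.

Section ClassicalForms.
Variable R : realType.
Local Notation C := (cplx R).

Definition sigma_ (k n : nat) : nat := \sum_(e <- divisors n) e ^ k.

(* 1 + c * \sum_(n >= 1) sigma_k(n) q^n *)
Definition eisenstein_series (c : C) (k : nat) (tau : C) : C :=
  1 + c * limn (fun N => \sum_(1 <= n < N) (sigma_ k n)%:R * qpar tau ^+ n).

Definition E2 : C -> C := eisenstein_series (- 24%:R) 1.
Definition E4 : C -> C := eisenstein_series 240%:R 3.
Definition E6 : C -> C := eisenstein_series (- 504%:R) 5.

Definition dedekind_eta (tau : C) : C :=
  cexp (twopii R * tau / 24%:R)
  * limn (fun N => \prod_(1 <= n < N) (1 - qpar tau ^+ n)).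

Definition Delta (tau : C) : C := dedekind_eta tau ^+ 24.

Definition kleinJ (tau : C) : C := E4 tau ^+ 3 / Delta tau.

(* D_w, applied entrywise *)
Definition Dw (w : C) m n (F : C -> 'M[C]_(m, n)) (tau : C) : 'M[C]_(m, n) :=
  (twopii R)^-1 *: mxderive F tau - (w / 12%:R * E2 tau) *: F tau.

End ClassicalForms.

Section Multipliers.
Variable R : realType.
Local Notation C := (cplx R).

Definition SL2Z : {pred 'M[int]_2} := [pred g : 'M[int]_2 | \det g == 1].

Definition Tmx : 'M[int]_2 := 1%:M + delta_mx 0 1.

Definition cden (g : 'M[int]_2) (tau : C) : C :=
  (g 1 0)%:~R * tau + (g 1 1)%:~R.

Definition mobius (g : 'M[int]_2) (tau : C) : C :=
  ((g 0 0)%:~R * tau + (g 0 1)%:~R) / cden g tau.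

(* rho is only ever used on SL2Z: its values at other matrices play no role. *)
Definition rho_tilde d (rho : 'M[int]_2 -> 'M[C]_d) (w : C)
    (g : 'M[int]_2) (tau : C) : 'M[C]_d :=
  cpow (cden g tau) w *: rho g.

Definition admissible d (rho : 'M[int]_2 -> 'M[C]_d) (w : C) : Prop :=
  [/\ forall g, g \in SL2Z -> rho g \in unitmx,
      forall g1 g2 tau, g1 \in SL2Z -> g2 \in SL2Z -> upper tau ->
        rho_tilde rho w (g1 *m g2) tau
        = rho_tilde rho w g1 (mobius g2 tau) *m rho_tilde rho w g2 tau,
      rho 1%:M = 1%:M
    & cexp (- (ofreal pi * iunit R * w)) *: rho (- 1%:M) = 1%:M].

Definition is_exponent d (rho : 'M[int]_2 -> 'M[C]_d) (lambda : 'M[C]_d) : Prop :=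
  is_diag_mx lambda
  /\ diag_mx (\row_j cexp (twopii R * lambda j j)) = rho Tmx.

Definition qpow d (lambda : 'M[C]_d) (tau : C) : 'M[C]_d :=
  diag_mx (\row_j cexp (twopii R * tau * lambda j j)).

(* F = q^lambda \sum_(n in Z) a_n q^n on the upper half-plane, with only
   finitely many nonzero a_n for n < 0: all of them vanish for n < - N, and the
   sum is taken over n = k - N, k >= 0. *)
Definition has_qexp d m (lambda : 'M[C]_d) (F : C -> 'M[C]_(d, m))
    (a : int -> 'M[C]_(d, m)) : Prop :=
  exists2 N : nat,
    (forall n : int, n < - N%:Z -> a n = 0)
  & forall tau, upper tau -> forall i j,
      (fun K : nat =>
         (qpow lambda tau *m
            \sum_(0 <= k < K)
               qpar tau ^ (k%:Z - N%:Z) *: a (k%:Z - N%:Z)) i j) @ \oo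
      --> F tau i j.

(* The n-th coefficient F_(n) relative to lambda; junk without an expansion. *)
Definition qcoef d m (lambda : 'M[C]_d) (F : C -> 'M[C]_(d, m)) :
    int -> 'M[C]_(d, m) :=
  xget (fun=> 0) [set a | has_qexp lambda F a].

(* Gamma has a single orbit of cusps, so this is a condition at i oo: the
   1-periodic function q^{-lambda} X is meromorphic in q at q = 0. It does not
   depend on the choice of the exponent. *)
Definition meromorphic_at_cusps d (rho : 'M[int]_2 -> 'M[C]_d)
    (X : C -> 'cV[C]_d) : Prop :=
  exists2 lambda, is_exponent rho lambda & exists a, has_qexp lambda X a.

(* M^!_w(rho). A function on the upper half-plane is encoded as a function on C
   vanishing off the upper half-plane, so that equality of the encodings is
   equality of functions on the upper half-plane. *)
Definition Mweak d (rho : 'M[int]_2 -> 'M[C]_d) (w : C) :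
    set (C -> 'cV[C]_d) :=
  [set X | [/\ forall tau, ~ upper tau -> X tau = 0,
               holomorphic_on (@upper R) X,
               forall g tau, g \in SL2Z -> upper tau ->
                 X (mobius g tau) = rho_tilde rho w g tau *m X tau
             & meromorphic_at_cusps rho X]].

(* C^d[q^{-1}] is 'cV[{poly C}]_d, the polynomial variable 'X being q^{-1}. *)
Definition principal_part d (lambda : 'M[C]_d) (X : C -> 'cV[C]_d) :
    'cV[{poly C}]_d :=
  xget 0 [set p : 'cV[{poly C}]_d |
            forall (n : nat) j, (p j 0)`_n = qcoef lambda X (- n%:Z) j 0].

Definition bijective_exponent d (rho : 'M[int]_2 -> 'M[C]_d) (w : C)
    (lambda : 'M[C]_d) : Prop :=
  [/\ is_exponent rho lambda,
      forall (c : C) X Y, Mweak rho w X -> Mweak rho w Y ->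
        principal_part lambda (fun tau => c *: X tau + Y tau)
        = c%:P *: principal_part lambda X + principal_part lambda Y
    & set_bij (Mweak rho w) [set: 'cV[{poly C}]_d] (principal_part lambda)].

(* X^{(j;n)}, the inverse image of q^{-n} e_j *)
Definition Xjn d (rho : 'M[int]_2 -> 'M[C]_d) (w : C) (lambda : 'M[C]_d)
    (j : 'I_d) (n : nat) : C -> 'cV[C]_d :=
  xget (fun=> 0)
    [set X | Mweak rho w X
             /\ principal_part lambda X = 'X^n *: delta_mx j 0].

Definition Xi d (rho : 'M[int]_2 -> 'M[C]_d) (w : C) (lambda : 'M[C]_d)
    (tau : C) : 'M[C]_d :=
  \matrix_(i, j) Xjn rho w lambda j 0 tau i 0.

Definition chi d (rho : 'M[int]_2 -> 'M[C]_d) (w : C) (lambda : 'M[C]_d) :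
    'M[C]_d :=
  qcoef lambda (Xi rho w lambda) 1.

(* M is a C[J]-module for pointwise operations. *)
Definition CJ_module d (M : set (C -> 'cV[C]_d)) : Prop :=
  [/\ M (fun=> 0),
      forall X Y, M X -> M Y -> M (fun tau => X tau + Y tau)
    & forall (p : {poly C}) X, M X -> M (fun tau => p.[kleinJ tau] *: X tau)].

(* Uniqueness is asked for the polynomials p_j and not just for the functions
   p_j(J), i.e. C[J] is identified with {poly C}. *)
Definition CJ_freely_generated d (M : set (C -> 'cV[C]_d)) r
    (B : 'I_r -> C -> 'cV[C]_d) : Prop :=
  (forall j, M (B j))
  /\ forall X, M X ->
       exists! p : 'cV[{poly C}]_r,
         X = (fun tau => \sum_j (p j 0).[kleinJ tau] *: B j tau).

Definition lie_mx d (A B : 'M[C]_d) : 'M[C]_d := A *m B - B *m A.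

(* A (single-valued, continuous) branch on U of the multivalued inverse tau(z)
   of z(tau) = J(tau)/1728; 0 and 1 are the branch points. *)
Definition is_tau_branch (U : set C) (t : C -> C) : Prop :=
  [/\ open U,
      forall z, U z -> z != 0 /\ z != 1,
      forall z, U z -> {for z, continuous t}
    & forall z, U z -> upper (t z) /\ kleinJ (t z) / 1728%:R = z].

End Multipliers.

(* Main.v *)
(** No contour integration is needed: all functions are given by q-series converging
    on the unit disc, and identities between holomorphic functions are obtained by
    showing that a derivative vanishes. Herglotz' trick gives the expansion of
    sum_n (z + n)^-2, hence zeta(2) and the cotangent, and an exchange of two
    conditionally convergent sums gives the law of E_2 under tau -> -1/tau.
    Ramanujan's equations for D E_2, D E_4, D E_6 are convolution identities for divisor
    sums, proved in Liouville's way from the solutions of ax + by = n; differentiating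
    the law of E_2 then yields those of E_4 and E_6, and E_4^3 - E_6^2 = 1728 Delta
    because both sides satisfy D f = E_2 f and start with 1728 q.

    (a) is an induction on the order of the pole. In (b) both sides are weakly
    holomorphic of weight w, and their principal parts agree. For (c), write
    Delta Xi A_2 = E_6 U with U of weight 6; one Serre derivative and the equation of (b)
    give 1728 Delta U (A_2 - 1/2) = E_6 Z, so that
    1728 Xi A_2 (A_2 - 1/2) = (J - 1728) Z / Delta. Since Z / Delta is weakly
    holomorphic and multiplication by J - 1728 raises the order of a pole by one,
    Z / Delta has no principal part and vanishes. The relation for A_3 is the same
    with E_4 in place of E_6 and two derivatives. *)

Require Import Defs.
From HB Require Import structures.
From mathcomp Require Import all_boot all_order all_algebra.
From mathcomp Require Import complex.
From mathcomp Require Import all_classical all_reals all_analysis.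
From mathcomp Require Import ring lra zify.

Set Implicit Arguments.
Unset Strict Implicit.
Unset Printing Implicit Defensive.

Import Order.TTheory GRing.Theory Num.Theory.
Import numFieldNormedType.Exports.

Local Open Scope classical_set_scope.
Local Open Scope ring_scope.

(** * Real-valued modulus and convergence of complex sequences *)

Section Modulus.
Variable R : realType.
Local Notation C := (cplx R).
Implicit Types (x y z : C) (a b : R).

(** Since Cauchy's theory is avoided, holomorphy yields no expansion: every function carries its
    [q]-expansion along and each operation transports it. [1 / Delta] is expanded as an exponential,
    the logarithm of the product being explicit. The double series of [(n tau + m)^-2] does not
    converge absolutely; it is compared with a telescoping series built on the half-integers, and
    the two orders of summation of the latter differ by [pi i / tau], which is the anomaly of [E_2].
    No valence formula is used either: identities between vector-valued forms come from the
    injectivity of the principal part map, whence the care to reach weight exactly [w] by dividing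
    by [Delta]. The constants come from few coefficients: [984 = 744 + 240], from [J] and from
    [E_4 E_6 / Delta = q^-1 - 240 + ...]; partial fractions at [z = 1] and [z = 0] turn this into
    [31/72 = 744/1728] and [41/72 = 984/1728]. The eigenvalues [1/2] and [1/3] are the factors in
    the Serre derivatives [- E_4^2 / 2] of [E_6] and [- E_6 / 3] of [E_4]; a second elimination step
    adds another [1/3]. *)

Lemma ofrealD : {morph @ofreal R : a b / a + b >-> a + b}.
Proof. by move=> a b; rewrite /ofreal; apply/eqP; rewrite eq_complex /= addr0 !eqxx. Qed.

Lemma ofrealM : {morph @ofreal R : a b / a * b >-> a * b}.
Proof.
move=> a b; apply/eqP; rewrite /ofreal eq_complex /=.
by rewrite !mulr0 mul0r subr0 addr0 !eqxx.
Qed.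

Lemma ofrealN : {morph @ofreal R : a / - a >-> - a}.
Proof. by move=> a; apply/eqP; rewrite /ofreal eq_complex /= oppr0 !eqxx. Qed.

Lemma ofreal0 : ofreal 0 = 0 :> C. Proof. by []. Qed.
Lemma ofreal1 : ofreal 1 = 1 :> C. Proof. by []. Qed.

Lemma ofreal_inj : injective (@ofreal R).
Proof. by move=> a b []. Qed.

Lemma ofrealV : {morph @ofreal R : a / a^-1 >-> a^-1}.
Proof.
move=> a; have [->|a0] := eqVneq a 0; first by rewrite invr0 ofreal0 invr0.
have oa0 : ofreal a != 0 by apply: contra_neq a0 => /ofreal_inj.
by apply: (mulfI oa0); rewrite -ofrealM !mulfV.
Qed.

Lemma ofrealX n : {morph @ofreal R : a / a ^+ n >-> a ^+ n}.
Proof. by move=> a; elim: n => [|n IH]; rewrite ?expr0// !exprS ofrealM IH. Qed.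

Lemma ofreal_nat n : ofreal n%:R = n%:R :> C.
Proof. by elim: n => // n IH; rewrite -natr1 ofrealD IH ofreal1 natr1. Qed.

Lemma normCE z : `|z| = ofreal (cmod z).
Proof. by rewrite /cmod normc_def. Qed.

Lemma cmod_sqrt z :
  cmod z = Num.sqrt (complex.Re z ^+ 2 + complex.Im z ^+ 2).
Proof. by rewrite /cmod normc_def. Qed.

Lemma ofreal_le a b : (ofreal a <= ofreal b) = (a <= b).
Proof. exact: lecR. Qed.

Lemma ofreal_lt a b : (ofreal a < ofreal b) = (a < b).
Proof. exact: ltcR. Qed.

Lemma cmod_ge0 z : 0 <= cmod z.
Proof. by rewrite cmod_sqrt sqrtr_ge0. Qed.

Lemma cmodD x y : cmod (x + y) <= cmod x + cmod y.
Proof. by rewrite -ofreal_le ofrealD -!normCE ler_normD. Qed.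

Lemma cmodM x y : cmod (x * y) = cmod x * cmod y.
Proof. by apply: ofreal_inj; rewrite ofrealM -!normCE normrM. Qed.

Lemma cmodN x : cmod (- x) = cmod x.
Proof. by apply: ofreal_inj; rewrite -!normCE normrN. Qed.

Lemma cmod_ofreal a : cmod (ofreal a) = `|a|.
Proof. by rewrite cmod_sqrt /= expr0n addr0 sqrtr_sqr. Qed.

Lemma cmod0 : cmod (0 : C) = 0.
Proof. by rewrite -ofreal0 cmod_ofreal normr0. Qed.

Lemma cmod1 : cmod (1 : C) = 1.
Proof. by rewrite -ofreal1 cmod_ofreal normr1. Qed.

Lemma cmod_nat n : cmod (n%:R : C) = n%:R.
Proof. by rewrite -ofreal_nat cmod_ofreal normr_nat. Qed.

Lemma cmodX n x : cmod (x ^+ n) = cmod x ^+ n.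
Proof. by elim: n => [|n IH]; rewrite ?expr0 ?cmod1// !exprS cmodM IH. Qed.

Lemma cmodV x : cmod x^-1 = (cmod x)^-1.
Proof. by apply: ofreal_inj; rewrite ofrealV -!normCE normfV. Qed.

Lemma cmod_div x y : cmod (x / y) = cmod x / cmod y.
Proof. by rewrite cmodM cmodV. Qed.

Lemma cmod_eq0 x : (cmod x == 0) = (x == 0).
Proof.
rewrite -[in RHS]normr_eq0 normCE; apply/eqP/eqP => [->//|].
by rewrite -ofreal0 => /ofreal_inj.
Qed.

Lemma cmod_gt0 x : (0 < cmod x) = (x != 0).
Proof. by rewrite lt_def cmod_eq0 cmod_ge0 andbT. Qed.

Lemma cmodC x y : cmod (x - y) = cmod (y - x).
Proof. by rewrite -cmodN opprB. Qed.

Lemma cmodB_ge x y : cmod x - cmod y <= cmod (x - y).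
Proof. by have := cmodD (x - y) y; rewrite subrK; lra. Qed.

Lemma cmodD_ge x y : cmod x - cmod y <= cmod (x + y).
Proof. by have := cmodB_ge x (- y); rewrite opprK cmodN. Qed.

Lemma cmod_tri x y z : cmod (x - z) <= cmod (x - y) + cmod (y - z).
Proof. by have := cmodD (x - y) (y - z); rewrite subrKA. Qed.

Lemma sqr_cmod z : cmod z ^+ 2 = complex.Re z ^+ 2 + complex.Im z ^+ 2.
Proof. by rewrite cmod_sqrt sqr_sqrtr// addr_ge0// sqr_ge0. Qed.

Lemma cmod_Re z : `|complex.Re z| <= cmod z.
Proof.
rewrite -ler_sqr ?nnegrE ?cmod_ge0// sqr_cmod real_normK ?num_real//.
by rewrite lerDl sqr_ge0.
Qed.

Lemma cmod_Im z : `|complex.Im z| <= cmod z.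
Proof.
rewrite -ler_sqr ?nnegrE ?cmod_ge0// sqr_cmod real_normK ?num_real//.
by rewrite lerDr sqr_ge0.
Qed.

Lemma cmod_le_ReIm z : cmod z <= `|complex.Re z| + `|complex.Im z|.
Proof.
rewrite -ler_sqr ?nnegrE ?addr_ge0 ?cmod_ge0// sqr_cmod sqrrD !real_normK ?num_real//.
by have := mulr_ge0 (normr_ge0 (complex.Re z)) (normr_ge0 (complex.Im z)); nra.
Qed.

Lemma cmod_sum I (r : seq I) (P : pred I) (f : I -> C) :
  cmod (\sum_(i <- r | P i) f i) <= \sum_(i <- r | P i) cmod (f i).
Proof.
elim/big_ind2 : _ => //; first by rewrite cmod0.
by move=> x a y b xa yb; rewrite (le_trans (cmodD _ _))// lerD.
Qed.

Lemma ReD x y : complex.Re (x + y) = complex.Re x + complex.Re y.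
Proof. by case: x; case: y. Qed.
Lemma ImD x y : complex.Im (x + y) = complex.Im x + complex.Im y.
Proof. by case: x; case: y. Qed.
Lemma ReN x : complex.Re (- x) = - complex.Re x.
Proof. by case: x. Qed.
Lemma ImN x : complex.Im (- x) = - complex.Im x.
Proof. by case: x. Qed.
Lemma ReM x y :
  complex.Re (x * y) = complex.Re x * complex.Re y - complex.Im x * complex.Im y.
Proof. by case: x; case: y. Qed.
Lemma ImM x y :
  complex.Im (x * y) = complex.Re x * complex.Im y + complex.Im x * complex.Re y.
Proof. by case: x => a b; case: y => c d /=. Qed.

Lemma complex_eq x y :
  complex.Re x = complex.Re y -> complex.Im x = complex.Im y -> x = y.
Proof. by case: x; case: y => /= ? ? ? ? -> ->. Qed.

(** Tolerances and moduli live in [R], whose order is total, so that estimates reduce to linear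
    arithmetic; [cvgCP] translates back to the topological limit. *)
Definition cvgs (u : nat -> C) (l : C) :=
  forall e : R, 0 < e -> exists N, forall n, (N <= n)%N -> cmod (u n - l) < e.

Lemma cvgCP (u : nat -> C) (l : C) :
  u @ \oo --> l <-> cvgs u l.
Proof.
split.
  move=> /cvgrPdist_lt ul e e0.
  have /ul [N _ H] : 0 < ofreal e by rewrite -ofreal0 ofreal_lt.
  exists N => n Nn; rewrite cmodC -ofreal_lt -normCE.
  exact: H.
move=> H; apply/cvgrPdist_lt => e e0.
have [er e1] : e = ofreal (complex.Re e) /\ 0 < complex.Re e.
  move: e0; rewrite ltcE /= => /andP[/eqP im re]; split => //.
  by apply: complex_eq.
have [N HN] := H _ e1.
exists N => // n /= Nn; rewrite er normCE ofreal_lt cmodC.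
exact: HN.
Qed.

Lemma cvgs_unique (u : nat -> C) (l l' : C) : cvgs u l -> cvgs u l' -> l = l'.
Proof.
move=> ul ul'; apply/eqP; rewrite -subr_eq0 -cmod_eq0 eq_le cmod_ge0 andbT.
apply/ler_addgt0Pr => e e0; rewrite add0r.
have [N HN] := ul _ (divr_gt0 e0 (ltr0Sn R 1)).
have [M HM] := ul' _ (divr_gt0 e0 (ltr0Sn R 1)).
have := HN _ (leq_maxl N M); have := HM _ (leq_maxr N M).
have := cmod_tri l (u (maxn N M)) l'; rewrite (cmodC l (u _)); lra.
Qed.

Lemma cvgs_cst (l : C) : cvgs (fun=> l) l.
Proof. by move=> e e0; exists 0%N => n _; rewrite subrr cmod0. Qed.

Lemma cvgsD (u v : nat -> C) (k l : C) : cvgs u k -> cvgs v l ->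
  cvgs (fun n => u n + v n) (k + l).
Proof.
move=> ul ul' e e0.
have [N HN] := ul _ (divr_gt0 e0 (ltr0Sn R 1)).
have [M HM] := ul' _ (divr_gt0 e0 (ltr0Sn R 1)).
exists (maxn N M) => n; rewrite geq_max => /andP[/HN h1 /HM h2].
have := cmodD (u n - k) (v n - l).
by rewrite addrACA -opprD; lra.
Qed.

Lemma cvgsZ (c : C) (u : nat -> C) (l : C) : cvgs u l ->
  cvgs (fun n => c * u n) (c * l).
Proof.
move=> ul e e0.
have c0 : 0 < cmod c + 1 by have := cmod_ge0 c; lra.
have [N HN] := ul _ (divr_gt0 e0 c0).
exists N => n /HN; rewrite -mulrBr cmodM ltr_pdivlMr// => lt.
apply: le_lt_trans lt; rewrite mulrC ler_wpM2l ?cmod_ge0//; lra.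
Qed.

Lemma cvgsN (u : nat -> C) (l : C) : cvgs u l -> cvgs (fun n => - u n) (- l).
Proof. by move=> /(cvgsZ (-1)); rewrite mulN1r; under eq_fun do rewrite mulN1r. Qed.

Lemma cvgsB (u v : nat -> C) (k l : C) : cvgs u k -> cvgs v l ->
  cvgs (fun n => u n - v n) (k - l).
Proof. by move=> uk /cvgsN; exact: cvgsD. Qed.

Lemma cvgs_eq (u : nat -> C) l N : (forall n, (N <= n)%N -> u n = l) -> cvgs u l.
Proof. by move=> ul e e0; exists N => n Nn; rewrite ul// subrr cmod0. Qed.

Lemma cvgsS (u : nat -> C) l : cvgs (fun n => u n.+1) l <-> cvgs u l.
Proof.
split=> ul e /ul[N HN]; first by exists N.+1 => -[//|n]; exact: HN.
by exists N => n Nn; apply: HN; exact: leqW.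
Qed.

Lemma cvgs_le (u : nat -> C) (l c : C) (B : R) N :
  cvgs u l -> (forall n, (N <= n)%N -> cmod (u n - c) <= B) ->
  cmod (l - c) <= B.
Proof.
move=> ul uB; apply/ler_addgt0Pr => e /ul[M /(_ (maxn M N) (leq_maxl M N))].
rewrite cmodC => lt; have := cmod_tri l (u (maxn M N)) c.
have := uB (maxn M N) (leq_maxr M N); lra.
Qed.

Lemma cvgC_Re_Im (u : nat -> C) (l : C) :
  (fun n => complex.Re (u n)) @ \oo --> complex.Re l ->
  (fun n => complex.Im (u n)) @ \oo --> complex.Im l -> u @ \oo --> l.
Proof.
move=> /cvgrPdist_lt ur /cvgrPdist_lt ui; apply/cvgCP => e e0.
have e2 : 0 < e / 2 by rewrite divr_gt0.
have [N1 _ H1] := ur _ e2.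
have [N2 _ H2] := ui _ e2.
exists (maxn N1 N2) => n; rewrite geq_max => /andP[n1 n2].
have {}H1 := H1 _ n1; have {}H2 := H2 _ n2.
apply: le_lt_trans (cmod_le_ReIm _) _.
rewrite ReD ReN ImD ImN -(normrN (_ - _)) opprB -(normrN (complex.Im _ - _)) opprB.
by rewrite [ltRHS]splitr ltrD.
Qed.

(** Completeness is inherited from [R]: real and imaginary parts are 1-Lipschitz for the modulus. *)
Lemma cauchyC_cvg (u : nat -> C) :
  (forall e : R, 0 < e -> exists N, forall n m, (N <= n)%N -> (N <= m)%N ->
     cmod (u n - u m) < e) -> exists l : C, cvgs u l.
Proof.
move=> H.
have K (f : C -> R) : (forall x y, `|f x - f y| <= cmod (x - y)) ->
    exists l : R, (fun n => f (u n)) @ \oo --> l.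
  move=> fl; exists (lim ((fun n => f (u n)) @ \oo)); apply: cauchy_cvg.
  apply: cauchy_exP => e e0; have [N HN] := H _ e0.
  exists (f (u N)); exists N => // n /= Nn; rewrite /ball /=.
  by apply: le_lt_trans (fl _ _) (HN _ _ _ _).
have [x y|lr Hr] := K (@complex.Re R).
  by apply: le_trans (cmod_Re _); rewrite ReD ReN.
have [x y|li Hi] := K (@complex.Im R).
  by apply: le_trans (cmod_Im _); rewrite ImD ImN.
by exists (Complex lr li); apply/cvgCP; apply: cvgC_Re_Im.
Qed.

End Modulus.

(** * Absolutely convergent series, double series and Cauchy products *)

Section Series.
Variable R : realType.
Local Notation C := (cplx R).
Implicit Types (a b : nat -> C) (s t : C).

(** The index [N] is one where [S] comes within [e] of its supremum. It serves partial sums as well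
    as the sums over squares of a double series. *)
Lemma monotone_bounded_cauchy (S : nat -> R) (B : R) :
  (forall n m, (n <= m)%N -> S n <= S m) -> (forall n, S n <= B) ->
  forall e : R, 0 < e -> exists N, forall n, (N <= n)%N -> S n - S N < e.
Proof.
move=> mS SB e e0.
have hs : has_sup (range S).
  by split; [exists (S 0%N), 0%N | exists B => _ [n _ <-]].
have [_ [N _ <-] HN] := sup_adherent e0 hs.
exists N => n Nn; have : S n <= sup (range S) by apply: (sup_upper_bound hs); exists n.
lra.
Qed.

Definition asum a := exists B : R, forall N, \sum_(0 <= n < N) cmod (a n) <= B.

Definition sumC a : C := limn (fun N => \sum_(0 <= n < N) a n).

Lemma sum_nat_ge0_mono (f : nat -> R) n m :
  (forall k, 0 <= f k) -> (n <= m)%N ->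
  \sum_(0 <= k < n) f k <= \sum_(0 <= k < m) f k.
Proof.
move=> f0 nm; rewrite (big_cat_nat (leq0n n) nm)/= lerDl.
exact: sumr_ge0.
Qed.

Lemma sum_nat_tail (V : zmodType) (f : nat -> V) n m : (n <= m)%N ->
  \sum_(0 <= k < m) f k - \sum_(0 <= k < n) f k = \sum_(n <= k < m) f k.
Proof.
by move=> nm; apply/eqP; rewrite subr_eq addrC -(big_cat_nat (leq0n n) nm).
Qed.

Lemma asum_cvg_ex a : asum a ->
  exists l : C, cvgs (fun N => \sum_(0 <= n < N) a n) l.
Proof.
move=> [B HB]; apply: cauchyC_cvg => e e0.
have [N HN] := monotone_bounded_cauchy
  (fun n m => @sum_nat_ge0_mono (fun k => cmod (a k)) n m (fun=> cmod_ge0 _)) HB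
  (divr_gt0 e0 (ltr0Sn R 1)).
have K n : (N <= n)%N ->
    cmod (\sum_(0 <= k < n) a k - \sum_(0 <= k < N) a k) < e / 2.
  move=> Nn; apply: le_lt_trans (HN _ Nn).
  by rewrite !sum_nat_tail//; exact: cmod_sum.
exists N => n m Nn Nm.
apply: le_lt_trans (cmod_tri _ (\sum_(0 <= k < N) a k) _) _.
by rewrite (splitr e) ltrD ?K// cmodC K.
Qed.

Lemma cvg_sumC a s : cvgs (fun N => \sum_(0 <= n < N) a n) s -> sumC a = s.
Proof. by move=> /cvgCP; exact: cvg_lim. Qed.

Lemma asum_cvg a : asum a -> cvgs (fun N => \sum_(0 <= n < N) a n) (sumC a).
Proof. by move=> /asum_cvg_ex[l al]; rewrite (cvg_sumC al). Qed.

Lemma cmod_sumC_le a (B : R) :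
  (forall N, \sum_(0 <= n < N) cmod (a n) <= B) -> cmod (sumC a) <= B.
Proof.
move=> HB; have aa : asum a by exists B.
rewrite -[sumC a]subr0; apply: (cvgs_le (N := 0%N) (asum_cvg aa)) => n _.
by rewrite subr0 (le_trans (cmod_sum _ _ _)).
Qed.

Lemma eq_sumC a b : a =1 b -> sumC a = sumC b.
Proof. by move=> /funext ->. Qed.

Lemma asum_le a (b : nat -> R) (B : R) :
  (forall n, cmod (a n) <= b n) -> (forall N, \sum_(0 <= n < N) b n <= B) ->
  asum a.
Proof.
move=> ab bB; exists B => N; apply: le_trans (bB N); exact: ler_sum.
Qed.

Lemma asumD a b : asum a -> asum b -> asum (fun n => a n + b n).
Proof.
move=> [A HA] [B HB]; exists (A + B) => N.
apply: le_trans (lerD (HA N) (HB N)); rewrite -big_split /=.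
by apply: ler_sum => i _; exact: cmodD.
Qed.

Lemma asumZ c a : asum a -> asum (fun n => c * a n).
Proof.
move=> [A HA]; exists (cmod c * A) => N.
rewrite (eq_bigr (fun n => cmod c * cmod (a n))) => [|i _]; last exact: cmodM.
by rewrite -mulr_sumr ler_wpM2l ?cmod_ge0.
Qed.

Lemma asumN a : asum a -> asum (fun n => - a n).
Proof.
move=> [A HA]; exists A => N.
by rewrite (eq_bigr (fun n => cmod (a n))) => [//|i _]; exact: cmodN.
Qed.

Lemma sumCD a b : asum a -> asum b ->
  sumC (fun n => a n + b n) = sumC a + sumC b.
Proof.
move=> /asum_cvg ha /asum_cvg hb; apply: cvg_sumC.
under eq_fun do rewrite big_split /=.
exact: cvgsD.
Qed.

Lemma sumCZ c a : asum a -> sumC (fun n => c * a n) = c * sumC a.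
Proof.
move=> /asum_cvg ha; apply: cvg_sumC.
under eq_fun do rewrite -mulr_sumr.
exact: cvgsZ.
Qed.

Lemma sumCN a : asum a -> sumC (fun n => - a n) = - sumC a.
Proof.
move=> /asum_cvg ha; apply: cvg_sumC.
under eq_fun do rewrite sumrN.
exact: cvgsN.
Qed.

Lemma sumCB a b : asum a -> asum b ->
  sumC (fun n => a n - b n) = sumC a - sumC b.
Proof. by move=> ha hb; rewrite sumCD ?sumCN//; exact: asumN. Qed.

Lemma sumC_fin a N : (forall n, (N <= n)%N -> a n = 0) ->
  sumC a = \sum_(0 <= n < N) a n.
Proof.
move=> a0; apply: cvg_sumC; apply: (@cvgs_eq _ _ _ N) => n Nn.
rewrite (big_cat_nat (leq0n N) Nn)/= [X in _ + X = _](_ : _ = 0) ?addr0//.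
by rewrite big_nat_cond big1// => i; rewrite andbT => /andP[Ni _]; rewrite a0.
Qed.

Lemma asumS a : asum (fun n => a n.+1) <-> asum a.
Proof.
split=> -[A HA].
  exists (cmod (a 0%N) + A) => -[|N].
    by rewrite big_nil addr_ge0 ?cmod_ge0//; have := HA 0%N; rewrite big_nil.
  by rewrite big_nat_recl// lerD2l.
exists A => N; have := HA N.+1; rewrite big_nat_recl//.
by apply: le_trans; rewrite lerDr cmod_ge0.
Qed.

Lemma sumCS a : asum a -> sumC a = a 0%N + sumC (fun n => a n.+1).
Proof.
move=> ha; apply: cvg_sumC; apply/cvgsS.
under eq_fun do rewrite big_nat_recl//.
apply: cvgsD; first exact: cvgs_cst.
by apply: asum_cvg; apply/asumS.
Qed.

(** Summability over pairs, tested on finite rectangles only; it is symmetric in the two indices. *)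
Definition asum2 (a : nat -> nat -> C) := exists B : R, forall M N,
  \sum_(0 <= m < M) \sum_(0 <= n < N) cmod (a m n) <= B.

Lemma asum2_sym (a : nat -> nat -> C) : asum2 a -> asum2 (fun m n => a n m).
Proof. by move=> [B HB]; exists B => M N; rewrite exchange_big_nat/=. Qed.

Lemma asum2_row (a : nat -> nat -> C) m : asum2 a -> asum (a m).
Proof.
move=> [B HB]; exists B => N; apply: le_trans (HB m.+1 N).
rewrite big_nat_recr//= lerDr sumr_ge0// => i _.
by apply: sumr_ge0 => j _; exact: cmod_ge0.
Qed.

Lemma cvgs_sum (M : nat) (u : nat -> nat -> C) (l : nat -> C) :
  (forall m, cvgs (u m) (l m)) ->
  cvgs (fun n => \sum_(0 <= m < M) u m n) (\sum_(0 <= m < M) l m).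
Proof.
move=> ul; elim: M => [|M IH].
  by apply: (@cvgs_eq _ _ _ 0%N) => n _; rewrite !big_nil.
rewrite big_nat_recr//= (_ : (fun n => _) =
  (fun n => \sum_(0 <= m < M) u m n + u M n)); first exact: cvgsD.
by apply: funext => n; rewrite big_nat_recr.
Qed.

(** Finitely many rows can be truncated at one common column with an error [e] each; the bound [B]
    survives when [e] tends to 0. *)
Lemma asum2_rows (a : nat -> nat -> C) : asum2 a -> asum (fun m => sumC (a m)).
Proof.
move=> aa; have [B HB] := aa; exists B => M.
suff: forall e : R, 0 < e ->
    \sum_(0 <= m < M) cmod (sumC (a m)) <= B + M%:R * e.
  move=> H; apply/ler_addgt0Pr => e e0.
  have M0 : 0 < M.+1%:R :> R by rewrite ltr0n.
  apply: le_trans (H (e / M.+1%:R) _) _; first by rewrite divr_gt0.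
  rewrite lerD2l mulrCA ger_pMr// ler_pdivrMr// mul1r ler_nat//.
move=> e e0.
have [N HN] : exists N, forall m, (m < M)%N ->
    cmod (sumC (a m) - \sum_(0 <= n < N) a m n) < e.
  elim: (M) => [|k [N HN]]; first by exists 0%N.
  have /(_ _ e0)[N2 HN2] := asum_cvg (asum2_row k aa).
  have [N1 HN1] : exists N1, forall m n, (m < k)%N -> (N1 <= n)%N ->
      cmod (sumC (a m) - \sum_(0 <= i < n) a m i) < e.
    elim: (k) => [|j [N3 HN3]]; first by exists 0%N.
    have /(_ _ e0)[N4 HN4] := asum_cvg (asum2_row j aa).
    exists (maxn N3 N4) => m n; rewrite ltnS leq_eqVlt geq_max => /orP[/eqP->|mj] /andP[n3 n4].
      by rewrite cmodC HN4.
    exact: HN3.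
  exists (maxn N1 N2) => m; rewrite ltnS leq_eqVlt => /orP[/eqP->|mk].
    by rewrite cmodC HN2// leq_maxr.
  by rewrite HN1// leq_maxl.
apply: le_trans (_ : \sum_(0 <= m < M) (\sum_(0 <= n < N) cmod (a m n) + e) <= _).
  rewrite big_nat_cond [leRHS]big_nat_cond; apply: ler_sum => m; rewrite andbT => /andP[_ mM].
  have := HN _ mM; have := cmodB_ge (sumC (a m)) (\sum_(0 <= n < N) a m n).
  have := cmod_sum (index_iota 0 N) predT (a m); lra.
rewrite big_split/= sumr_const_nat subn0 -[e *+ M]mulr_natl.
exact: lerD (HB _ _) (lexx _).
Qed.

(** Fubini: a square carrying all the absolute mass up to [e / 2] gives a finite sum [D] within
    [e / 2] of every larger rectangle, hence of both iterated sums. *)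
Lemma sumC_exchange (a : nat -> nat -> C) : asum2 a ->
  sumC (fun m => sumC (a m)) = sumC (fun n => sumC (fun m => a m n)).
Proof.
move=> aa; have [B HB] := aa.
have ab := asum2_sym aa.
pose S k := \sum_(0 <= m < k) \sum_(0 <= n < k) cmod (a m n).
have mS k l : (k <= l)%N -> S k <= S l.
  move=> kl; rewrite /S.
  apply: (@le_trans _ _ (\sum_(0 <= m < k) \sum_(0 <= n < l) cmod (a m n))).
    by apply: ler_sum => m _; apply: sum_nat_ge0_mono => // ?; exact: cmod_ge0.
  apply: sum_nat_ge0_mono => // m; apply: sumr_ge0 => ? _; exact: cmod_ge0.
suff H (e : R) : 0 < e ->
   cmod (sumC (fun m => sumC (a m)) - sumC (fun n => sumC (fun m => a m n))) <= e.
  apply/eqP; rewrite -subr_eq0 -cmod_eq0 eq_le cmod_ge0 andbT.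
  by apply/ler_addgt0Pr => e e0; rewrite add0r H.
move=> e0; have [K HK] := monotone_bounded_cauchy mS (fun n => HB n n)
  (divr_gt0 e0 (ltr0Sn R 1)).
pose D := \sum_(0 <= m < K) \sum_(0 <= n < K) a m n.
have key M N : (K <= M)%N -> (K <= N)%N ->
    cmod (\sum_(0 <= m < M) \sum_(0 <= n < N) a m n - D) <= e / 2.
  move=> KM KN.
  have LE : \sum_(0 <= m < M) \sum_(0 <= n < N) cmod (a m n) - S K <= e / 2.
    have ML := leq_maxl M N; have NL := leq_maxr M N.
    have : \sum_(0 <= m < M) \sum_(0 <= n < N) cmod (a m n) <= S (maxn M N).
      apply: (@le_trans _ _ (\sum_(0 <= m < M) \sum_(0 <= n < maxn M N) cmod (a m n))).
        by apply: ler_sum => m _; apply: sum_nat_ge0_mono => // ?; exact: cmod_ge0.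
      apply: sum_nat_ge0_mono => // m; apply: sumr_ge0 => ? _; exact: cmod_ge0.
    have := HK _ (leq_trans KM ML); lra.
  apply: le_trans LE; rewrite /D /S.
  rewrite (big_cat_nat (leq0n K) KM)/= [in leRHS](big_cat_nat (leq0n K) KM)/=.
  rewrite [X in cmod (X + _ - _)](eq_bigr (fun m => \sum_(0 <= n < K) a m n + \sum_(K <= n < N) a m n)); last first.
    by move=> m _; rewrite (big_cat_nat (leq0n K) KN).
  rewrite [X in _ <= X + _ - _](eq_bigr (fun m => \sum_(0 <= n < K) cmod (a m n) + \sum_(K <= n < N) cmod (a m n))); last first.
    by move=> m _; rewrite (big_cat_nat (leq0n K) KN).
  rewrite !big_split/= -!addrA addrC addrA subrK [leRHS]addrC !addrA subrK.
  apply: le_trans (cmodD _ _) _; apply: lerD.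
    apply: le_trans (cmod_sum _ _ _) _; apply: ler_sum => m _; exact: cmod_sum.
  apply: le_trans (cmod_sum _ _ _) _; apply: ler_sum => m _; exact: cmod_sum.
have half (u : nat -> nat -> C) : asum2 u ->
   (forall M N, (K <= M)%N -> (K <= N)%N ->
    cmod (\sum_(0 <= m < M) \sum_(0 <= n < N) u m n - D) <= e / 2) ->
   cmod (sumC (fun m => sumC (u m)) - D) <= e / 2.
  move=> uu ukey; apply: (cvgs_le (N := K) (asum_cvg (asum2_rows uu))) => M KM.
  apply: (cvgs_le (N := K) (cvgs_sum M (fun m => asum_cvg (asum2_row m uu)))).
  by move=> N KN; exact: ukey.
have h1 := half _ aa key.
have h2 : cmod (sumC (fun n => sumC (fun m => a m n)) - D) <= e / 2.
  by apply: half => // M N KM KN; rewrite exchange_big_nat/= key.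
have := cmod_tri (sumC (fun m => sumC (a m))) D (sumC (fun n => sumC (fun m => a m n))).
rewrite (cmodC D); lra.
Qed.

Definition cauchy_prod a b n : C := \sum_(i < n.+1) a i * b (n - i)%N.

Lemma sum_triangle (V : zmodType) (f : nat -> nat -> V) N :
  \sum_(0 <= n < N) \sum_(i < n.+1) f i (n - i)%N
  = \sum_(0 <= m < N) \sum_(0 <= n < N - m) f m n.
Proof.
elim: N => [|N IH]; first by rewrite !big_nil.
rewrite big_nat_recr//= IH [in RHS]big_nat_recr//= subSnn big_nat1.
rewrite big_ord_recr/= subnn addrA; congr (_ + _).
rewrite -(big_mkord predT (fun i => f i (N - i)%N)) -big_split/=.
rewrite big_nat_cond [RHS]big_nat_cond; apply: eq_bigr => i; rewrite andbT => /andP[_ iN].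
by rewrite subSn ?(ltnW iN)// big_nat_recr.
Qed.

(** The terms of index below [N] fill a triangle, which lies in the rectangle bounded by [A * B]. *)
Lemma cauchy_prod_bound a b (A B : R) :
  (forall N, \sum_(0 <= n < N) cmod (a n) <= A) ->
  (forall N, \sum_(0 <= n < N) cmod (b n) <= B) ->
  forall N, \sum_(0 <= n < N) cmod (cauchy_prod a b n) <= A * B.
Proof.
move=> HA HB N.
have A0 : 0 <= A by have := HA 0%N; rewrite big_nil.
apply: (@le_trans _ _ (\sum_(0 <= n < N) \sum_(i < n.+1) cmod (a i) * cmod (b (n - i)%N))).
  apply: ler_sum => n _; apply: le_trans (cmod_sum _ _ _) _.
  by apply: ler_sum => i _; rewrite cmodM.
rewrite (sum_triangle (fun i j => cmod (a i) * cmod (b j))).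
apply: (@le_trans _ _ (\sum_(0 <= m < N) cmod (a m) * B)).
  by apply: ler_sum => m _; rewrite -mulr_sumr ler_wpM2l ?cmod_ge0.
by rewrite -mulr_suml ler_wpM2r//; have := HB 0%N; rewrite big_nil.
Qed.

Lemma asum_shiftn (a : nat -> C) m :
  asum a -> asum (fun n => if (m <= n)%N then a (n - m)%N else 0).
Proof.
elim: m a => [|m IH] a aa.
  by under eq_fun do rewrite subn0.
apply/asumS; under eq_fun do rewrite ltnS subSS; exact: IH.
Qed.

Lemma sumC_shiftn (a : nat -> C) m : asum a ->
  sumC (fun n => if (m <= n)%N then a (n - m)%N else 0) = sumC a.
Proof.
move=> aa; elim: m => [|m IH].
  by apply: eq_sumC => n; rewrite subn0.
rewrite sumCS; last exact: asum_shiftn.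
by rewrite add0r -IH; apply: eq_sumC => n; rewrite ltnS subSS.
Qed.

(** An instance of the exchange of sums: row [m] is [b] shifted by [m] places and multiplied by
    [a m], and column [n] is the finite sum defining the Cauchy product. *)
Lemma sumC_cauchy_prod a b : asum a -> asum b ->
  sumC (cauchy_prod a b) = sumC a * sumC b.
Proof.
move=> aa ab; have [A HA] := aa; have [B HB] := ab.
pose f m n := if (m <= n)%N then a m * b (n - m)%N else 0.
have ff : asum2 f.
  exists (A * B) => M N.
  have B0 : 0 <= B by have := HB 0%N; rewrite big_nil.
  apply: (@le_trans _ _ (\sum_(0 <= m < M) cmod (a m) * B)); last first.
    by rewrite -mulr_suml ler_wpM2r.
  apply: ler_sum => m _.
  rewrite (eq_bigr (fun n => cmod (a m) * cmod (if (m <= n)%N then b (n - m)%N else 0))).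
    rewrite -mulr_sumr ler_wpM2l ?cmod_ge0//.
    have [Nm|mN] := leqP N m.
      rewrite big_nat_cond big1// => i; rewrite andbT => /andP[_ iN].
      by rewrite leqNgt (leq_trans iN Nm) cmod0.
    rewrite (big_cat_nat (leq0n m) (ltnW mN))/= big_nat_cond big1 ?add0r; last first.
      by move=> i; rewrite andbT => /andP[_ im]; rewrite leqNgt im cmod0.
    rewrite -{1}(add0n m) big_addn.
    by under eq_bigr do rewrite leq_addl addnK.
  by move=> n _; rewrite /f; case: ifP => _; rewrite ?mulr0 ?cmodM ?cmod0 ?mulr0.
have := sumC_exchange ff.
rewrite (_ : (fun m => sumC (f m)) = (fun m => sumC b * a m)); last first.
  apply: funext => m; rewrite mulrC -(sumC_shiftn m ab) -sumCZ.
    by apply: eq_sumC => n; rewrite /f; case: ifP => _; rewrite ?mulr0.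
  exact: asum_shiftn.
rewrite sumCZ// mulrC => ->; apply: eq_sumC => n.
rewrite (@sumC_fin _ n.+1) => [|m]; last by rewrite /f ltnNge => /negbTE ->.
rewrite big_mkord /cauchy_prod; apply: eq_bigr => i _.
by rewrite /f -ltnS ltn_ord.
Qed.

End Series.

(** * Complex derivatives in epsilon-delta form *)

Section DerivativeEps.
Variable K : numFieldType.
Implicit Types (f : K -> K) (z l : K).

(** The form without division, where [h = 0] is allowed; sums, products and compositions then become
    triangle inequalities. *)
Lemma is_derive_epsP f z l : is_derive z 1 f l <->
  forall e : K, 0 < e -> exists2 d : K, 0 < d & forall h : K, `|h| < d ->
    `|f (z + h) - f z - l * h| <= e * `|h|.
Proof.
split.
  move=> [df dv] e e0.
  have : (fun h => h^-1 *: (f (h *: 1 + z) - f z)) @ 0^' --> l.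
    by rewrite -dv; exact: df.
  move=> /cvgrPdist_le/(_ _ e0)[d /= d0 H]; exists d => // h hd.
  have [->|h0] := eqVneq h 0; first by rewrite addr0 subrr mulr0 subr0 normr0 mulr0.
  have := H h; rewrite /= sub0r normrN => /(_ hd h0).
  rewrite -(ler_pM2r (_ : 0 < `|h|)) ?normr_gt0// -normrM mulrBl distrC.
  by rewrite mulrAC /GRing.scale/= mulr1 mulVf// mul1r (addrC h).
move=> H.
have lim : (fun h => h^-1 *: (f (h *: 1 + z) - f z)) @ 0^' --> l.
  apply/cvgrPdist_le => e e0; have [d d0 Hd] := H _ e0.
  near=> h.
  have h0 : h != 0 by near: h; exact: nbhs_dnbhs_neq.
  have hd : `|h| < d.
    near: h; apply: dnbhs0_lt => //.
  rewrite -(ler_pM2r (_ : 0 < `|h|)) ?normr_gt0// -normrM mulrBl distrC.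
  rewrite mulrAC /GRing.scale/= mulr1 mulVf// mul1r (addrC h).
  exact: Hd.
split; first by apply/cvg_ex; exists l.
exact: cvg_lim lim.
Unshelve. all: by end_near. Qed.

End DerivativeEps.

Section ComplexDerivative.
Variable R : realType.
Local Notation C := (cplx R).
Implicit Types (f g : C -> C) (z l h : C).

(** A relation between function, point and value, so that differentiability and the value of the
    derivative are established together. *)
Definition cder f z l := forall e : R, 0 < e -> exists2 d : R, 0 < d &
  forall h : C, cmod h < d -> cmod (f (z + h) - f z - l * h) <= e * cmod h.

Lemma ofreal_gt0 (e : C) : 0 < e -> e = ofreal (complex.Re e) /\ 0 < complex.Re e.
Proof.
rewrite ltcE /= => /andP[/eqP im re]; split => //.
by apply: complex_eq.
Qed.

Lemma cderP f z l : is_derive z 1 f l <-> cder f z l.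
Proof.
split=> [/is_derive_epsP H e e0|H].
  have [|d d0 Hd] := H (ofreal e); first by rewrite -ofreal0 ofreal_lt.
  have [de dp] := ofreal_gt0 d0; exists (complex.Re d) => // h hd.
  rewrite -ofreal_le ofrealM -!normCE; apply: Hd.
  by rewrite de normCE ofreal_lt.
apply/is_derive_epsP => e e0; have [er ep] := ofreal_gt0 e0.
have [d d0 Hd] := H _ ep.
exists (ofreal d) => [|h]; first by rewrite -ofreal0 ofreal_lt.
by rewrite er !normCE -ofrealM ofreal_lt ofreal_le; exact: Hd.
Qed.

Lemma cder_unique f z l l' : cder f z l -> cder f z l' -> l = l'.
Proof. by move=> /cderP[_ <-] /cderP[_ <-]. Qed.

Lemma cder_derive1 f z l : cder f z l -> derive1 f z = l.
Proof. by move=> /cderP[_ <-]; rewrite derive1E. Qed.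

Lemma cder_derivable f z l : cder f z l -> derivable f z 1.
Proof. by move=> /cderP[]. Qed.

Lemma cder_eq f z l l' : cder f z l -> l = l' -> cder f z l'.
Proof. by move=> ? <-. Qed.

Lemma cder_local f g z l (r : R) : 0 < r ->
  (forall x, cmod (x - z) < r -> f x = g x) -> cder f z l -> cder g z l.
Proof.
move=> r0 fg df e /df[d d0 Hd]; exists (Num.min d r) => [|h].
  by rewrite lt_min d0.
rewrite lt_min => /andP[hd hr]; rewrite -!fg ?subrr ?cmod0//; first exact: Hd.
by rewrite addrC addKr.
Qed.

Lemma cder_cst c z : cder (fun=> c) z 0.
Proof.
move=> e e0; exists 1 => // h _; rewrite subrr mul0r subrr cmod0.
by rewrite mulr_ge0 ?cmod_ge0// ltW.
Qed.

Lemma cder_id z : cder id z 1.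
Proof.
move=> e e0; exists 1 => // h _; rewrite mul1r (addrC z) addrK subrr cmod0.
by rewrite mulr_ge0 ?cmod_ge0// ltW.
Qed.

Lemma cderD f g z k l : cder f z k -> cder g z l ->
  cder (fun x => f x + g x) z (k + l).
Proof.
move=> df dg e e0; have e2 : 0 < e / 2 by rewrite divr_gt0.
have [d d0 Hd] := df _ e2; have [d' d'0 Hd'] := dg _ e2.
exists (Num.min d d') => [|h]; first by rewrite lt_min d0.
rewrite lt_min => /andP[/Hd h1 /Hd' h2].
have -> : f (z + h) + g (z + h) - (f z + g z) - (k + l) * h =
  (f (z + h) - f z - k * h) + (g (z + h) - g z - l * h) by ring.
apply: le_trans (cmodD _ _) _; lra.
Qed.

Lemma cder_lip f z l : cder f z l -> exists2 d : R, 0 < d & forall h,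
  cmod h < d -> cmod (f (z + h) - f z) <= (cmod l + 1) * cmod h.
Proof.
move=> /(_ 1 ltr01)[d d0 Hd]; exists d => // h hd.
have := Hd _ hd; have := cmodD (f (z + h) - f z - l * h) (l * h).
rewrite subrK cmodM; lra.
Qed.

Lemma cder_cont f z l : cder f z l -> forall e : R, 0 < e ->
  exists2 d : R, 0 < d & forall h, cmod h < d -> cmod (f (z + h) - f z) < e.
Proof.
move=> /cder_lip[d d0 Hd] e e0; have l0 : 0 < cmod l + 1 by have := cmod_ge0 l; lra.
exists (Num.min d (e / (cmod l + 1))) => [|h]; first by rewrite lt_min d0 divr_gt0.
rewrite lt_min ltr_pdivlMr// => /andP[/Hd h1 h2].
by apply: le_lt_trans h1 _; rewrite mulrC.
Qed.

Lemma cderM f g z k l : cder f z k -> cder g z l ->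
  cder (fun x => f x * g x) z (k * g z + f z * l).
Proof.
move=> df dg e e0.
have e3 : 0 < e / 3 by rewrite divr_gt0.
have g0 : 0 < cmod (g z) + 1 by have := cmod_ge0 (g z); lra.
have f0 : 0 < cmod (f z) + 1 by have := cmod_ge0 (f z); lra.
have k0 : 0 < cmod k + 1 by have := cmod_ge0 k; lra.
have [d1 d10 H1] := df _ (divr_gt0 e3 g0); have [d2 d20 H2] := dg _ (divr_gt0 e3 f0).
have [d3 d30 H3] := cder_lip df; have [d4 d40 H4] := cder_cont dg (divr_gt0 e3 k0).
exists (Num.min (Num.min d1 d2) (Num.min d3 d4)) => [|h].
  by rewrite !lt_min d10 d20 d30.
rewrite !lt_min => /andP[/andP[/H1 h1 /H2 h2] /andP[/H3 h3 /H4 h4]].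
have -> : f (z + h) * g (z + h) - f z * g z - (k * g z + f z * l) * h =
  (f (z + h) - f z - k * h) * g z + f z * (g (z + h) - g z - l * h)
  + (f (z + h) - f z) * (g (z + h) - g z) by ring.
have h0 := cmod_ge0 h.
have a1 : cmod ((f (z + h) - f z - k * h) * g z) <= e / 3 * cmod h.
  rewrite cmodM; apply: le_trans (ler_wpM2r (cmod_ge0 _) h1) _.
  rewrite -mulrA mulrAC -mulrA [leRHS]mulrC -[leRHS]mulr1 [leRHS]mulrAC.
  have : cmod (g z) / (cmod (g z) + 1) <= 1 by rewrite ler_pdivrMr//; lra.
  have : 0 <= e / 3 * cmod h by rewrite mulr_ge0// ltW.
  by move=> a b; have := ler_wpM2l a b; nra.
have a2 : cmod (f z * (g (z + h) - g z - l * h)) <= e / 3 * cmod h.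
  rewrite cmodM; apply: le_trans (ler_wpM2l (cmod_ge0 _) h2) _.
  have : cmod (f z) / (cmod (f z) + 1) <= 1 by rewrite ler_pdivrMr//; lra.
  have : 0 <= e / 3 * cmod h by rewrite mulr_ge0// ltW.
  by move=> a b; have := ler_wpM2l a b; nra.
have a3 : cmod ((f (z + h) - f z) * (g (z + h) - g z)) <= e / 3 * cmod h.
  rewrite cmodM; apply: le_trans (ler_pM (cmod_ge0 _) (cmod_ge0 _) h3 (ltW h4)) _.
  suff -> : (cmod k + 1) * cmod h * (e / 3 / (cmod k + 1)) = e / 3 * cmod h by [].
  by field; rewrite gt_eqF.
apply: le_trans (cmodD _ _) _; have := cmodD ((f (z + h) - f z - k * h) * g z) (f z * (g (z + h) - g z - l * h)); lra.
Qed.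

Lemma cderZ c f z l : cder f z l -> cder (fun x => c * f x) z (c * l).
Proof. by move=> /(cderM (cder_cst c z)); rewrite mul0r add0r. Qed.

Lemma cderN f z l : cder f z l -> cder (fun x => - f x) z (- l).
Proof. by move=> /(cderZ (-1)); rewrite mulN1r; under eq_fun do rewrite mulN1r. Qed.

Lemma cderB f g z k l : cder f z k -> cder g z l ->
  cder (fun x => f x - g x) z (k - l).
Proof. by move=> df /cderN; exact: cderD. Qed.

Lemma cder_comp f g z k l : cder f z k -> cder g (f z) l ->
  cder (fun x => g (f x)) z (l * k).
Proof.
move=> df dg e e0.
have k0 : 0 < cmod k + 1 by have := cmod_ge0 k; lra.
have l0 : 0 < cmod l + 1 by have := cmod_ge0 l; lra.
have e2 : 0 < e / 2 by rewrite divr_gt0.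
have [d1 d10 H1] := dg _ (divr_gt0 e2 k0).
have [d2 d20 H2] := cder_cont df d10; have [d3 d30 H3] := cder_lip df.
have [d4 d40 H4] := df _ (divr_gt0 e2 l0).
exists (Num.min d2 (Num.min d3 d4)) => [|h]; first by rewrite !lt_min d20 d30.
rewrite !lt_min => /and3P[/H2 h2 /H3 h3 /H4 h4].
have := H1 _ h2; rewrite subrKC => h1.
have -> : g (f (z + h)) - g (f z) - l * k * h =
  (g (f (z + h)) - g (f z) - l * (f (z + h) - f z)) + l * (f (z + h) - f z - k * h) by ring.
apply: le_trans (cmodD _ _) _; rewrite (splitr e) mulrDl; apply: lerD.
  apply: le_trans h1 _; rewrite -mulrA ler_wpM2l ?(ltW e2)//.
  by rewrite mulrC ler_pdivrMr// mulrC.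
rewrite cmodM; apply: le_trans (ler_wpM2l (cmod_ge0 _) h4) _.
have : cmod l / (cmod l + 1) <= 1 by rewrite ler_pdivrMr//; lra.
have : 0 <= e / 2 * cmod h by rewrite mulr_ge0 ?cmod_ge0// ltW.
by move=> a b; have := ler_wpM2l a b; nra.
Qed.

Lemma cder_inv z : z != 0 -> cder (fun x => x^-1) z (- z^-1 ^+ 2).
Proof.
move=> z0 e e0; have cz : 0 < cmod z by rewrite cmod_gt0.
pose d := Num.min (cmod z / 2) (e * cmod z ^+ 3 / 2).
have d0 : 0 < d by rewrite lt_min !divr_gt0// mulr_gt0// exprn_gt0.
exists d => // h; rewrite lt_min => /andP[h1 h2].
have ch := cmod_ge0 h.
have zh : cmod z / 2 <= cmod (z + h) by have := cmodD_ge z h; lra.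
have zh0 : z + h != 0 by rewrite -cmod_gt0; lra.
have -> : (z + h)^-1 - z^-1 - - z^-1 ^+ 2 * h = h * h / (z ^+ 2 * (z + h)).
  by field; rewrite zh0 z0.
rewrite cmod_div cmodM (cmodM (z ^+ 2)) cmodX ler_pdivrMr; last first.
  by rewrite mulr_gt0 ?exprn_gt0// cmod_gt0.
rewrite mulrAC ler_wpM2r// ; apply: ltW; apply: lt_le_trans h2 _.
have -> : e * cmod z ^+ 3 / 2 = e * (cmod z ^+ 2 * (cmod z / 2)) by rewrite exprSr; ring.
by rewrite !ler_pM2l// exprn_gt0.
Qed.

Lemma cderV f z l : f z != 0 -> cder f z l ->
  cder (fun x => (f x)^-1) z (- l * (f z)^-1 ^+ 2).
Proof.
by move=> f0 df; apply: cder_eq (cder_comp df (cder_inv f0)) _; rewrite mulrC mulrN mulNr.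
Qed.

Lemma cderX f z l n : cder f z l ->
  cder (fun x => f x ^+ n) z (n%:R * f z ^+ n.-1 * l).
Proof.
move=> df; elim: n => [|n IH].
  by under eq_fun do rewrite expr0; rewrite !mul0r; exact: cder_cst.
under eq_fun do rewrite exprS.
apply: cder_eq (cderM df IH) _; case: n {IH} => [|n] /=; first by rewrite !expr0; ring.
by rewrite -!natr1 exprS; ring.
Qed.

(** The mean value theorem, applied to the real and to the imaginary part along the segment. This is
    what replaces integration: only the segment matters, so it may start next to singularities. *)
Lemma cder0_const f (a b : C) :
  (forall t : R, 0 <= t <= 1 -> cder f (a + ofreal t * (b - a)) 0) -> f a = f b.
Proof.
move=> H.
pose p (t : R) : C := a + ofreal t * (b - a).
have pD (t h : R) : p (t + h) = p t + ofreal h * (b - a).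
  by rewrite /p ofrealD mulrDl addrA.
have K (g : C -> R) : (forall x y, g (x - y) = g x - g y) ->
    (forall x, `|g x| <= cmod x) -> g (f a) = g (f b).
  move=> gB gle.
  pose G (s : R) : R := g (f (p s)).
  have D (t : R) : t \in `[0, 1] -> is_derive t 1 G 0.
    rewrite in_itv/= => /H Ht; apply/is_derive_epsP => e e0.
    have c0 : 0 < cmod (b - a) + 1 by have := cmod_ge0 (b - a); lra.
    have [d d0 Hd] := Ht _ (divr_gt0 e0 c0).
    exists (d / (cmod (b - a) + 1)) => [|h]; first by rewrite divr_gt0.
    rewrite ltr_pdivlMr// => hd; rewrite mul0r subr0 /G -gB.
    apply: le_trans (gle _) _; rewrite pD.
    have hle : `|h| * cmod (b - a) <= `|h| * (cmod (b - a) + 1) by rewrite ler_wpM2l//; lra.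
    have := Hd (ofreal h * (b - a)); rewrite mul0r subr0 cmodM cmod_ofreal.
    move=> /(_ (le_lt_trans hle hd))/le_trans; apply.
    by rewrite mulrAC ler_pdivrMr// -mulrA ler_pM2l.
  have D' (t : R) : t \in `]0, 1[ -> is_derive t 1 G 0.
    by move=> tin; apply: D; exact: subset_itv_oo_cc.
  have cG : {within `[0, 1], continuous G}.
    by apply: derivable_within_continuous => x /D[].
  have [c _] := MVT_segment ler01 D' cG.
  rewrite mul0r /G /p ofreal0 ofreal1 mul0r addr0 mul1r subrKC.
  by move/eqP; rewrite subr_eq0 => /eqP.
apply: complex_eq.
  by apply: K => [x y|x]; [rewrite ReD ReN | exact: cmod_Re].
by apply: K => [x y|x]; [rewrite ImD ImN | exact: cmod_Im].
Qed.

End ComplexDerivative.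

(** * Power series converging on the open unit disc *)

Section PowerSeries.
Variable R : realType.
Local Notation C := (cplx R).
Implicit Types (a b : nat -> C) (q z h : C).

Definition conv a := forall r : R, 0 <= r < 1 ->
  exists B : R, forall N, \sum_(0 <= n < N) cmod (a n) * r ^+ n <= B.

Definition ev a q : C := sumC (fun n => a n * q ^+ n).

Lemma conv_asum a q : conv a -> cmod q < 1 -> asum (fun n => a n * q ^+ n).
Proof.
move=> ca q1; have [|B HB] := ca (cmod q); first by rewrite cmod_ge0.
by exists B => N; under eq_bigr do rewrite cmodM cmodX; exact: HB.
Qed.

Lemma eq_ev a b q : a =1 b -> ev a q = ev b q.
Proof. by move=> /funext ->. Qed.

Lemma geometric_bound (r : R) N : 0 <= r < 1 -> \sum_(0 <= n < N) r ^+ n <= (1 - r)^-1.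
Proof.
move=> /andP[r0 r1]; have r1' : 0 < 1 - r by lra.
rewrite -[leRHS]mul1r ler_pdivlMr// mulrC.
suff -> : (1 - r) * \sum_(0 <= n < N) r ^+ n = 1 - r ^+ N by rewrite gerBl exprn_ge0.
by rewrite big_mkord -[1 - r]opprB mulNr -subrX1 opprB.
Qed.

(** Induction on [k]: with [r < s < 1] and [x = r / s], one factor [n + 1] is absorbed by [(n + 1)
    x^n <= 1 + x + ... + x^n <= 1 / (1 - x)]. *)
Lemma conv_le a (D : R) k : (forall n, cmod (a n) <= D * n.+1%:R ^+ k) -> conv a.
Proof.
elim: k D a => [|k IH] D a aD r /andP[r0 r1].
  exists (D * (1 - r)^-1) => N.
  apply: (@le_trans _ _ (\sum_(0 <= n < N) D * r ^+ n)).
    by apply: ler_sum => n _; rewrite ler_wpM2r ?exprn_ge0//; have := aD n; rewrite expr0 mulr1.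
  have D0 : 0 <= D by have := aD 0%N; rewrite expr0 mulr1; apply: le_trans (cmod_ge0 _).
  by rewrite -mulr_sumr ler_wpM2l// geometric_bound ?r0.
pose s := (r + 1) / 2; have s01 : 0 <= s < 1 by rewrite /s; apply/andP; split; lra.
have rs : r < s by rewrite /s; lra.
have s0 : 0 < s by apply: le_lt_trans rs.
have D0 : 0 <= D by have := aD 0%N; rewrite expr1n mulr1; apply: le_trans (cmod_ge0 _).
have [|B HB] := IH D (fun n => ofreal (D * n.+1%:R ^+ k)) _ s s01.
  by move=> n; rewrite cmod_ofreal ger0_norm// mulr_ge0 ?exprn_ge0.
exists ((1 - r / s)^-1 * B) => N.
apply: le_trans (ler_wpM2l _ (HB N)); last first.
  by rewrite invr_ge0 subr_ge0 ler_pdivrMr// mul1r ltW.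
rewrite mulr_sumr; apply: ler_sum => n _.
rewrite cmod_ofreal ger0_norm ?mulr_ge0 ?exprn_ge0//.
apply: le_trans (ler_wpM2r (exprn_ge0 n r0) (aD n)) _.
have x01 : 0 <= r / s < 1 by rewrite divr_ge0 ?(ltW s0)//= ltr_pdivrMr// mul1r.
have : n.+1%:R * (r / s) ^+ n <= (1 - r / s)^-1.
  apply: le_trans (geometric_bound n.+1 x01).
  rewrite (_ : _ * _ = \sum_(0 <= i < n.+1) (r / s) ^+ n); last first.
    by rewrite sumr_const_nat subn0 mulr_natl.
  apply: ler_sum_nat => i /andP[_ ilt]; have /andP[x0 x1] := x01.
  by apply: ler_wiXn2l => //; exact: ltW.
rewrite expr_div_n mulrA ler_pdivrMr ?exprn_gt0// => le.
rewrite exprSr.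
have -> : D * (n.+1%:R ^+ k * n.+1%:R) * r ^+ n = D * n.+1%:R ^+ k * (n.+1%:R * r ^+ n) by ring.
have Dk : 0 <= D * n.+1%:R ^+ k by rewrite mulr_ge0 ?exprn_ge0.
by have := ler_wpM2l Dk le; rewrite [X in _ -> _ <= X]mulrCA.
Qed.

Lemma conv_coef_bound a (r : R) : conv a -> 0 <= r < 1 ->
  exists2 B : R, 0 <= B & forall n, cmod (a n) * r ^+ n <= B.
Proof.
move=> ca /[dup] r01 /andP[r0 _]; have [B HB] := ca _ r01.
have B0 : 0 <= B by have := HB 0%N; rewrite big_nil.
exists B => // n; have := HB n.+1; rewrite big_nat_recr//=; apply: le_trans.
by rewrite lerDr sumr_ge0// => i _; rewrite mulr_ge0 ?cmod_ge0 ?exprn_ge0.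
Qed.

Lemma conv0 : conv (fun=> 0).
Proof. by move=> r _; exists 0 => N; rewrite big1// => i _; rewrite cmod0 mul0r. Qed.

Lemma convD a b : conv a -> conv b -> conv (fun n => a n + b n).
Proof.
move=> ca cb r /[dup] r01 /andP[r0 _]; have [A HA] := ca _ r01; have [B HB] := cb _ r01.
exists (A + B) => N; apply: le_trans (lerD (HA N) (HB N)); rewrite -big_split/=.
by apply: ler_sum => n _; rewrite -mulrDl ler_wpM2r ?exprn_ge0// cmodD.
Qed.

Lemma convZ c a : conv a -> conv (fun n => c * a n).
Proof.
move=> ca r r01; have [A HA] := ca _ r01.
exists (cmod c * A) => N; under eq_bigr do rewrite cmodM -mulrA.
by rewrite -mulr_sumr ler_wpM2l// cmod_ge0.
Qed.

Lemma conv_tail a : conv a -> conv (fun n => a n.+1).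
Proof.
move=> ca r /andP[r0 r1]; pose s := (r + 1) / 2.
have s01 : 0 <= s < 1 by rewrite /s; apply/andP; split; lra.
have s0 : 0 < s by rewrite /s; lra.
have [A HA] := ca _ s01; exists (s^-1 * A) => N.
rewrite mulrC ler_pdivlMr// mulr_suml; apply: le_trans (HA N.+1).
rewrite big_nat_recl//=; apply: ler_wpDl; first by rewrite expr0 mulr1 cmod_ge0.
apply: ler_sum => n _; rewrite -mulrA ler_wpM2l ?cmod_ge0// exprSr ler_wpM2r ?(ltW s0)//.
by apply: lerXn2r; rewrite ?nnegrE ?(ltW s0)// /s; lra.
Qed.

Lemma conv_cons c a : conv a -> conv (fun n => if n is m.+1 then a m else c).
Proof.
move=> ca r /[dup] r01 /andP[r0 r1]; have [A HA] := ca _ r01.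
have A0 : 0 <= A by have := HA 0%N; rewrite big_nil.
exists (cmod c + A) => -[|N]; first by rewrite big_nil addr_ge0 ?cmod_ge0.
rewrite big_nat_recl//= expr0 mulr1 lerD2l; apply: le_trans (HA N).
apply: ler_sum => n _; rewrite ler_wpM2l ?cmod_ge0// exprS ler_piMl ?exprn_ge0//.
exact: ltW.
Qed.

Lemma conv_cauchy_prod a b : conv a -> conv b -> conv (cauchy_prod a b).
Proof.
move=> ca cb r /[dup] r01 /andP[r0 r1].
have [A HA] := ca _ r01; have [B HB] := cb _ r01.
pose a' n := a n * ofreal (r ^+ n); pose b' n := b n * ofreal (r ^+ n).
have nr n : cmod (ofreal (r ^+ n)) = r ^+ n by rewrite cmod_ofreal ger0_norm ?exprn_ge0.
exists (A * B) => N.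
rewrite (eq_bigr (fun n => cmod (cauchy_prod a' b' n))); last first.
  move=> n _; rewrite -{1}(nr n) -cmodM /cauchy_prod mulr_suml; congr cmod.
  apply: eq_bigr => i _; rewrite /a' /b'.
  by rewrite mulrACA -ofrealM -exprD subnKC// -ltnS.
apply: cauchy_prod_bound => {}N.
  by under eq_bigr do rewrite cmodM nr; exact: HA.
by under eq_bigr do rewrite cmodM nr; exact: HB.
Qed.

Lemma evD a b q : conv a -> conv b -> cmod q < 1 ->
  ev (fun n => a n + b n) q = ev a q + ev b q.
Proof.
move=> ca cb q1; rewrite /ev -sumCD; [|exact: conv_asum..].
by apply: eq_sumC => n; rewrite mulrDl.
Qed.

Lemma evZ c a q : conv a -> cmod q < 1 -> ev (fun n => c * a n) q = c * ev a q.
Proof.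
move=> ca q1; rewrite /ev -sumCZ; last exact: conv_asum.
by apply: eq_sumC => n; rewrite mulrA.
Qed.

Lemma ev_cauchy_prod a b q : conv a -> conv b -> cmod q < 1 ->
  ev (cauchy_prod a b) q = ev a q * ev b q.
Proof.
move=> ca cb q1; rewrite /ev -sumC_cauchy_prod; [|exact: conv_asum..].
apply: eq_sumC => n; rewrite /cauchy_prod mulr_suml; apply: eq_bigr => i _.
by rewrite mulrACA -exprD subnKC// -ltnS.
Qed.

Lemma ev_split a q : conv a -> cmod q < 1 -> ev a q = a 0%N + q * ev (fun n => a n.+1) q.
Proof.
move=> ca q1; rewrite /ev sumCS; last exact: conv_asum.
rewrite expr0 mulr1 -sumCZ; last by apply: conv_asum => //; exact: conv_tail.
by congr (_ + _); apply: eq_sumC => n; rewrite exprS mulrCA.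
Qed.

Lemma ev_cons c a q : conv a -> cmod q < 1 ->
  ev (fun n => if n is m.+1 then a m else c) q = c + q * ev a q.
Proof. by move=> ca q1; rewrite ev_split//; exact: conv_cons. Qed.

Lemma ev_fin a N q : (forall n, (N <= n)%N -> a n = 0) ->
  ev a q = \sum_(0 <= n < N) a n * q ^+ n.
Proof. by move=> a0; rewrite /ev (@sumC_fin _ _ N)// => n /a0 ->; rewrite mul0r. Qed.

Lemma ev_zero a : ev a 0 = a 0%N.
Proof.
rewrite /ev (@sumC_fin _ _ 1) => [|[//|n] _]; first by rewrite big_nat1 expr0 mulr1.
by rewrite exprS mul0r mulr0.
Qed.

Definition diffs a n : C := n.+1%:R * a n.+1.
Definition theta a n : C := n%:R * a n.

(** At a larger radius [s < 1] the terms of [a] are bounded, which leaves the series of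
    [n (r / s)^n]. *)
Lemma conv_theta a : conv a -> conv (theta a).
Proof.
move=> ca r /andP[r0 r1]; pose s := (r + 1) / 2.
have s01 : 0 <= s < 1 by rewrite /s; apply/andP; split; lra.
have s0 : 0 < s by rewrite /s; lra.
have [B B0 HB] := conv_coef_bound ca s01.
pose b n : C := ofreal B * n%:R.
have cb : conv b.
  apply: (@conv_le b B 1) => n; rewrite /b cmodM cmod_ofreal cmod_nat expr1.
  by rewrite ger0_norm// ler_wpM2l// ler_nat.
have rs : 0 <= r / s < 1.
  by rewrite divr_ge0 ?(ltW s0)//= ltr_pdivrMr// mul1r /s; lra.
have [D HD] := cb _ rs; exists D => N; apply: le_trans (HD N).
apply: ler_sum => n _; rewrite /b /theta !cmodM cmod_nat cmod_ofreal ger0_norm//.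
have -> : r ^+ n = s ^+ n * (r / s) ^+ n by rewrite -exprMn mulrCA divff ?mulr1// gt_eqF.
have := HB n => /(ler_wpM2r (_ : 0 <= n%:R * (r / s) ^+ n)).
have /andP[x0 _] := rs.
by rewrite mulr_ge0 ?exprn_ge0// => /(_ isT); set x := r / s; lra.
Qed.

Lemma conv_diffs a : conv a -> conv (diffs a).
Proof. by move=> /conv_theta/conv_tail. Qed.

Lemma ev_theta a q : conv a -> cmod q < 1 -> ev (theta a) q = q * ev (diffs a) q.
Proof.
move=> ca q1; rewrite ev_split//; last exact: conv_theta.
by rewrite /theta mul0r add0r.
Qed.

(** Second-order remainder of a power, by the recursion obtained from one more factor [q + h]. The
    factor [p ^+ 2] on the left avoids [p ^ (n - 2)] for small [n]. *)
Lemma pow_taylor (q h : C) (p : R) n : 0 < p -> cmod q <= p -> cmod (q + h) <= p ->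
  cmod ((q + h) ^+ n - q ^+ n - n%:R * q ^+ n.-1 * h) * p ^+ 2
    <= n%:R ^+ 2 * p ^+ n * cmod h ^+ 2.
Proof.
move=> p0 qp qhp; elim: n => [|n IH].
  by rewrite !expr0 subrr !mul0r subrr cmod0 expr0n !mul0r.
have -> : (q + h) ^+ n.+1 - q ^+ n.+1 - n.+1%:R * q ^+ n.+1.-1 * h =
   (q + h) * ((q + h) ^+ n - q ^+ n - n%:R * q ^+ n.-1 * h) + n%:R * q ^+ n.-1 * h ^+ 2.
  case: n {IH} => [|n]; first by rewrite /= !expr0 !expr1; ring.
  by rewrite /= !exprS -!natr1; ring.
apply: le_trans (ler_wpM2r _ (cmodD _ _)) _; first by rewrite exprn_ge0// ltW.
rewrite mulrDl cmodM -[_ * _ * p ^+ 2]mulrA.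
have h0 := cmod_ge0 h; have ph := exprn_ge0 n (ltW p0).
have A1 := ler_pM (cmod_ge0 _) (mulr_ge0 (cmod_ge0 _) (exprn_ge0 2 (ltW p0))) qhp IH.
have A2 : cmod (n%:R * q ^+ n.-1 * h ^+ 2) * p ^+ 2 <= n%:R * p ^+ n.+1 * cmod h ^+ 2.
  rewrite (cmodM (_ * _)) (cmodM n%:R) cmod_nat !cmodX mulrAC ler_wpM2r ?exprn_ge0//.
  case: n {IH A1 ph} => [|n]; first by rewrite !mul0r.
  rewrite /= -mulrA ler_wpM2l// (_ : p ^+ n.+2 = p ^+ n * p ^+ 2); last by rewrite -exprD addn2.
  rewrite ler_wpM2r ?exprn_ge0 ?(ltW p0)//.
  by apply: lerXn2r; rewrite ?nnegrE ?cmod_ge0// ltW.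
apply: le_trans (lerD A1 A2) _.
rewrite mulrA -mulrDl ler_wpM2r ?exprn_ge0//.
rewrite mulrCA -exprS -mulrDl ler_wpM2r ?exprn_ge0 ?(ltW p0)//.
by rewrite -natrX -natrD -natrX ler_nat; lia.
Qed.

(** Termwise differentiation: for [p] halfway between [|q|] and 1, the remainders of [pow_taylor]
    are dominated by the convergent series of [n^2 |a n| p^n] times [|h|^2 / p^2]. *)
Lemma cder_ev a q : conv a -> cmod q < 1 -> cder (ev a) q (ev (diffs a) q).
Proof.
move=> ca q1 e e0.
pose p : R := (cmod q + 1) / 2.
have q0 := cmod_ge0 q.
have p0 : 0 < p by rewrite /p; lra.
have p1 : p < 1 by rewrite /p; lra.
have qp : cmod q < p by rewrite /p; lra.
have [|B HB] := conv_theta (conv_theta ca) (r := p); first by rewrite (ltW p0).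
have B0 : 0 <= B by have := HB 0%N; rewrite big_nil.
have Bp : 0 < (B + 1) / p ^+ 2 by rewrite divr_gt0 ?exprn_gt0//; lra.
exists (Num.min (p - cmod q) (e / ((B + 1) / p ^+ 2))) => [|h].
  by rewrite lt_min subr_gt0 qp divr_gt0.
rewrite lt_min => /andP[h1 h2].
have h0 := cmod_ge0 h.
have qh : cmod (q + h) <= p by have := cmodD q h; lra.
have qh1 : cmod (q + h) < 1 by lra.
rewrite mulrC /ev -sumCZ; last by apply: conv_asum => //; exact: conv_diffs.
rewrite -sumCB; [|exact: conv_asum..].
pose t n := theta a n * q ^+ n.-1 * h.
have tE : (fun n => h * (diffs a n * q ^+ n)) = (fun n => t n.+1).
  by apply: funext => n; rewrite /t /diffs /theta /=; ring.
have at1 : asum t.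
  by apply/asumS; rewrite -tE; apply: asumZ; apply: conv_asum => //; exact: conv_diffs.
rewrite tE (_ : sumC (fun n => t n.+1) = sumC t); last first.
  by rewrite (sumCS at1) {2}/t /theta !mul0r add0r.
rewrite -sumCB//; last by apply: asumD; [exact: conv_asum | apply: asumN; exact: conv_asum].
apply: (@le_trans _ _ (B / p ^+ 2 * cmod h ^+ 2)); last first.
  have : cmod h * ((B + 1) / p ^+ 2) <= e by rewrite -ler_pdivlMr// ltW.
  have : B / p ^+ 2 <= (B + 1) / p ^+ 2 by rewrite ler_wpM2r ?invr_ge0 ?exprn_ge0 ?(ltW p0)//; lra.
  move=> le1 le2; rewrite expr2 mulrA ler_wpM2r// mulrC.
  by apply: le_trans le2; exact: ler_wpM2l.
apply: cmod_sumC_le => N.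
rewrite mulrAC ler_pdivlMr ?exprn_gt0// mulr_suml.
apply: le_trans (ler_wpM2r (exprn_ge0 2 h0) (HB N)); rewrite mulr_suml.
apply: ler_sum => n _.
have -> : a n * (q + h) ^+ n - a n * q ^+ n - t n =
   a n * ((q + h) ^+ n - q ^+ n - n%:R * q ^+ n.-1 * h) by rewrite /t /theta; ring.
rewrite cmodM -[_ * _ * p ^+ 2]mulrA.
apply: le_trans (ler_wpM2l (cmod_ge0 (a n)) (pow_taylor n p0 (ltW qp) qh)) _.
by rewrite /theta !cmodM cmod_nat; rewrite le_eqVlt; apply/orP; left; apply/eqP; ring.
Qed.

Lemma cvgs_comp_cont (f : C -> C) (u : nat -> C) z l : cder f z l -> cvgs u z ->
  cvgs (fun n => f (u n)) (f z).
Proof.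
move=> df uz e e0; have [d d0 Hd] := cder_cont df e0; have [N HN] := uz _ d0.
by exists N => n Nn; have := Hd _ (HN _ Nn); rewrite subrKC.
Qed.

(** Identity theorem at 0: continuity gives the constant coefficient, after which the series is
    divided by the nonzero [u n] and the induction continues. *)
Lemma ev_eq0 a (u : nat -> C) : conv a -> cvgs u 0 ->
  (forall n, u n != 0 /\ cmod (u n) < 1 /\ ev a (u n) = 0) -> forall n, a n = 0.
Proof.
move=> ca u0 Hu n; elim: n a ca Hu => [|n IH] a ca Hu.
  rewrite -ev_zero; apply: (@cvgs_unique _ (fun n => ev a (u n))).
    by apply: cvgs_comp_cont u0; apply: cder_ev => //; rewrite cmod0 ltr01.
  by apply: (@cvgs_eq _ _ _ 0%N) => n _; have [_ []] := Hu n.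
have a0 : a 0%N = 0.
  rewrite -ev_zero; apply: (@cvgs_unique _ (fun n => ev a (u n))).
    by apply: cvgs_comp_cont u0; apply: cder_ev => //; rewrite cmod0 ltr01.
  by apply: (@cvgs_eq _ _ _ 0%N) => k _; have [_ []] := Hu k.
apply: (IH (fun n => a n.+1)) => [|k]; first exact: conv_tail.
have [uk [uk1 ek]] := Hu k; split => //; split => //.
move: ek; rewrite ev_split// a0 add0r => /eqP; rewrite mulf_eq0 (negbTE uk)/=.
by move/eqP.
Qed.

End PowerSeries.

(** * The complex exponential: derivative, power series and kernel *)

Section ComplexExponential.
Variable R : realType.
Local Notation C := (cplx R).
Implicit Types (z h : C) (x y : R).

Lemma real_linear_approx (f : R -> R) (l e : R) :
  is_derive (0 : R) (1 : R) f l -> 0 < e ->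
  exists2 d : R, 0 < d & forall x, `|x| < d -> `|f x - f 0 - l * x| <= e * `|x|.
Proof.
move=> /is_derive_epsP H /H[d d0 Hd]; exists d => // x /Hd.
by rewrite add0r.
Qed.

Definition cis y : C := Complex (cos y) (sin y).

Lemma cexpE z : cexp z = ofreal (expR (complex.Re z)) * cis (complex.Im z).
Proof. by []. Qed.

Lemma cmod_cis y : cmod (cis y) = 1.
Proof. by rewrite cmod_sqrt /= cos2Dsin2 sqrtr1. Qed.

Lemma cisD x y : cis (x + y) = cis x * cis y.
Proof. by apply: complex_eq; rewrite ?ReM ?ImM /= ?cosD ?sinD//; ring. Qed.

Lemma cexpD z h : cexp (z + h) = cexp z * cexp h.
Proof. by rewrite !cexpE ReD ImD expRD ofrealM cisD mulrACA. Qed.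

Lemma cexp0 : cexp (0 : C) = 1.
Proof. by rewrite cexpE /= expR0 /cis cos0 sin0 mul1r. Qed.

Lemma cexpNr z : cexp z * cexp (- z) = 1.
Proof. by rewrite -cexpD subrr cexp0. Qed.

Lemma cexp_neq0 z : cexp z != 0.
Proof.
by apply/negP => /eqP z0; have /eqP := cexpNr z; rewrite z0 mul0r eq_sym oner_eq0.
Qed.

Lemma cexpN z : cexp (- z) = (cexp z)^-1.
Proof. by apply: (mulfI (cexp_neq0 z)); rewrite cexpNr mulfV ?cexp_neq0. Qed.

Lemma cexpB z h : cexp (z - h) = cexp z / cexp h.
Proof. by rewrite cexpD cexpN. Qed.

Lemma cexpMn n z : cexp (n%:R * z) = cexp z ^+ n.
Proof.
elim: n => [|n IH]; first by rewrite mul0r cexp0.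
by rewrite -natr1 mulrDl mul1r cexpD IH exprSr.
Qed.

Lemma cmod_cexp z : cmod (cexp z) = expR (complex.Re z).
Proof.
by rewrite cexpE cmodM cmod_ofreal cmod_cis mulr1 ger0_norm// expR_ge0.
Qed.

(** The derivatives at 0 of the real [expR], [cos] and [sin] suffice, through a splitting into three
    pieces; the eighths of [e] share the error among them. *)
Lemma cexp_linear_approx (e : R) : 0 < e -> exists2 d : R, 0 < d & forall h,
  cmod h < d -> cmod (cexp h - 1 - h) <= e * cmod h.
Proof.
move=> e0; have e8 : 0 < e / 8 by rewrite divr_gt0.
have De : is_derive (0 : R) 1 expR 1 by have := is_derive_expR (0 : R); rewrite expR0.
have Dc : is_derive (0 : R) 1 cos 0 by have := is_derive_cos (0 : R); rewrite sin0 oppr0.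
have Ds : is_derive (0 : R) 1 sin 1 by have := is_derive_sin (0 : R); rewrite cos0.
have [d1 d10 H1] := real_linear_approx De e8.
have [d2 d20 H2] := real_linear_approx Dc e8.
have [d3 d30 H3] := real_linear_approx Ds e8.
have e8' : 0 < (e / 8) / (1 + e / 4) by rewrite divr_gt0//; lra.
exists (Num.min (Num.min d1 d2) (Num.min d3 ((e / 8) / (1 + e / 4)))) => [|h].
  by rewrite !lt_min d10 d20 d30.
rewrite !lt_min => /andP[/andP[h1 h2] /andP[h3 h4]].
set x := complex.Re h; set y := complex.Im h; set m := cmod h.
have xm : `|x| <= m := cmod_Re h; have ym : `|y| <= m := cmod_Im h.
have m0 : 0 <= m := cmod_ge0 h.
have {}H1 := H1 _ (le_lt_trans xm h1); have {}H2 := H2 _ (le_lt_trans ym h2).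
have {}H3 := H3 _ (le_lt_trans ym h3).
rewrite expR0 mul1r in H1; rewrite cos0 mul0r subr0 in H2; rewrite sin0 subr0 mul1r in H3.
have -> : cexp h - 1 - h = ofreal (expR x - 1 - x) * cis y + ofreal x * (cis y - 1)
    + Complex (cos y - 1) (sin y - y).
  rewrite cexpE -/x -/y (_ : h = Complex x y); last by apply: complex_eq.
  by apply: complex_eq; rewrite ?ReD ?ImD ?ReM ?ImM ?ReN ?ImN ?ReD ?ImD /=; ring.
have U : cmod (Complex (cos y - 1) (sin y - y)) <= e / 4 * m.
  apply: le_trans (cmod_le_ReIm _) _ => /=.
  have : e / 8 * `|y| <= e / 8 * m by rewrite ler_wpM2l// ltW.
  lra.
have V : cmod (cis y - 1) <= (1 + e / 4) * m.
  have -> : cis y - 1 = Complex (cos y - 1) (sin y - y) + Complex 0 y.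
    by apply: complex_eq; rewrite ?ReD ?ImD ?ReN ?ImN /=; ring.
  have : cmod (Complex 0 y : C) <= `|y| by apply: le_trans (cmod_le_ReIm _) _; rewrite /= normr0 add0r.
  have := cmodD (Complex (cos y - 1) (sin y - y)) (Complex 0 y : C); lra.
have W : cmod (ofreal x * (cis y - 1)) <= e / 8 * m.
  rewrite cmodM cmod_ofreal; apply: le_trans (ler_pM _ (cmod_ge0 _) xm V) _ => //.
  rewrite mulrA ler_wpM2r//; apply: ltW.
  by rewrite -ltr_pdivlMr//; lra.
have X : cmod (ofreal (expR x - 1 - x) * cis y) <= e / 8 * m.
  rewrite cmodM cmod_cis mulr1 cmod_ofreal; apply: le_trans H1 _.
  by rewrite ler_wpM2l// ltW.
have := cmodD (ofreal (expR x - 1 - x) * cis y + ofreal x * (cis y - 1)) (Complex (cos y - 1) (sin y - y)).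
have := cmodD (ofreal (expR x - 1 - x) * cis y) (ofreal x * (cis y - 1)).
have : 0 <= e * m by rewrite mulr_ge0// ltW.
lra.
Qed.

Lemma cder_cexp z : cder (@cexp R) z (cexp z).
Proof.
move=> e e0; have z0 : 0 < cmod (cexp z) by rewrite cmod_gt0 cexp_neq0.
have [d d0 Hd] := cexp_linear_approx (divr_gt0 e0 z0).
exists d => // h /Hd hh; rewrite cexpD.
have -> : cexp z * cexp h - cexp z - cexp z * h = cexp z * (cexp h - 1 - h) by ring.
rewrite cmodM mulrC -ler_pdivlMr//; apply: le_trans hh _.
by rewrite mulrAC.
Qed.

Lemma conv_exp_coeff : conv (fun n => (n`!%:R : C)^-1).
Proof.
apply: (@conv_le _ _ 1 0) => n; rewrite mul1r expr0 cmodV cmod_nat.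
by rewrite invf_le1 ?ltr0n ?fact_gt0// ler1n fact_gt0.
Qed.

(** The series times [cexp (- x)] has derivative 0 along the segment from 0. The disc of radius 1 is
    enough for the local study of the cosecant. *)
Lemma cexp_series z : cmod z < 1 -> cexp z = ev (fun n => (n`!%:R : C)^-1) z.
Proof.
move=> z1; set a := fun n => _.
have ca : conv a := conv_exp_coeff.
have da : diffs a = a.
  apply: funext => n; rewrite /diffs /a factS natrM invfM mulrA mulfV ?mul1r//.
suff : ev a 0 * cexp (- 0) = ev a z * cexp (- z).
  rewrite oppr0 cexp0 ev_zero /a fact0 invr1 mulr1 => /(congr1 ( *%R (cexp z))).
  by rewrite mulr1 mulrCA cexpNr mulr1.
apply: (@cder0_const R (fun x : C => ev a x * cexp (- x)) (0 : C) z) => t /andP[t0 t1].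
rewrite add0r subr0; set x := ofreal t * z.
have x1 : cmod x < 1.
  rewrite cmodM cmod_ofreal ger0_norm//; apply: le_lt_trans z1.
  by rewrite ler_piMl ?cmod_ge0.
apply: cder_eq (cderM (cder_ev ca x1) (cder_comp (cderN (cder_id x)) (cder_cexp (- x)))) _.
by rewrite da; ring.
Qed.

Lemma cexp_pii : cexp (ofreal pi * iunit R) = - 1.
Proof.
rewrite cexpE ReM ImM /= mul0r mulr0 mul0r subrr mulr1 addr0 expR0.
rewrite /cis cospi sinpi ofreal1 mul1r; apply: complex_eq; rewrite ?ReN ?ImN//=.
by rewrite oppr0.
Qed.

Lemma twopiiE : twopii R = 2 * (ofreal pi * iunit R).
Proof. by rewrite /twopii ofrealM (ofreal_nat R 2) mulrA. Qed.

Lemma cexp_2pii : cexp (twopii R) = 1.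
Proof. by rewrite twopiiE (cexpMn 2) cexp_pii sqrrN expr1n. Qed.

Lemma cexp_2piin n : cexp (twopii R * n%:R) = 1.
Proof. by rewrite mulrC cexpMn cexp_2pii expr1n. Qed.

Lemma cexp_2piiz (n : int) : cexp (twopii R * n%:~R) = 1.
Proof.
case: n => n; first exact: cexp_2piin.
by rewrite NegzE mulrNz mulrN cexpN cexp_2piin invr1.
Qed.

Lemma ofreal_int (n : int) : ofreal n%:~R = n%:~R :> C.
Proof.
case: n => n; first exact: ofreal_nat.
by rewrite NegzE !mulrNz ofrealN; congr (- _); exact: ofreal_nat.
Qed.

(** The modulus gives real part 0; the imaginary part is reduced to [y] in [[0, 2 pi[], and
    [1 - cos y = 2 sin^2 (y / 2)] forces [y = 0], since sine is positive on []0, pi[]. *)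
Lemma cexp_eq1 z : cexp z = 1 -> exists n : int, z = twopii R * n%:~R.
Proof.
move=> z1; have x0 : complex.Re z = 0.
  by apply: expR_inj; rewrite -cmod_cexp z1 cmod1 expR0.
have pi2 : 0 < 2 * pi :> R by rewrite mulr_gt0 ?pi_gt0.
pose k := Num.floor (complex.Im z / (2 * pi)).
pose y := complex.Im z - 2 * pi * k%:~R.
have /andP[k1 k2] : k%:~R <= complex.Im z / (2 * pi) < (k + 1)%:~R.
  exact: floor_itv.
have y0 : 0 <= y by rewrite /y subr_ge0 mulrC -ler_pdivlMr.
have y2 : y < 2 * pi.
  by rewrite /y ltrBlDr; move: k2; rewrite intrD ltr_pdivrMr//; lra.
have cy : cexp (Complex 0 y) = 1.
  have -> : Complex 0 y = z - twopii R * k%:~R.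
    apply: complex_eq; rewrite -ofreal_int ?ReD ?ImD ?ReN ?ImN ?ReM ?ImM /= ?x0; rewrite /y; ring.
  by rewrite cexpB z1 cexp_2piiz divr1.
have s0 : sin (y / 2) = 0.
  have := congr1 (@complex.Re R) cy.
  rewrite cexpE ReM /= expR0 mul1r mul0r subr0.
  have yE : y = (y / 2) *+ 2 by rewrite -mulr_natr divfK.
  rewrite {1}yE cos_mulr2n cos2sin2 mulrnBl -[X in X - _ - _](_ : 1 *+ 2 = _)// => H.
  have : sin (y / 2) ^+ 2 = 0 by lra.
  by move/eqP; rewrite sqrf_eq0 => /eqP.
have y00 : y = 0.
  apply/eqP; rewrite eq_le y0 andbT leNgt; apply/negP => yp.
  have : 0 < sin (y / 2) by apply: sin_gt0_pi; apply/andP; split; lra.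
  by rewrite s0 ltxx.
exists k; apply: complex_eq; rewrite -ofreal_int ?ReM ?ImM /= ?x0; first by ring.
have -> : complex.Im z = 2 * pi * k%:~R by apply/eqP; rewrite -subr_eq0 -/y y00.
ring.
Qed.

End ComplexExponential.

(** * Herglotz' trick for the sum of the [(z + n)^-2] *)

Section Herglotz.
Variable R : realType.
Local Notation C := (cplx R).
Implicit Types (z h : C).

Lemma natC_neq0 n : n.+1%:R != 0 :> C.
Proof. by rewrite pnatr_eq0. Qed.

Lemma inv_sqr_sum_le N : \sum_(0 <= n < N) (n.+1%:R ^+ 2)^-1 <= 2 :> R.
Proof.
(* The sharper bound is what the induction carries. *)
suff : forall N, \sum_(0 <= n < N.+1) (n.+1%:R ^+ 2)^-1 <= 2 - N.+1%:R^-1 :> R.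
  case: N => [|N] H; first by rewrite big_nil.
  by apply: le_trans (H N) _; rewrite gerBl invr_ge0.
elim=> [|n IH]; first by rewrite big_nat1 expr1n invr1; lra.
rewrite big_nat_recr//=; apply: le_trans (lerD IH (lexx _)) _.
have a0 : 0 < n.+1%:R :> R by rewrite ltr0n.
have -> : n.+2%:R = n.+1%:R + 1 :> R by rewrite natr1.
set a := n.+1%:R in a0 *.
have -> : 2 - a^-1 + ((a + 1) ^+ 2)^-1 = 2 - (a + 1)^-1 - (a * (a + 1) ^+ 2)^-1.
  by field; rewrite !gt_eqF//; lra.
by rewrite gerBl invr_ge0 mulr_ge0 ?exprn_ge0//; lra.
Qed.

(** The first [K] terms are absorbed into the constant [E], so that only a tail estimate has to be
    supplied. *)
Lemma asum_inv_sqr (a : nat -> C) K (D : R) :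
  (forall n, (K <= n)%N -> cmod (a n) <= D * (n.+1%:R ^+ 2)^-1) -> asum a.
Proof.
move=> H.
pose E := \sum_(0 <= n < K) cmod (a n) * n.+1%:R ^+ 2 + `|D|.
have E0 : 0 <= E.
  by rewrite addr_ge0// sumr_ge0// => i _; rewrite mulr_ge0 ?cmod_ge0 ?exprn_ge0.
apply: (@asum_le _ a (fun n => E * (n.+1%:R ^+ 2)^-1) (E * 2)) => [n|N]; last first.
  by rewrite -mulr_sumr ler_wpM2l// inv_sqr_sum_le.
rewrite ler_pdivlMr ?exprn_gt0 ?ltr0n//.
have [Kn|nK] := leqP K n.
  have := H _ Kn; rewrite ler_pdivlMr ?exprn_gt0 ?ltr0n// => /le_trans; apply.
  apply: le_trans (ler_norm D) _; rewrite lerDr sumr_ge0// => i _.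
  by rewrite mulr_ge0 ?cmod_ge0 ?exprn_ge0.
apply: ler_wpDr => //; rewrite big_mkord (bigD1 (Ordinal nK))//= lerDl.
by apply: sumr_ge0 => i _; rewrite mulr_ge0 ?cmod_ge0 ?exprn_ge0.
Qed.

Definition nonint z := forall n : int, z + n%:~R != 0.

Lemma nonintD z k : nonint z -> z + k%:R != 0.
Proof. by move=> /(_ k%:Z). Qed.

Lemma nonintB z k : nonint z -> z - k%:R != 0.
Proof. by move=> /(_ (- k%:Z)); rewrite mulrNz. Qed.

Lemma nonint_shift z (n : int) : nonint z -> nonint (z + n%:~R).
Proof. by move=> nz m; rewrite -addrA -intrD. Qed.

Lemma nonint_half z : nonint z -> nonint (z / 2).
Proof.
move=> nz n; apply: contra_neq (nz (n * 2)) => H.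
by rewrite intrM -[z](divfK (natC_neq0 1)) -mulrDl H mul0r.
Qed.

Lemma nonint_half1 z : nonint z -> nonint ((z + 1) / 2).
Proof. by move=> /(nonint_shift 1)/nonint_half. Qed.

Lemma Im_cexp z : complex.Im (cexp z) = expR (complex.Re z) * sin (complex.Im z).
Proof. by rewrite cexpE ImM /= mul0r addr0. Qed.

Lemma cmod_shift_ge z n : 2 * cmod z + 2 <= n%:R ->
  (n.+1%:R / 4 <= cmod (z + n%:R)) * (n.+1%:R / 4 <= cmod (z - n.+1%:R)).
Proof.
move=> H; have z0 := cmod_ge0 z; have n1 : n.+1%:R = n%:R + 1 :> R by rewrite natr1.
split.
  have := cmodD_ge (n%:R : C) z; rewrite (addrC (n%:R : C)) cmod_nat; lra.
have := cmodB_ge (n.+1%:R : C) z; rewrite cmodC cmod_nat; lra.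
Qed.

Lemma inv_sqr_shift_le z n : 2 * cmod z + 2 <= n%:R ->
  (cmod ((z + n%:R) ^- 2) <= 16 * (n.+1%:R ^+ 2)^-1)
  * (cmod ((z - n.+1%:R) ^- 2) <= 16 * (n.+1%:R ^+ 2)^-1).
Proof.
move=> /cmod_shift_ge[h1 h2].
have K (x : C) : n.+1%:R / 4 <= cmod x -> cmod (x ^- 2) <= 16 * (n.+1%:R ^+ 2)^-1.
  move=> hx; have n0 : 0 < n.+1%:R :> R by rewrite ltr0n.
  have x0 : 0 < cmod x by apply: lt_le_trans hx; rewrite divr_gt0.
  rewrite cmodV cmodX -[16]invrK -invfM lef_pV2 ?posrE ?mulr_gt0 ?exprn_gt0//.
  have -> : 16^-1 * n.+1%:R ^+ 2 = (n.+1%:R / 4) ^+ 2 :> R by field.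
  by apply: lerXn2r => //; rewrite nnegrE ?ltW// divr_gt0.
by split; apply: K.
Qed.

Lemma nat_above (x : R) : exists K, forall n, (K <= n)%N -> x <= n%:R.
Proof.
exists (Num.trunc `|x|).+1 => n Kn; apply: le_trans (ler_norm x) _.
apply: ltW; apply: lt_le_trans (_ : (Num.trunc `|x|).+1%:R <= n%:R); last by rewrite ler_nat.
exact: truncnS_gt.
Qed.

(** The integers [k] and [- (k + 1)] together, so that [k] in [nat] runs once through all
    integers. *)
Definition lip_u z k : C := (z + k%:R) ^- 2 + (z - k.+1%:R) ^- 2.
Definition lip z : C := sumC (lip_u z).

Lemma asum_inv_sqr_pos z : asum (fun k => (z + k%:R) ^- 2).
Proof.
have [K HK] := nat_above (2 * cmod z + 2).
by apply: (@asum_inv_sqr _ K 16) => n /HK /inv_sqr_shift_le[].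
Qed.

Lemma asum_inv_sqr_neg z : asum (fun k => (z - k.+1%:R) ^- 2).
Proof.
have [K HK] := nat_above (2 * cmod z + 2).
by apply: (@asum_inv_sqr _ K 16) => n /HK /inv_sqr_shift_le[].
Qed.

Lemma asum_lip z : asum (lip_u z).
Proof. exact: asumD (asum_inv_sqr_pos z) (asum_inv_sqr_neg z). Qed.

Lemma cvgs_subseq (u : nat -> C) l (f : nat -> nat) :
  (forall n, (n <= f n)%N) -> cvgs u l -> cvgs (fun n => u (f n)) l.
Proof.
by move=> nf ul e /ul[N HN]; exists N => n Nn; apply: HN; exact: leq_trans (nf n).
Qed.

Lemma sum_nat_double (V : zmodType) (f : nat -> V) N :
  \sum_(0 <= k < N.*2) f k = \sum_(0 <= k < N) (f k.*2 + f k.*2.+1).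
Proof.
elim: N => [|N IH]; first by rewrite !big_nil.
by rewrite doubleS !big_nat_recr//= IH addrA.
Qed.

Lemma natr_double (V : pzRingType) k : k.*2%:R = 2 * k%:R :> V.
Proof. by rewrite -mul2n natrM. Qed.

(** The translates of [z / 2] account for the even integers and those of [(z + 1) / 2] for the odd
    ones; the squares contribute the factor 4. *)
Lemma lip_double z : nonint z -> lip (z / 2) + lip ((z + 1) / 2) = 4 * lip z.
Proof.
move=> nz; rewrite /lip -sumCD; [|exact: asum_lip..].
apply: cvg_sumC.
have := cvgsZ 4 (cvgs_subseq (fun n => _ : n <= n.*2)%N (asum_cvg (asum_lip z))).
rewrite (_ : (fun n => _) = (fun N =>
  \sum_(0 <= n < N) (lip_u (z / 2) n + lip_u ((z + 1) / 2) n))); last first.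
  apply: funext => N; rewrite sum_nat_double mulr_sumr; apply: eq_bigr => k _.
  have z1 := nonintD k.*2 nz; have z2 := nonintD k.*2.+1 nz.
  have z3 := nonintB k.*2.+1 nz; have z4 := nonintB k.*2.+2 nz.
  have n1 : k.*2.+1%:R = 2 * k%:R + 1 :> C by rewrite -natr_double natr1.
  have n2 : k.*2.+2%:R = 2 * k%:R + 1 + 1 :> C by rewrite -n1 natr1.
  move: z1 z2 z3 z4; rewrite /lip_u n1 n2 natr_double -[k.+1%:R]natr1 => z1 z2 z3 z4.
  have -> : z / 2 + k%:R = (z + 2 * k%:R) / 2 by field.
  have -> : z / 2 - (k%:R + 1) = (z - (2 * k%:R + 1 + 1)) / 2 by field.
  have -> : (z + 1) / 2 + k%:R = (z + (2 * k%:R + 1)) / 2 by field.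
  have -> : (z + 1) / 2 - (k%:R + 1) = (z - (2 * k%:R + 1)) / 2 by field.
  have H4 (x : C) : (x / 2) ^- 2 = 4 * x ^- 2.
    by rewrite expr_div_n invf_div; congr (_ * _); ring.
  by rewrite !H4; ring.
by apply => n; rewrite -addnn leq_addr.
Qed.

Lemma asum_cvg0 (a : nat -> C) : asum a -> cvgs a 0.
Proof.
move=> /asum_cvg H; have := cvgsB ((cvgsS _ _).2 H) H.
rewrite subrr (_ : (fun n => _) = a)//; apply: funext => n.
by rewrite big_nat_recr//= addrAC subrr add0r.
Qed.

(** The difference of the partial sums telescopes to two boundary terms tending to 0. *)
Lemma lip_periodic z : nonint z -> lip (z + 1) = lip z.
Proof.
move=> nz; apply/eqP; rewrite -subr_eq0; apply/eqP.
rewrite /lip -sumCB; [|exact: asum_lip..]; apply: cvg_sumC.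
apply/cvgsS.
have := cvgsB (asum_cvg0 ((asumS _).2 (asum_inv_sqr_pos z))) (asum_cvg0 (asum_inv_sqr_neg z)).
rewrite subr0 (_ : (fun n => (_ : C)) = (fun n => \sum_(0 <= n0 < n.+1) (lip_u (z + 1) n0 - lip_u z n0)))//.
apply: funext => n; elim: n => [|n IH].
  by rewrite big_nat1 /lip_u !addr0 addrK; ring.
rewrite big_nat_recr//= -IH /lip_u.
have -> : z + 1 + n.+1%:R = z + n.+2%:R by rewrite -[n.+2%:R]natr1; ring.
have -> : z + 1 - n.+2%:R = z - n.+1%:R by rewrite -[n.+2%:R]natr1; ring.
ring.
Qed.

(** In this strip [|z + n| >= |n| / 2] for [n != 0], so each half of the remaining sum is at most
    [4 * 2]. *)
Lemma lip_bound z : `|complex.Re z| <= 1 / 2 -> cmod (lip z - z ^- 2) <= 16.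
Proof.
move=> zr.
have K (x : R) : (0 <= x) -> (x + 1) / 2 <= cmod (z + ofreal (x + 1)) /\
    (x + 1) / 2 <= cmod (z - ofreal (x + 1)).
  move=> x0; move: zr; rewrite ler_norml => /andP[r1 r2]; split.
    by apply: le_trans (cmod_Re _); rewrite ReD /= ger0_norm; lra.
  by apply: le_trans (cmod_Re _); rewrite ReD ReN /= ler0_norm; lra.
have L n (x : C) : (n%:R + 1) / 2 <= cmod x -> cmod (x ^- 2) <= 4 * (n.+1%:R ^+ 2)^-1.
  rewrite natr1 => hx; have n0 : 0 < n.+1%:R :> R by rewrite ltr0n.
  have x0 : 0 < cmod x by apply: lt_le_trans hx; rewrite divr_gt0.
  rewrite cmodV cmodX -[4]invrK -invfM lef_pV2 ?posrE ?mulr_gt0 ?exprn_gt0//.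
  have -> : 4^-1 * n.+1%:R ^+ 2 = (n.+1%:R / 2) ^+ 2 :> R by field.
  by apply: lerXn2r => //; rewrite nnegrE ?ltW// divr_gt0.
have nE n : n.+1%:R = ofreal (n%:R + 1) :> C by rewrite natr1 ofreal_nat.
rewrite /lip sumCD; [|exact: asum_inv_sqr_pos|exact: asum_inv_sqr_neg].
rewrite sumCS; last exact: asum_inv_sqr_pos.
rewrite addr0; set A := sumC _; set B := sumC _.
have -> : z ^- 2 + A + B - z ^- 2 = A + B by ring.
rewrite /A /B.
have B1 : cmod (sumC (fun n => (z + n.+1%:R) ^- 2)) <= 8.
  apply: cmod_sumC_le => N; apply: (@le_trans _ _ (\sum_(0 <= n < N) 4 * (n.+1%:R ^+ 2)^-1)).
    apply: ler_sum => n _; apply: L; rewrite nE.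
    by have [] := K n%:R (ler0n _ _).
  by rewrite -mulr_sumr; have := inv_sqr_sum_le N; lra.
have B2 : cmod (sumC (fun n => (z - n.+1%:R) ^- 2)) <= 8.
  apply: cmod_sumC_le => N; apply: (@le_trans _ _ (\sum_(0 <= n < N) 4 * (n.+1%:R ^+ 2)^-1)).
    apply: ler_sum => n _; apply: L; rewrite nE.
    by have [] := K n%:R (ler0n _ _).
  by rewrite -mulr_sumr; have := inv_sqr_sum_le N; lra.
have := cmodD (sumC (fun n => (z + n.+1%:R) ^- 2)) (sumC (fun n => (z - n.+1%:R) ^- 2)); lra.
Qed.

Lemma twopiiC : twopii R = Complex 0 (2 * pi).
Proof. by apply: complex_eq; rewrite /twopii ?ReM ?ImM /=; ring. Qed.

Lemma Im_twopii z : complex.Im (twopii R * z) = 2 * pi * complex.Re z.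
Proof. by rewrite twopiiC ImM /=; ring. Qed.

Lemma Re_twopii z : complex.Re (twopii R * z) = - (2 * pi * complex.Im z).
Proof. by rewrite twopiiC ReM /=; ring. Qed.

Lemma qpar_neq1 z : nonint z -> qpar z != 1.
Proof.
move=> nz; apply/eqP => /cexp_eq1[n]; have t0 : twopii R != 0.
  rewrite -cmod_gt0 /twopii cmodM cmod_ofreal gtr0_norm ?mulr_gt0 ?pi_gt0//.
  by rewrite cmod_gt0; apply/eqP => /(congr1 (@complex.Im R))/eqP; rewrite oner_eq0.
move=> /(mulfI t0) zn; have := nz (- n).
by rewrite zn mulrNz subrr eqxx.
Qed.

Lemma twopii_neq0 : twopii R != 0.
Proof.
rewrite -cmod_gt0 /twopii cmodM cmod_ofreal gtr0_norm ?mulr_gt0 ?pi_gt0//.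
by rewrite cmod_gt0; apply/eqP => /(congr1 (@complex.Im R))/eqP; rewrite oner_eq0.
Qed.

Lemma qparD z h : qpar (z + h) = qpar z * qpar h.
Proof. by rewrite /qpar mulrDr cexpD. Qed.

Lemma qpar_int (n : int) : qpar (n%:~R : C) = 1.
Proof. exact: cexp_2piiz. Qed.

Lemma qpar_half : qpar (1 / 2 : C) = -1.
Proof.
rewrite /qpar twopiiE (_ : _ * _ = ofreal pi * iunit R) ?cexp_pii//.
by field.
Qed.

(** This is [pi^2 / sin^2 (pi z)]. *)
Definition csc2 z : C := twopii R ^+ 2 * (qpar z / (1 - qpar z) ^+ 2).

Lemma csc2_periodic z (n : int) : csc2 (z + n%:~R) = csc2 z.
Proof. by rewrite /csc2 qparD qpar_int mulr1. Qed.

Lemma csc2_double z : nonint z -> csc2 (z / 2) + csc2 ((z + 1) / 2) = 4 * csc2 z.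
Proof.
move=> nz; rewrite /csc2.
have y1 := qpar_neq1 (nonint_half nz).
have y2 := qpar_neq1 (nonint_half1 nz).
have -> : qpar z = qpar (z / 2) ^+ 2.
  by rewrite expr2 -qparD; congr qpar; field.
have E : qpar ((z + 1) / 2) = - qpar (z / 2).
  by rewrite mulrDl qparD qpar_half mulrN1.
rewrite E in y2 *.
set y := qpar (z / 2) in y1 y2 *.
have a1 : 1 - y != 0 by rewrite subr_eq0 eq_sym.
have a2 : 1 + y != 0 by rewrite -[y]opprK subr_eq0 eq_sym.
have -> : 1 - y ^+ 2 = (1 - y) * (1 + y) by ring.
by rewrite opprK; field; rewrite a1 a2.
Qed.

(** With [v = u / 2] the quotient is [(e^v - e^-v)^-2], and [|e^v - e^-v|] is at least [|Re v|] and
    at least [|sin (Im v)|]. Either [|Re v| >= 1/8], or [|Im v|] lies between [1/8] and [pi / 2]. *)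
Lemma exp_csc_far (u : C) : 1 / 2 <= cmod u -> `|complex.Im u| <= pi ->
  cmod (cexp u / (1 - cexp u) ^+ 2) <= (Num.min (1 / 8) (sin (1 / 8 : R))) ^- 2.
Proof.
move=> u1 uim; pose v := u / 2.
have vv : u = v + v by rewrite /v; field.
have s0 : 0 < sin (1 / 8 : R).
  by have pi2 := pi_ge2 R; apply: sin_gt0_pi; apply/andP; split; lra.
set c := Num.min _ _; have c0 : 0 < c by rewrite lt_min s0 andbT; lra.
have ev0 := cexp_neq0 v.
set x := complex.Re v; set y := complex.Im v.
have xE : complex.Re u = x + x by rewrite vv ReD.
have yE : complex.Im u = y + y by rewrite vv ImD.
have ex := expR_ge1Dx `|x|.
have ex1 : 1 <= expR `|x| by have := normr_ge0 x; lra.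
have exN : expR (- `|x|) <= 1 by rewrite expR_le1 oppr_le0.
have exN0 := expR_ge0 (- `|x|).
have L1 : `|x| <= cmod (cexp v - cexp (- v)).
  have [x0|x0] := leP 0 x.
    have := cmodB_ge (cexp v) (cexp (- v)).
    by rewrite !cmod_cexp ReN -/x; move: ex exN; rewrite ger0_norm//; lra.
  have := cmodB_ge (cexp (- v)) (cexp v).
  by rewrite cmodC !cmod_cexp ReN -/x; move: ex exN; rewrite ltr0_norm// opprK; lra.
have L2 : `|sin y| <= cmod (cexp v - cexp (- v)).
  apply: le_trans (cmod_Im _).
  rewrite ImD ImN !Im_cexp ReN ImN -/x -/y sinN mulrN opprK -mulrDl normrM.
  rewrite ler_peMl// ger0_norm ?addr_ge0 ?expR_ge0//.
  have [x0|x0] := leP 0 x.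
    by move: ex1 exN0; rewrite ger0_norm//; lra.
  by move: ex1 exN0; rewrite ltr0_norm// opprK; lra.
have L3 : c <= cmod (cexp v - cexp (- v)).
  have := cmod_le_ReIm u; rewrite xE yE => uu.
  have [x8|x8] := leP (1 / 8) `|x|.
    by apply: le_trans L1; rewrite ge_min x8.
  have y8 : 1 / 8 <= `|y|.
    by have := ler_normD x x; have := ler_normD y y; lra.
  apply: le_trans L2; rewrite ge_min; apply/orP; right.
  have yp : `|y| <= pi / 2.
    by move: uim; rewrite yE -mulr2n normrMn -mulr_natr; lra.
  have -> : `|sin y| = sin `|y|.
    have [y0|y0] := leP 0 y.
      move: yp; rewrite (ger0_norm y0) => yp; have pi0 := pi_ge0 R.
      by rewrite ger0_norm// sin_ge0_pi//; apply/andP; split; lra.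
    move: yp; rewrite (ltr0_norm y0) => yp; have pi0 := pi_ge0 R.
    by rewrite -normrN -sinN ger0_norm// sin_ge0_pi//; apply/andP; split; lra.
  rewrite leNgt; apply/negP; rewrite ltr_sin ?in_itv/=; first by lra.
    by have pi2 := pi_ge2 R; apply/andP; split; lra.
  by have pi2 := pi_ge2 R; apply/andP; split; lra.
have -> : cexp u / (1 - cexp u) ^+ 2 = (cexp v - cexp (- v)) ^- 2.
  have d0 : cexp v - cexp (- v) != 0 by rewrite -cmod_gt0; apply: lt_le_trans L3.
  have e0 : 1 - cexp u != 0.
    move: d0; apply: contra_neq => H.
    by rewrite cexpN; apply: (mulfI ev0); rewrite mulr0 mulrBr mulfV// -cexpD -vv -opprB H oppr0.
  move: d0 e0; rewrite vv cexpN cexpD; set w := cexp v in ev0 * => d0 e0.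
  have w1 : w * w - 1 != 0 by rewrite -opprB oppr_eq0.
  by field; rewrite ev0 w1 e0.
rewrite cmodV cmodX lef_pV2 ?posrE ?exprn_gt0//; last by apply: lt_le_trans L3.
by apply: lerXn2r => //; rewrite nnegrE ltW// (lt_le_trans c0).
Qed.

(** [ev (a k) u] is the sum of the [u^n / (n + k)!]. Writing [e^u = 1 + u E1], [E1 = 1 + u E2],
    [E2 = 1/2 + u E3], the terms in [u^-2] and [u^-1] cancel and [(E2 - 2 E3 - E2^2) / E1^2]
    remains, with [|E1| >= 1/2]. *)
Lemma exp_csc_near (u : C) : u != 0 -> cmod u <= 1 / 2 ->
  cmod (cexp u / (1 - cexp u) ^+ 2 - u ^- 2) <= 16.
Proof.
move=> u0 u1; have u1' : cmod u < 1 by lra.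
pose a k n : C := ((n + k)%N`!%:R)^-1.
have ca k : conv (a k).
  elim: k => [|k IH]; last by have := conv_tail IH; rewrite /a; under eq_fun do rewrite addSnnS.
  by rewrite /a; under eq_fun do rewrite addn0; exact: conv_exp_coeff.
have sp k : ev (a k) u = (k`!%:R)^-1 + u * ev (a k.+1) u.
  by rewrite ev_split//; congr (_ + _ * _); apply: eq_ev => n; rewrite /a addSnnS.
have bd k (B : R) : 0 <= B -> (forall n, ((n + k)%N`!%:R)^-1 <= B) -> cmod (ev (a k) u) <= 2 * B.
  move=> B0 HB; apply: cmod_sumC_le => N.
  apply: (@le_trans _ _ (\sum_(0 <= n < N) B * (1 / 2) ^+ n)).
    apply: ler_sum => n _; rewrite cmodM cmodX /a cmodV cmod_nat; apply: ler_pM; rewrite ?invr_ge0 ?exprn_ge0 ?cmod_ge0//.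
    by apply: lerXn2r; rewrite ?nnegrE ?cmod_ge0//; lra.
  rewrite -mulr_sumr mulrC ler_wpM2r//.
  apply: le_trans (geometric_bound _ _) _; first by lra.
  by rewrite (_ : 1 - 1 / 2 = 2^-1) ?invrK//; lra.
have fk k n : ((n + k.+2)%N`!%:R)^-1 <= 2^-1 :> R.
  rewrite lef_pV2 ?posrE ?ltr0n ?fact_gt0// ler_nat.
  by rewrite !addnS !factS; have := fact_gt0 (n + k); nia.
have B2 : cmod (ev (a 2) u) <= 1 by have := bd 2 2^-1 _ (fk 0%N); rewrite mulfV//; apply.
have B3 : cmod (ev (a 3) u) <= 1 by have := bd 3 2^-1 _ (fk 1%N); rewrite mulfV//; apply.
have e0 : cexp u = 1 + u * ev (a 1) u.
  have := sp 0%N; rewrite fact0 invr1 => <-; rewrite cexp_series//.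
  by apply: eq_ev => n; rewrite /a addn0.
have e1 : ev (a 1) u = 1 + u * ev (a 2) u by rewrite sp (_ : 1`! = 1)%N// invr1.
have e2 : ev (a 2) u = 2^-1 + u * ev (a 3) u by rewrite sp.
set E1 := ev (a 1) u in e0 e1; set E2 := ev (a 2) u in e1 e2 B2; set E3 := ev (a 3) u in e2 B3.
have E1h : 1 / 2 <= cmod E1.
  rewrite e1; have := cmodD_ge 1 (u * E2); rewrite cmod1 cmodM.
  have : cmod u * cmod E2 <= 1 / 2 * 1 by apply: ler_pM => //; exact: cmod_ge0.
  lra.
have E10 : E1 != 0 by rewrite -cmod_gt0; lra.
have -> : cexp u / (1 - cexp u) ^+ 2 - u ^- 2 = (E2 - 2 * E3 - E2 ^+ 2) / E1 ^+ 2.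
  have -> : 1 - cexp u = - (u * E1) by rewrite e0; ring.
  have -> : E2 - 2 * E3 - E2 ^+ 2 = (cexp u - E1 ^+ 2) / u ^+ 2.
    have u20 : u ^+ 2 != 0 by rewrite expf_neq0.
    apply: (mulIf u20); rewrite divfK// e0 e1.
    have e3 : 2 * u * E3 = 2 * E2 - 1 by rewrite e2; field.
    have -> : (E2 - 2 * E3 - E2 ^+ 2) * u ^+ 2 =
      E2 * u ^+ 2 - u * (2 * u * E3) - E2 ^+ 2 * u ^+ 2 by ring.
    by rewrite e3; ring.
  by field; rewrite E10 u0.
rewrite cmod_div cmodX ler_pdivrMr ?exprn_gt0 ?cmod_gt0//.
have E0 := cmod_ge0 E2.
have N1 : cmod (E2 - 2 * E3 - E2 ^+ 2) <= 4.
  have := cmodD (E2 - 2 * E3) (- E2 ^+ 2); rewrite -[cmod (- _ ^+ 2)]/(cmod (- (E2 ^+ 2))) cmodN cmodX.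
  have := cmodD E2 (- (2 * E3)); rewrite cmodN cmodM (cmod_nat _ 2).
  have : cmod E2 ^+ 2 <= 1 by rewrite exprn_ile1.
  lra.
have : (1 / 2) ^+ 2 <= cmod E1 ^+ 2 by apply: lerXn2r; rewrite ?nnegrE//; lra.
rewrite (_ : (1 / 2) ^+ 2 = 1 / 4); last by field.
lra.
Qed.

Lemma geometric_small (x B : R) : (forall k : nat, x <= B / 2 ^+ k) -> x <= 0.
Proof.
move=> H; rewrite leNgt; apply/negP => x0.
have [K HK] := nat_above (B / x + 1).
have {HK}HK := HK _ (leqnn K).
have k2 : K%:R <= 2 ^+ K :> R by rewrite -natrX ler_nat ltnW// ltn_expl.
have p2 : 0 < 2 ^+ K :> R by rewrite exprn_gt0.
have := H K; rewrite ler_pdivlMr// leNgt => /negP; apply.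
have : B / x < 2 ^+ K by lra.
by rewrite ltr_pdivrMr// mulrC.
Qed.

Lemma csc2_bound : exists B : R, forall z, nonint z -> `|complex.Re z| <= 1 / 2 ->
  cmod (csc2 z - z ^- 2) <= B.
Proof.
pose t := cmod (twopii R) ^+ 2.
pose M := (Num.min (1 / 8) (sin (1 / 8 : R))) ^- 2.
have M0 : 0 <= M by rewrite invr_ge0 sqr_ge0.
have t0 : 0 <= t by rewrite exprn_ge0 ?cmod_ge0.
exists (t * (M + 16)) => z nz zr.
have z0 : z != 0 by have := nz 0; rewrite addr0.
pose u := twopii R * z.
have u0 : u != 0 by rewrite mulf_neq0 ?twopii_neq0.
have -> : csc2 z - z ^- 2 = twopii R ^+ 2 * (cexp u / (1 - cexp u) ^+ 2 - u ^- 2).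
  rewrite /csc2 /qpar -/u mulrBr; congr (_ - _); rewrite /u.
  by field; rewrite z0 twopii_neq0.
rewrite cmodM cmodX; apply: ler_wpM2l => //.
have [h|h] := leP (1 / 2) (cmod u); last first.
  by apply: le_trans (exp_csc_near u0 (ltW h)) _; rewrite lerDr.
have uim : `|complex.Im u| <= pi.
  have pi0 := pi_gt0 R.
  by rewrite /u Im_twopii normrM gtr0_norm ?mulr_gt0//; nra.
apply: le_trans (cmodD _ _) _; rewrite cmodN; apply: lerD; first exact: exp_csc_far.
rewrite cmodV cmodX -[16]invrK lef_pV2 ?posrE ?invr_gt0 ?exprn_gt0//; last by lra.
by have : (1 / 2) ^+ 2 <= cmod u ^+ 2; [apply: lerXn2r; rewrite ?nnegrE//; lra|lra].
Qed.

(* Herglotz: the difference is bounded and satisfies F(z/2) + F((z+1)/2) = 4 F(z). *)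
Lemma lip_csc2 z : nonint z -> lip z = csc2 z.
Proof.
have [B HB] := csc2_bound.
pose F z := lip z - csc2 z.
have Fper (n : nat) x : nonint x -> F (x + n%:R) = F x.
  move=> nx; elim: n => [|n IH]; first by rewrite addr0.
  rewrite -IH -natr1 addrA /F -(csc2_periodic (x + n%:R) 1) lip_periodic//.
  exact: nonint_shift n%:Z nx.
have FperZ (n : int) x : nonint x -> F (x + n%:~R) = F x.
  case: n => n nx; first exact: Fper.
  have nx' : nonint (x + (Negz n)%:~R) by exact: nonint_shift.
  by rewrite -(Fper n.+1 _ nx') NegzE mulrNz subrK.
(* Periodicity moves any point to the strip [|Re| <= 1/2], where the double poles at 0 cancel. *)
have FB x : nonint x -> cmod (F x) <= B + 16.
  move=> nx; pose n := Num.floor (complex.Re x + 1 / 2).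
  have /andP[n1 n2] := floor_itv (complex.Re x + 1 / 2).
  rewrite -(FperZ (- n) x nx); set y := x + _.
  have ny : nonint y by exact: nonint_shift.
  have yr : `|complex.Re y| <= 1 / 2.
    rewrite /y -ofreal_int ReD /= mulrNz ler_norml.
    by move: n1 n2; rewrite -/n intrD; lra.
  have := HB _ ny yr; have := lip_bound yr.
  have -> : F y = (lip y - y ^- 2) - (csc2 y - y ^- 2) by rewrite /F; ring.
  by have := cmodD (lip y - y ^- 2) (- (csc2 y - y ^- 2)); rewrite cmodN; lra.
have FD x : nonint x -> F (x / 2) + F ((x + 1) / 2) = 4 * F x.
  by move=> nx; rewrite /F mulrBr -lip_double// -csc2_double//; ring.
(* A bound [M] for [|F|] improves to [2 M / 4] by the functional equation. *)
have Fk k x : nonint x -> cmod (F x) <= (B + 16) / 2 ^+ k.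
  elim: k x => [|k IH] x nx; first by rewrite expr0 divr1 FB.
  have := IH _ (nonint_half nx); have := IH _ (nonint_half1 nx).
  have := cmodD (F (x / 2)) (F ((x + 1) / 2)); rewrite FD// cmodM (cmod_nat _ 4).
  by rewrite exprS invfM mulrCA; lra.
move=> nz; apply/eqP; rewrite -subr_eq0 -cmod_eq0 eq_le cmod_ge0 andbT.
by apply: (@geometric_small _ (B + 16)) => k; exact: Fk.
Qed.

End Herglotz.

(** * Lambert series and the [q]-expansions of Eisenstein series *)

Section Lambert.
Variable R : realType.
Local Notation C := (cplx R).
Implicit Types (q x : C).

Lemma conv_cst (c : C) : conv (fun=> c).
Proof. by apply: (@conv_le _ _ (cmod c) 0) => n; rewrite expr0 mulr1. Qed.

Lemma neq1_of_cmod_lt1 x : cmod x < 1 -> 1 - x != 0.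
Proof.
by move=> x1; rewrite subr_eq0; apply: contraTneq x1 => <-; rewrite cmod1 ltxx.
Qed.

Lemma ev_geometric x : cmod x < 1 -> ev (fun=> 1) x = (1 - x)^-1.
Proof.
move=> x1; have n0 := neq1_of_cmod_lt1 x1.
apply: (mulfI n0); rewrite mulfV// mulrBl mul1r {1}ev_split ?addrK//.
exact: conv_cst.
Qed.

Lemma ev_succ x : cmod x < 1 -> ev (fun k => k.+1%:R) x = (1 - x) ^- 2.
Proof.
move=> x1; rewrite -exprVn -ev_geometric// expr2 -ev_cauchy_prod//; [|exact: conv_cst..].
apply: eq_ev => k; rewrite /cauchy_prod (eq_bigr (fun=> 1)) => [|i _]; last exact: mulr1.
by rewrite sumr_const card_ord.
Qed.

Lemma asum2_prod (a : nat -> nat -> C) (u v : nat -> R) (A B : R) :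
  (forall m n, cmod (a m n) <= u m * v n) ->
  (forall m, 0 <= u m) -> (forall n, 0 <= v n) ->
  (forall M, \sum_(0 <= m < M) u m <= A) -> (forall N, \sum_(0 <= n < N) v n <= B) ->
  asum2 a.
Proof.
move=> auv u0 v0 uA vB; exists (A * B) => M N.
apply: (@le_trans _ _ (\sum_(0 <= m < M) \sum_(0 <= n < N) u m * v n)).
  by apply: ler_sum => m _; apply: ler_sum.
under eq_bigr do rewrite -mulr_sumr.
by rewrite -mulr_suml; apply: ler_pM => //; apply: sumr_ge0.
Qed.

Definition divsum (f : nat -> C) n : C := \sum_(d <- divisors n) f d.

Lemma big_divisors (V : nmodType) (f : nat -> V) n :
  \sum_(d <- divisors n.+1) f d = \sum_(0 <= k < n.+1 | (k.+1 %| n.+1)%N) f k.+1.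
Proof.
rewrite -(big_map succn (fun d => d %| n.+1)%N f).
rewrite -[RHS]big_filter; apply: perm_big; apply: uniq_perm.
- exact: divisors_uniq.
- by rewrite filter_uniq// map_inj_uniq ?iota_uniq// => ? ? [].
move=> d; rewrite mem_filter -dvdn_divisors//.
have [dn|//] := boolP (d %| n.+1)%N.
have d0 := dvdn_gt0 (ltn0Sn n) dn; have := dvdn_leq (ltn0Sn n) dn.
case: d d0 dn => // d _ _; rewrite ltnS => dn.
by symmetry; rewrite andTb; apply/mapP; exists d; rewrite // mem_index_iota.
Qed.

Lemma divisors_codivisor (V : nmodType) (f : nat -> V) n :
  \sum_(d <- divisors n.+1) f (n.+1 %/ d)%N = \sum_(d <- divisors n.+1) f d.
Proof.
rewrite -(big_map (fun d => n.+1 %/ d)%N predT f).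
apply: perm_big; apply: uniq_perm; rewrite ?divisors_uniq//.
  rewrite map_inj_in_uniq ?divisors_uniq// => d e.
  rewrite -!dvdn_divisors// => dn en H.
  have d0 := dvdn_gt0 (ltn0Sn n) dn; have dle := dvdn_leq (ltn0Sn n) dn.
  have nd0 : (0 < n.+1 %/ d)%N by rewrite divn_gt0.
  apply/eqP; rewrite -(eqn_pmul2l nd0); apply/eqP.
  by rewrite divnK// H divnK.
move=> d; apply/mapP/idP.
  move=> [e]; rewrite -!dvdn_divisors// => en ->.
  by apply/dvdnP; exists e; rewrite mulnC divnK.
rewrite -dvdn_divisors// => dn; exists (n.+1 %/ d)%N.
  by rewrite -dvdn_divisors//; apply/dvdnP; exists d; rewrite mulnC divnK.
have [k kE] := dvdnP dn; rewrite kE mulnK ?(dvdn_gt0 _ dn)// mulKn//.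
by move: kE; case: k.
Qed.

(* Lambert series: collecting the terms of sum_{n,k >= 1} f(k) q^(nk) with nk = N. *)
Lemma lambert (f : nat -> C) q : conv f -> cmod q < 1 ->
  asum (fun n => sumC (fun k => f k.+1 * q ^+ (n.+1 * k.+1))) /\
  sumC (fun n => sumC (fun k => f k.+1 * q ^+ (n.+1 * k.+1)))
  = sumC (fun N => divsum f N.+1 * q ^+ N.+1).
Proof.
move=> cf q1; set r := cmod q; have r0 : 0 <= r := cmod_ge0 q.
have [|B HB] := conv_tail cf (r := r); first by rewrite r0.
have B0 : 0 <= B by have := HB 0%N; rewrite big_nil.
pose b n k := f k.+1 * q ^+ (n.+1 * k.+1).
pose D := (1 - r)^-1 * B.
have bb M N : \sum_(0 <= n < M) \sum_(0 <= k < N) cmod (b n k) <= D.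
  apply: (@le_trans _ _ (\sum_(0 <= n < M) \sum_(0 <= k < N) r ^+ n * (cmod (f k.+1) * r ^+ k))).
    apply: ler_sum => n _; apply: ler_sum => k _.
    rewrite /b cmodM cmodX mulrCA ler_wpM2l ?cmod_ge0// -exprD.
    by apply: ler_wiXn2l => //; [exact: ltW | rewrite mulSn mulnS; lia].
  under eq_bigr do rewrite -mulr_sumr.
  rewrite -mulr_suml; apply: ler_pM => //.
  - by apply: sumr_ge0 => ? _; rewrite exprn_ge0.
  - by apply: sumr_ge0 => ? _; rewrite mulr_ge0 ?cmod_ge0 ?exprn_ge0.
  - by apply: geometric_bound; rewrite r0.
have b2 : asum2 b by exists D.
(* Row [n] regrouped by the exponent [N + 1]: only multiples of [n + 1] survive, one in each block
   of length [n + 1]. *)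
pose a n N := if (n.+1 %| N.+1)%N then f (N.+1 %/ n.+1)%N * q ^+ N.+1 else 0.
have blk (V : zmodType) (g : nat -> V) (h : nat -> V) n M :
   (forall N, g N = if (n.+1 %| N.+1)%N then h (N.+1 %/ n.+1)%N else 0) ->
   \sum_(0 <= N < n.+1 * M) g N = \sum_(0 <= k < M) h k.+1.
  move=> gh; elim: M => [|M IH]; first by rewrite muln0 !big_nil.
  rewrite [RHS]big_nat_recr//= -IH mulnS addnC.
  rewrite (big_cat_nat (leq0n (n.+1 * M)) (leq_addr _ _))/=; congr (_ + _).
  rewrite -{1}[(n.+1 * M)%N]add0n big_addn addKn big_nat_recr//= big_nat_cond big1 ?add0r.
    rewrite gh -addSn -[(n.+1 + _)%N]mulnS dvdn_mulr// mulKn//.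
  move=> i; rewrite andbT => /andP[_ ilt].
  by rewrite gh -addSn dvdn_addl ?dvdn_mulr// gtnNdvd.
have a2 : asum2 a.
  exists D => M N; apply: le_trans (bb M N); apply: ler_sum => n _.
  apply: (@le_trans _ _ (\sum_(0 <= k < n.+1 * N) cmod (a n k))).
    by apply: sum_nat_ge0_mono => [?|]; [exact: cmod_ge0 | rewrite leq_pmull].
  rewrite (blk _ _ (fun k => cmod (f k * q ^+ (n.+1 * k)))) ?lexx// => k.
  by rewrite /a; case: ifP => [d|]; rewrite ?cmod0// [(n.+1 * _)%N]mulnC divnK.
have row n : sumC (a n) = sumC (b n).
  apply: (@cvgs_unique _ (fun M => \sum_(0 <= N < n.+1 * M) a n N)).
    by apply: (@cvgs_subseq _ _ _ (muln n.+1)) (asum_cvg (asum2_row n a2)) => k; rewrite leq_pmull.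
  have := asum_cvg (asum2_row n b2).
  rewrite (_ : (fun N => _) = (fun M => \sum_(0 <= N < n.+1 * M) a n N))//.
  apply: funext => M; rewrite (blk _ _ (fun k => f k * q ^+ (n.+1 * k))) // => k.
  by rewrite /a; case: ifP => [d|]; rewrite ?mul0r// [(n.+1 * _)%N]mulnC divnK.
have Eb : (fun n => sumC (b n)) = (fun n => sumC (a n)) by apply: funext.
split; first exact: asum2_rows b2.
rewrite -/b Eb (sumC_exchange a2); apply: eq_sumC => N.
rewrite (@sumC_fin _ _ N.+1) => [|n Nn]; last by rewrite /a gtnNdvd.
rewrite /divsum -divisors_codivisor mulr_suml.
rewrite (big_divisors (fun d => f (N.+1 %/ d)%N * q ^+ N.+1)) [RHS]big_mkcond.
by apply: eq_bigr.
Qed.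

Definition eis_coef (c : C) (k n : nat) : C := if n is m.+1 then c * (sigma_ k n)%:R else 1.

Lemma sigma_le k n : (sigma_ k n.+1 <= n.+1 ^ k.+1)%N.
Proof.
rewrite /sigma_ big_divisors.
apply: leq_trans (_ : \sum_(0 <= i < n.+1) n.+1 ^ k <= _)%N; last first.
  by rewrite sum_nat_const_nat subn0 expnS.
rewrite big_mkcond big_nat_cond [X in (_ <= X)%N]big_nat_cond; apply: leq_sum => i.
by rewrite andbT => /andP[_ il]; case: ifP => // _; case: k => // k; rewrite leq_exp2r.
Qed.

Lemma conv_eis c k : conv (eis_coef c k).
Proof.
apply: (@conv_le _ _ (cmod c + 1) k.+1) => -[|n].
  by rewrite cmod1 expr1n mulr1 lerDr cmod_ge0.
rewrite /eis_coef cmodM cmod_nat; apply: ler_pM; rewrite ?cmod_ge0//; first by rewrite lerDl.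
rewrite -natrX ler_nat; apply: leq_trans (sigma_le _ _) _.
by rewrite leq_exp2r.
Qed.

Lemma upper_qpar (tau : C) : upper tau -> cmod (qpar tau) < 1.
Proof.
rewrite /upper /= => t0; rewrite cmod_cexp Re_twopii expR_lt1 oppr_lt0.
by rewrite !mulr_gt0// pi_gt0.
Qed.

Lemma qpar_neq0 (tau : C) : qpar tau != 0.
Proof. exact: cexp_neq0. Qed.

Lemma eisenstein_ev c k (tau : C) : upper tau ->
  eisenstein_series c k tau = ev (eis_coef c k) (qpar tau).
Proof.
move=> /upper_qpar q1; set q := qpar tau in q1 *.
rewrite ev_split//; last exact: conv_eis.
congr (_ + _); rewrite -/q.
pose s n : C := (sigma_ k n.+1)%:R * q ^+ n.+1.
have ss : asum s.
  have -> : s = fun n => q * ((sigma_ k n.+1)%:R * q ^+ n).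
    by apply: funext => n; rewrite /s exprS mulrCA.
  apply: asumZ; apply: conv_asum => //.
  apply: (@conv_le _ (fun n => (sigma_ k n.+1)%:R) 1 k.+1) => n.
  by rewrite mul1r cmod_nat -natrX ler_nat sigma_le.
have -> : limn (fun N => \sum_(1 <= n < N) (sigma_ k n)%:R * q ^+ n) = sumC s.
  apply: cvg_lim => //; apply/cvgCP; apply/cvgsS.
  have := asum_cvg ss; rewrite (_ : (fun N => _) = (fun n => \sum_(1 <= n0 < n.+1) (sigma_ k n0)%:R * q ^+ n0))//.
  by apply: funext => N; rewrite big_add1.
rewrite -sumCZ// /ev -sumCZ; last by apply: conv_asum => //; apply: conv_tail; exact: conv_eis.
by apply: eq_sumC => n; rewrite /s /eis_coef exprS; ring.
Qed.

End Lambert.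

(** * The value of zeta(2) and the partial fractions of the cotangent *)

Section QuasiModularity.
Variable R : realType.
Local Notation C := (cplx R).
Implicit Types (z h tau : C).
Local Notation T := (twopii R).

Definition zeta2 : C := sumC (fun n => n.+1%:R ^- 2).

Lemma asum_zeta2 : asum (fun n => n.+1%:R ^- 2 : C).
Proof.
apply: (@asum_inv_sqr _ _ 0 1) => n _.
by rewrite mul1r cmodV cmodX cmod_nat.
Qed.

Lemma nonint_halfint : nonint (1 / 2 : C).
Proof.
move=> n; apply/eqP => H.
have : (1 + n * 2)%:~R = 0 :> C.
  by rewrite intrD intrM -[RHS](mul0r 2) -H; field.
by move=> /eqP; rewrite intr_eq0 => /eqP; lia.
Qed.

(** At [z = 1/2] the Herglotz sum is 8 times the sum [o] over odd squares, and [o] is three quarters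
    of zeta(2). Since [T = 2 pi i], the value is [pi^2 / 6]. *)
Lemma zeta2E : zeta2 = - T ^+ 2 / 24.
Proof.
pose o n : C := n.*2.+1%:R ^- 2.
have oE n : lip_u (1 / 2) n = 8 * o n.
  rewrite /lip_u /o -[n.+1%:R]natr1 -[n.*2.+1%:R]natr1 natr_double.
  have n0 : 2 * n%:R + 1 != 0 :> C by rewrite -natr_double natr1 pnatr_eq0.
  have -> : 1 / 2 + n%:R = (2 * n%:R + 1) / 2 :> C by field.
  have -> : 1 / 2 - (n%:R + 1) = - ((2 * n%:R + 1) / 2) :> C by field.
  by field.
have ao : asum o.
  have -> : o = (fun n => 8^-1 * lip_u (1 / 2) n).
    by apply: funext => n; rewrite oE mulrA mulVf ?mul1r// pnatr_eq0.
  exact: asumZ (asum_lip _).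
have oS : sumC o = - T ^+ 2 / 32.
  have : 8 * sumC o = - T ^+ 2 / 4.
    rewrite -sumCZ// -(eq_sumC oE) -[LHS]/(lip (1 / 2)) lip_csc2; last exact: nonint_halfint.
    by rewrite /csc2 qpar_half; field.
  move=> H; apply: (mulfI (_ : 8 != 0 :> C)); first by rewrite pnatr_eq0.
  by rewrite H; field.
have : zeta2 = sumC o + 4^-1 * zeta2.
  rewrite -sumCZ; last exact: asum_zeta2.
  rewrite -sumCD//; last exact: asumZ asum_zeta2.
  apply: (@cvgs_unique _ (fun N => \sum_(0 <= n < N.*2) n.+1%:R ^- 2)).
    apply: (cvgs_subseq (f := double)) (asum_cvg asum_zeta2) => n.
    by rewrite -addnn leq_addr.
  have := asum_cvg (asumD ao (asumZ 4^-1 asum_zeta2)).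
  rewrite (_ : (fun N => _) = (fun N => \sum_(0 <= n < N.*2) n.+1%:R ^- 2))//.
  apply: funext => N; rewrite sum_nat_double; apply: eq_bigr => n _.
  have -> : n.*2.+2%:R = 2 * n.+1%:R :> C by rewrite -doubleS natr_double.
  have x0 : n.+1%:R != 0 :> C by rewrite pnatr_eq0.
  by congr (_ + _); move: x0; move: (n.+1%:R : C) => x x0; field.
rewrite oS => H.
have H2 : (3 / 4) * zeta2 = - T ^+ 2 / 32.
  have -> : (3 / 4) * zeta2 = zeta2 - 4^-1 * zeta2 by field.
  by rewrite {1}H addrK.
 have -> : zeta2 = 4 / 3 * (3 / 4 * zeta2) by field.
by rewrite H2; field.
Qed.

Lemma mul_inv_le (a b W : R) : a ^- 2 <= W -> b ^- 2 <= W -> a^-1 * b^-1 <= W.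
Proof. by rewrite -!exprVn => h1 h2; have := sqr_ge0 (a^-1 - b^-1); nra. Qed.

(** The terms [1 / (z + n)] are not absolutely summable; pairing [k] with [- (k + 1)] makes them so,
    and symmetric about [z = 1/2], where each pair cancels. *)
Definition cot_u z k : C := (z + k%:R)^-1 + (z - k.+1%:R)^-1.
Definition cots z : C := sumC (cot_u z).

Lemma asum_cots z : nonint z -> asum (cot_u z).
Proof.
move=> nz; have [K HK] := nat_above (2 * cmod z + 2).
apply: (@asum_inv_sqr _ _ K (cmod (2 * z - 1) * 16)) => n /HK zn.
have n1 := nonintD n nz; have n2 := nonintB n.+1 nz.
have -> : cot_u z n = (2 * z - 1) * ((z + n%:R)^-1 * (z - n.+1%:R)^-1).
  by rewrite /cot_u; move: n2; rewrite -natr1 => n2; field; rewrite n1 n2.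
rewrite cmodM -mulrA ler_wpM2l ?cmod_ge0// cmodM.
have [h1 h2] := inv_sqr_shift_le zn; have n0 : 0 < n.+1%:R :> R by rewrite ltr0n.
move: h1 h2; rewrite !cmodV !cmodX => h1 h2.
set a := cmod _ in h1 *; set b := cmod _ in h2 *.
exact: mul_inv_le h1 h2.
Qed.

(** A uniform distance to the integers, which makes the remainders of all terms of the cotangent
    series uniform. *)
Definition far z (d : R) := 0 < d /\ forall n : int, d <= cmod (z + n%:~R).

Lemma far_nonint z d : far z d -> nonint z.
Proof. by move=> [d0 H] n; rewrite -cmod_gt0; apply: lt_le_trans (H n). Qed.

(** Termwise: the remainder at [x = z + n] is [h^2 / ((x + h) x^2)], at most [|h|^2 (2 / d) |x|^-2],
    a summable bound. *)
Lemma cder_cots z d : far z d -> cder cots z (- lip z).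
Proof.
move=> [d0 Hd] e e0; have nz : nonint z by apply: far_nonint; split; first exact: d0.
have [A HA] := asum_inv_sqr_pos z; have [B HB] := asum_inv_sqr_neg z.
have AB0 : 0 <= A + B.
  by have := HA 0%N; have := HB 0%N; rewrite !big_nil; lra.
pose D := 2 / d * (A + B) + 1.
have D0 : 0 < D by rewrite ltr_wpDl// mulr_ge0// ltW// divr_gt0.
exists (Num.min (d / 2) (e / D)) => [|h]; first by rewrite lt_min !divr_gt0.
rewrite lt_min => /andP[h1 h2]; have h0 := cmod_ge0 h.
have nzh : nonint (z + h).
  move=> n; rewrite -cmod_gt0 -addrA (addrC h) addrA.
  by have := cmodD_ge (z + n%:~R) h; have := Hd n; lra.
have step (x : C) : d <= cmod x ->
    cmod ((x + h)^-1 - x^-1 + h * x ^- 2) <= cmod h ^+ 2 * (2 / d) * cmod (x ^- 2).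
  move=> dx; have x0 : x != 0 by rewrite -cmod_gt0; lra.
  have xh : d / 2 <= cmod (x + h) by have := cmodD_ge x h; lra.
  have xh0 : x + h != 0 by rewrite -cmod_gt0; lra.
  have -> : (x + h)^-1 - x^-1 + h * x ^- 2 = h ^+ 2 * (x + h)^-1 * x ^- 2.
    by field; rewrite x0 xh0.
  rewrite cmodM; apply: ler_wpM2r; first exact: cmod_ge0.
  rewrite cmodM cmodX cmodV ler_wpM2l ?exprn_ge0//.
  by rewrite -(invf_div d 2) lef_pV2 ?posrE//; [rewrite cmod_gt0 | rewrite divr_gt0].
have -> : cots (z + h) - cots z - - lip z * h =
    sumC (fun n => cot_u (z + h) n - cot_u z n + h * lip_u z n).
  rewrite sumCD; last exact: asumZ (asum_lip z).
    rewrite sumCB; [|exact: asum_cots..].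
    by rewrite sumCZ; [rewrite mulNr opprK (mulrC h) | exact: asum_lip].
  by apply: asumD; [exact: asum_cots | apply: asumN; exact: asum_cots].
apply: (@le_trans _ _ (cmod h ^+ 2 * (2 / d) * (A + B))).
  apply: cmod_sumC_le => N.
  apply: le_trans (ler_wpM2l _ (lerD (HA N) (HB N))); last first.
    by rewrite mulr_ge0 ?exprn_ge0// ltW// divr_gt0.
  rewrite -big_split/= mulr_sumr; apply: ler_sum => n _.
  have s1 := step (z + n%:R) (Hd n%:Z).
  have Hn : d <= cmod (z - n.+1%:R) by have := Hd (- n.+1%:Z); rewrite mulrNz.
  have s2 := step (z - n.+1%:R) Hn.
  rewrite [leRHS]mulrDr; apply: le_trans (lerD s1 s2).
  rewrite /cot_u /lip_u; apply: le_trans (cmodD _ _).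
  rewrite le_eqVlt; apply/orP; left; apply/eqP; congr cmod.
  rewrite (_ : z + h + n%:R = z + n%:R + h); last by ring.
  rewrite (_ : z + h - n.+1%:R = z - n.+1%:R + h); last by ring.
  ring.
move: h2; rewrite ltr_pdivlMr// /D => h2.
rewrite expr2; nra.
Qed.

(** This is [pi cot (pi z)]. *)
Definition cotq z : C := T / 2 * ((qpar z + 1) / (qpar z - 1)).

Lemma cder_qpar z : cder (@qpar R) z (T * qpar z).
Proof.
apply: cder_eq (cder_comp (cderZ T (cder_id z)) (cder_cexp (T * z))) _.
by rewrite mulr1 mulrC.
Qed.

Lemma cder_cotq z : nonint z -> cder cotq z (- csc2 z).
Proof.
move=> nz; have q1 : qpar z - 1 != 0 by rewrite subr_eq0 qpar_neq1.
have dq := cder_qpar z.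
apply: cder_eq (cderZ (T / 2) (cderM (cderD dq (cder_cst 1 z))
  (cderV _ (cderB dq (cder_cst 1 z))))) _ => //.
rewrite /csc2; have q1' : 1 - qpar z != 0 by rewrite -opprB oppr_eq0.
by field; rewrite q1 q1'.
Qed.

Lemma cots_half : cots (1 / 2) = 0.
Proof.
rewrite /cots (_ : cot_u _ = fun=> 0).
  by apply: cvg_sumC; apply: (@cvgs_eq _ _ _ 0%N) => n _; rewrite big1.
apply: funext => n; rewrite /cot_u -[n.+1%:R]natr1.
have -> : 1 / 2 - (n%:R + 1) = - (1 / 2 + n%:R) :> C by field.
by rewrite invrN subrr.
Qed.

Lemma far_Im z : complex.Im z != 0 -> far z `|complex.Im z|.
Proof.
move=> z0; split; first by rewrite normr_gt0.
move=> n; apply: le_trans (cmod_Im _).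
by rewrite -ofreal_int ImD /= addr0.
Qed.

Lemma far_half : far (1 / 2 : C) (1 / 2).
Proof.
split; first by lra.
move=> n; apply: le_trans (cmod_Re _).
have -> : (1 / 2 : C) = ofreal (1 / 2) by rewrite ofrealM ofrealV ofreal1 (ofreal_nat R 2).
rewrite -ofreal_int -ofrealD /=.
have [n0|n0] := leP 0 n.
  have n1 : 0 <= n%:~R :> R by rewrite ler0z.
  by rewrite ger0_norm; lra.
have n1 : n%:~R <= -1 :> R by rewrite -[-1]/((-1)%:~R) ler_int; lia.
by rewrite ler0_norm; lra.
Qed.

(** Both sides have the same derivative by Herglotz and vanish at [1/2]; the segment from there to a
    non-real [z] meets no integer. *)
Lemma cots_cotq z : complex.Im z != 0 -> cots z = cotq z.
Proof.
move=> z0; apply/eqP; rewrite -subr_eq0; apply/eqP.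
have -> : cots z - cotq z = cots (1 / 2) - cotq (1 / 2).
  symmetry; apply: (@cder0_const _ (fun x : C => cots x - cotq x)) => t /andP[t0 t1].
  set x := _ + _.
  suff [d fx] : exists d, far x d.
    apply: cder_eq (cderB (cder_cots fx) (cder_cotq (far_nonint fx))) _.
    by rewrite lip_csc2 ?subrr//; exact: far_nonint fx.
  have hE : (1 / 2 : C) = ofreal (1 / 2) by rewrite ofrealM ofrealV ofreal1 (ofreal_nat R 2).
  have [tt|tp] := eqVneq t 0.
    by exists (1 / 2); rewrite /x tt ofreal0 mul0r addr0; exact: far_half.
  exists `|complex.Im x|; apply: far_Im.
  rewrite /x hE ImD ImM ImD ImN /= add0r mul0r addr0 subr0.
  by rewrite mulf_neq0.
by rewrite cots_half /cotq qpar_half addNr mul0r mulr0 subrr.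
Qed.

End QuasiModularity.

(** * The law of [E_2] under inversion *)

Lemma E2_S_algebra (F : numFieldType) (t T E E' k : F) : t != 0 -> T != 0 ->
  T ^+ 2 / 24 * (1 - E) + t ^- 2 * T ^+ 2 / 24 - k =
  t ^- 2 * (T ^+ 2 / 24 * (1 - E')) + T ^+ 2 / 24 - k + T / 2 / t ->
  E' = t ^+ 2 * E + 12 / T * t.
Proof.
move=> t0 T0 /eqP; rewrite -subr_eq0 => /eqP H; apply/eqP; rewrite -subr_eq0; apply/eqP.
rewrite -[RHS](mulr0 (24 * t ^+ 2 / T ^+ 2)) -[in RHS]H.
by field; rewrite t0 T0.
Qed.

Section EisensteinTwo.
Variable R : realType.
Local Notation C := (cplx R).
Implicit Types (z h tau : C).
Local Notation T := (twopii R).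

Lemma upper_neq0 tau : upper tau -> tau != 0.
Proof. by apply: contraPneq => ->; rewrite /upper /= ltxx. Qed.

(** The imaginary part controls [s]. The reverse triangle inequality controls [t] unless
    [|t| < 2 |s tau|], and then [s] controls it. *)
Lemma upper_comb_ge tau : upper tau -> exists2 c : R, 0 < c & forall s t : R,
  c * `|s| <= cmod (ofreal s * tau + ofreal t) /\
  c * `|t| <= cmod (ofreal s * tau + ofreal t).
Proof.
move=> tau0; set y := complex.Im tau; have y0 : 0 < y by exact: tau0.
have m0 : 0 < cmod tau by rewrite cmod_gt0 upper_neq0.
pose c := Num.min (Num.min y (1 / 2)) (y / (2 * cmod tau)).
have c0 : 0 < c by rewrite !lt_min y0 /= !divr_gt0 ?mulr_gt0.
exists c => // s t.
have cy : c <= y by rewrite !ge_min lexx.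
have c2 : c <= 1 / 2 by rewrite !ge_min lexx orbT.
have c3 : c <= y / (2 * cmod tau) by rewrite ge_min lexx orbT.
have sy : `|s| * y <= cmod (ofreal s * tau + ofreal t).
  apply: le_trans (cmod_Im _); rewrite ImD ImM /= mul0r !addr0 normrM.
  by rewrite (gtr0_norm y0).
split; first by apply: le_trans sy; rewrite mulrC ler_wpM2l.
have [h|h] := leP (2 * (`|s| * cmod tau)) `|t|.
  have := cmodB_ge (ofreal t) (- (ofreal s * tau)).
  rewrite cmodN cmodM !cmod_ofreal opprK addrC.
  by rewrite [ofreal t + _]addrC; have := normr_ge0 t; nra.
apply: le_trans sy; apply: le_trans (ler_wpM2r (normr_ge0 t) c3) _.
rewrite mulrAC ler_pdivrMr ?mulr_gt0//; nra.
Qed.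

Lemma nonint_Im z : complex.Im z != 0 -> nonint z.
Proof. by move=> /far_Im/far_nonint. Qed.

Lemma cvgs_inv_shift z : cvgs (fun N => (z + N%:R)^-1) 0.
Proof.
move=> eps eps0; have [M HM] := nat_above (eps^-1 + cmod z + 1).
exists M => N /HM h; rewrite subr0 cmodV.
have ei : 0 < eps^-1 by rewrite invr_gt0.
have : eps^-1 < cmod (z + N%:R).
  by have := cmodD_ge (N%:R : C) z; rewrite [N%:R + z]addrC cmod_nat; lra.
by move=> lt; rewrite -[eps]invrK ltf_pV2 ?posrE// (lt_trans ei).
Qed.

Lemma lip_split z : lip z =
  z ^- 2 + sumC (fun k => (z - k.+1%:R) ^- 2 + (z + k.+1%:R) ^- 2).
Proof.
have a1 := asum_inv_sqr_pos z; have a2 := asum_inv_sqr_neg z.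
rewrite /lip sumCD// (sumCS a1) addr0 -addrA [X in _ + X]addrC -sumCD//.
by apply/(asumS (fun k => (z + k%:R) ^- 2)).
Qed.

Lemma upper_nat_mul tau n : upper tau -> upper (n.+1%:R * tau).
Proof.
by rewrite /upper /= -ofreal_nat ImM /= mul0r addr0 => t0; rewrite mulr_gt0.
Qed.

Lemma upper_Im_neq0 tau : upper tau -> complex.Im tau != 0.
Proof. by rewrite /upper /= => t0; rewrite gt_eqF. Qed.

Lemma qpar_nat_mul tau n : qpar (n%:R * tau) = qpar tau ^+ n.
Proof. by rewrite /qpar mulrCA cexpMn. Qed.

(** The closed form of [lip (n tau)] is Lipschitz' formula [T^2 * sum_k k q^(n k)], and the sum over
    [n] is then the Lambert series of the divisor sums in [E2]. *)
Lemma sum_lip_E2 tau : upper tau -> asum (fun n => lip (n.+1%:R * tau)) /\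
  sumC (fun n => lip (n.+1%:R * tau)) = T ^+ 2 / 24 * (1 - E2 tau).
Proof.
move=> tau0; have q1 := upper_qpar tau0; set q := qpar tau in q1 *.
have cid : conv (fun n => n%:R : C).
  by apply: (@conv_le _ _ 1 1) => n; rewrite mul1r expr1 cmod_nat ler_nat.
have lE n : lip (n.+1%:R * tau) = T ^+ 2 * sumC (fun k => k.+1%:R * q ^+ (n.+1 * k.+1)).
  have u0 := upper_nat_mul n tau0.
  rewrite lip_csc2; last by apply: nonint_Im; exact: upper_Im_neq0.
  rewrite /csc2 qpar_nat_mul -/q; congr (_ * _).
  have qn1 : cmod (q ^+ n.+1) < 1 by rewrite cmodX exprn_ilt1 ?cmod_ge0.
  rewrite -ev_succ// /ev -sumCZ; last first.
    by apply: conv_asum => //; exact: conv_tail cid.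
  by apply: eq_sumC => k; rewrite exprM (exprS (q ^+ n.+1)); ring.
have [a1 a2] := lambert cid q1.
rewrite (_ : (fun n => lip _) = fun n => T ^+ 2 * sumC (fun k => k.+1%:R * q ^+ (n.+1 * k.+1))); last exact: funext.
split; first exact: asumZ.
rewrite sumCZ// a2 -[RHS]mulrA; congr (_ * _).
rewrite /E2 eisenstein_ev// -/q ev_split//; last exact: conv_eis.
have ae : asum (fun n => eis_coef (- 24%:R) 1 n.+1 * q ^+ n : C).
  exact: conv_asum (conv_tail (@conv_eis R _ _)) q1.
rewrite /ev -sumCZ// opprD addrA subrr add0r -sumCN; last exact: asumZ.
rewrite -sumCZ; last by apply: asumN; exact: asumZ.
apply: eq_sumC => k; rewrite /eis_coef /divsum /sigma_ natr_sum.
rewrite (eq_bigr (fun d => (d ^ 1)%:R)) => [|i _]; last by rewrite expn1.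
rewrite exprS; move: (\sum_(_ <- _) _) (q ^+ k) => s p.
by field.
Qed.

Variable tau : C.
Hypothesis tau0 : upper tau.
Let tn0 : tau != 0 := upper_neq0 tau0.

(** [c n m] gathers the lattice points of row [n] at abscissas [m + 1] and [- (m + 1)]. [e n m]
    telescopes in [m] and is the integral of which [c n m] is the midpoint value, each integration
    interval having half-integer ends; the midpoint rule makes the difference [g] of order
    [n^-2 m^-2]. *)
Let x n : C := n.+1%:R * tau.
Let c n m : C := (x n - m.+1%:R) ^- 2 + (x n + m.+1%:R) ^- 2.
Let K n (a : C) : C := (x n + a)^-1 - (x n - a)^-1.
Let e n m : C := K n (m%:R + 1 / 2) - K n (m.+1%:R + 1 / 2).
Let g n m : C := c n m - e n m.

Let halfE : (1 / 2 : C) = ofreal (1 / 2).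
Proof. by rewrite ofrealM ofrealV ofreal1 (ofreal_nat R 2). Qed.

Let xr_neq0 n (t : R) : x n + ofreal t != 0.
Proof.
apply/eqP => /(congr1 (@complex.Im R)).
rewrite /x -ofreal_nat ImD ImM /= mul0r !addr0 => /eqP.
by rewrite mulf_eq0 pnatr_eq0/= gt_eqF.
Qed.

Lemma telescope_defect (X B D : C) : X != 0 -> B != 0 -> D != 0 ->
  B = X - 1 / 2 -> D = X + 1 / 2 ->
  X ^- 2 - (B^-1 - D^-1) = (4 * (X ^+ 2 * (B * D)))^-1 * -1.
Proof.
move=> X0 B0 D0 BE DE.
have -> : X ^- 2 - (B^-1 - D^-1) = (B * D - X ^+ 2 * (D - B)) / (X ^+ 2 * (B * D)).
  by field; rewrite X0 B0 D0.
have -> : B * D - X ^+ 2 * (D - B) = - 4^-1 by rewrite BE DE; field.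
by rewrite [in RHS]invfM; ring.
Qed.

Let g_asum2 : asum2 g.
Proof.
have [k k0 Hk] := upper_comb_ge tau0.
pose D := (k ^+ 4)^-1.
have D0 : 0 <= D by rewrite invr_ge0 exprn_ge0// ltW.
pose u n : R := (n.+1%:R ^+ 2)^-1.
have u0 n : 0 <= u n by rewrite invr_ge0 exprn_ge0.
(* Stated for a signed abscissa [t], so as to serve both [m + 1] and [- (m + 1)]; three factors are
   bounded below by the lattice estimate, one of them twice. *)
have step n m (t s1 s2 : R) : t - 1 / 2 = s1 -> t + 1 / 2 = s2 -> m.+1%:R <= `|t| ->
   m.+1%:R / 2 <= `|s1| -> m.+1%:R / 2 <= `|s2| ->
   cmod ((x n + ofreal t) ^- 2 - ((x n + ofreal s1)^-1 - (x n + ofreal s2)^-1)) <= D * (u n * u m).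
  move=> ts1 ts2 mt ms1 ms2.
  have nn : `|n.+1%:R : R| = n.+1%:R by rewrite normr_nat.
  have bX (s : R) (r : R) : r <= `|s| -> k * n.+1%:R <= cmod (x n + ofreal s) /\ k * r <= cmod (x n + ofreal s).
    move=> rs; have [] := Hk n.+1%:R s; rewrite nn /x -ofreal_nat => h1 h2; split => //.
    by apply: le_trans h2; rewrite ler_wpM2l// ltW.
  have [a1 a2] := bX _ _ mt; have [b1 b2] := bX _ _ ms1; have [c1 c2] := bX _ _ ms2.
  rewrite telescope_defect ?xr_neq0//; last 2 first.
    by rewrite -ts1 halfE ofrealD ofrealN addrA.
    by rewrite -ts2 halfE ofrealD addrA.
  have N0 : 0 < n.+1%:R :> R by rewrite ltr0n.
  have M0 : 0 < m.+1%:R :> R by rewrite ltr0n.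
  rewrite cmodM cmodN cmod1 mulr1 cmodV (cmodM 4) (cmod_nat R 4) (cmodM (_ ^+ 2)) cmodX cmodM.
  rewrite /D /u; move: N0 M0 a1 a2 b1 b2 c1 c2.
  move: n.+1%:R m.+1%:R (cmod (x n + ofreal t)) (cmod (x n + ofreal s1))
    (cmod (x n + ofreal s2)) => N M X B E N0 M0 a1 a2 b1 b2 c1 c2.
  have P1 : (k * N) * (k * M) <= X ^+ 2.
    by rewrite expr2; apply: ler_pM => //; rewrite mulr_ge0// ltW.
  have P2 : (k * N) * (k * (M / 2)) <= B * E.
    by apply: ler_pM => //; rewrite mulr_ge0// ltW// divr_gt0.
  have Q2 : 0 < (k * N) * (k * (M / 2)) by rewrite !mulr_gt0.
  have Q1 : 0 < (k * N) * (k * M) by rewrite !mulr_gt0.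
  have P3 := ler_pM (ltW Q1) (ltW Q2) P1 P2.
  rewrite -!invfM lef_pV2 ?posrE; last 2 first.
  - by rewrite mulr_gt0// (lt_le_trans _ P3)// mulr_gt0.
  - by rewrite !mulr_gt0 ?exprn_gt0.
  have -> : k ^+ 4 * (N ^+ 2 * M ^+ 2) = 2 * (k * N * (k * M) * (k * N * (k * (M / 2)))) by field.
  by have := mulr_gt0 Q1 Q2; lra.
apply: (@asum2_prod _ g (fun n => D * 2 * u n) u (D * 2 * 2) 2) => //.
- move=> n m.
  have m0 : 0 <= m%:R :> R by [].
  have m1 : m.+1%:R = m%:R + 1 :> R by rewrite natr1.
  have h1 : cmod ((x n + ofreal m.+1%:R) ^- 2 - ((x n + ofreal (m%:R + 1 / 2))^-1 -
      (x n + ofreal (m.+1%:R + 1 / 2))^-1)) <= D * (u n * u m).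
    by apply: step; rewrite ?m1; [lra|lra|rewrite ger0_norm; lra|rewrite ger0_norm; lra|rewrite ger0_norm; lra].
  have h2 : cmod ((x n + ofreal (- m.+1%:R)) ^- 2 - ((x n + ofreal (- (m.+1%:R + 1 / 2)))^-1 -
      (x n + ofreal (- (m%:R + 1 / 2)))^-1)) <= D * (u n * u m).
    by apply: step; rewrite ?m1; [lra|lra|rewrite ler0_norm; lra|rewrite ler0_norm; lra|rewrite ler0_norm; lra].
  have := cmodD ((x n + ofreal m.+1%:R) ^- 2 - ((x n + ofreal (m%:R + 1 / 2))^-1 -
      (x n + ofreal (m.+1%:R + 1 / 2))^-1)) ((x n + ofreal (- m.+1%:R)) ^- 2 - ((x n + ofreal (- (m.+1%:R + 1 / 2)))^-1 -
      (x n + ofreal (- (m%:R + 1 / 2)))^-1)).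
  have -> : g n m = (x n + ofreal m.+1%:R) ^- 2 - ((x n + ofreal (m%:R + 1 / 2))^-1 -
      (x n + ofreal (m.+1%:R + 1 / 2))^-1) + ((x n + ofreal (- m.+1%:R)) ^- 2 - ((x n + ofreal (- (m.+1%:R + 1 / 2)))^-1 -
      (x n + ofreal (- (m%:R + 1 / 2)))^-1)).
    rewrite /g /c /e /K !ofrealN !ofrealD !ofreal_nat -halfE.
    by ring.
  by move=> h3; apply: le_trans h3 _; lra.
- by move=> n; rewrite !mulr_ge0.
- by move=> M; rewrite -mulr_sumr ler_wpM2l ?mulr_ge0// inv_sqr_sum_le.
- by move=> M; exact: inv_sqr_sum_le.
Qed.

(* kappa a = \sum_(n >= 1) K n a, evaluated by the partial fractions of the cotangent. *)
Let kappa (a : C) : C := sumC (fun n => K n a).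

Let z_of (a : R) : C := ofreal a / tau.

Let Im_z_of a : complex.Im (z_of a) = - a * (complex.Im tau / cmod tau ^+ 2).
Proof.
have -> : z_of a = ofreal (a / cmod tau ^+ 2) * conjc tau.
  rewrite /z_of ofrealM ofrealV ofrealX -mulrA; congr (_ * _).
  by rewrite -normCE; exact: invc_norm.
by rewrite ImM; case: (tau) => p r /=; ring.
Qed.

Let K_asum_kappa (a : R) : a != 0 ->
  asum (fun n => K n (ofreal a)) /\
  kappa (ofreal a) = tau^-1 * (cots (z_of a) - (z_of a)^-1).
Proof.
move=> a0; set z := z_of a.
have zi : complex.Im z != 0.
  rewrite Im_z_of mulf_neq0 ?oppr_eq0// mulf_neq0 ?invr_neq0//; first by rewrite gt_eqF.
  by rewrite expf_neq0 ?cmod_eq0.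
have nz := nonint_Im zi.
have z0 : z != 0 by have := nz 0; rewrite addr0.
have KE n : K n (ofreal a) = tau^-1 * ((z + n.+1%:R)^-1 + (z - n.+1%:R)^-1).
  have p1 := nonintD n.+1 nz; have p2 := nonintB n.+1 nz.
  have aE : ofreal a = z * tau by rewrite /z /z_of divfK.
  rewrite /K /x aE; move: p1 p2; move: (n.+1%:R : C) => N p1 p2.
  have -> : N * tau + z * tau = (z + N) * tau by ring.
  have -> : N * tau - z * tau = - ((z - N) * tau) by ring.
  by field; rewrite p1 p2 tn0.
have part : cvgs (fun N => \sum_(0 <= n < N) ((z + n.+1%:R)^-1 + (z - n.+1%:R)^-1))
    (cots z - z^-1).
  have := cvgsB (cvgsD (asum_cvg (asum_cots nz)) (cvgs_inv_shift z)) (cvgs_cst z^-1).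
  rewrite addr0 (_ : (fun n => _) = (fun N => \sum_(0 <= n < N) ((z + n.+1%:R)^-1 + (z - n.+1%:R)^-1)))//.
  apply: funext => N; elim: N => [|N IH]; first by rewrite !big_nil addr0 add0r subrr.
  by rewrite !big_nat_recr//= -IH /cot_u; ring.
have aK : asum (fun n => K n (ofreal a)).
  have [M HM] := nat_above (2 * cmod z + 2).
  apply: (@asum_inv_sqr _ _ M (cmod tau^-1 * cmod (2 * z) * 16)) => n /HM zn.
  rewrite KE; have p1 := nonintD n.+1 nz; have p2 := nonintB n.+1 nz.
  have -> : (z + n.+1%:R)^-1 + (z - n.+1%:R)^-1 = 2 * z * ((z + n.+1%:R)^-1 * (z - n.+1%:R)^-1).
    by move: p1 p2; move: (n.+1%:R : C) => N p1 p2; field; rewrite p1 p2.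
  rewrite (cmodM tau^-1) (cmodM (2 * z)) -!mulrA; do 2!(apply: ler_wpM2l; rewrite ?cmod_ge0//).
  have [_ h2] := inv_sqr_shift_le zn.
  have zn1 : 2 * cmod z + 2 <= n.+1%:R by rewrite -natr1; lra.
  have [h1 _] := inv_sqr_shift_le zn1.
  rewrite cmodM !cmodV; apply: mul_inv_le; rewrite -cmodX -cmodV//.
  apply: le_trans h1 _; rewrite ler_wpM2l// lef_pV2 ?posrE ?exprn_gt0 ?ltr0n//.
  by rewrite -!natrX ler_nat leq_exp2r.
split => //; apply: cvg_sumC.
have := cvgsZ tau^-1 part; rewrite (_ : (fun n => _) = (fun N => \sum_(0 <= n < N) K n (ofreal a)))//.
by apply: funext => N; rewrite mulr_sumr; apply: eq_bigr => n _; rewrite KE.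
Qed.

(** As [a] grows, [a / tau] goes to infinity in the lower half-plane, where [|qpar|] is large and
    the cotangent tends to [T / 2], while the subtracted [tau / a] tends to 0. *)
Let kappa_lim : cvgs (fun M => kappa (M%:R + 1 / 2)) (T / 2 / tau).
Proof.
pose w := complex.Im tau / cmod tau ^+ 2.
have w0 : 0 < w by rewrite divr_gt0// exprn_gt0// cmod_gt0.
have pi0 := pi_gt0 R.
pose v := 2 * pi * w; have v0 : 0 < v by rewrite mulr_gt0// mulr_gt0.
have ct0 : 0 < cmod tau by rewrite cmod_gt0.
have cT0 : 0 < cmod T by rewrite cmod_gt0 twopii_neq0.
(* both error terms are O(1/M) *)
pose D := (cmod tau)^-1 * (cmod T / v + cmod tau).
have D0 : 0 <= D by rewrite mulr_ge0 ?invr_ge0 ?addr_ge0 ?divr_ge0// ltW.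
suff bound M : cmod (kappa (M%:R + 1 / 2) - T / 2 / tau) <= D / (M%:R + 1 / 2).
  move=> eps eps0; have [M HM] := nat_above (D / eps).
  exists M => N /HM h; apply: le_lt_trans (bound N) _.
  have N0 : 0 < N%:R + 1 / 2 :> R by have := ler0n R N; lra.
  rewrite ltr_pdivrMr//; move: h; rewrite ler_pdivrMr//; nra.
set a : R := M%:R + 1 / 2.
have a0 : 0 < a by have := ler0n R M; rewrite /a; lra.
have -> : M%:R + 1 / 2 = ofreal a by rewrite ofrealD ofreal_nat halfE.
have [_ ->] := K_asum_kappa (lt0r_neq0 a0).
set z := z_of a.
have Imz : complex.Im z = - a * w by rewrite Im_z_of.
have Imz0 : complex.Im z != 0 by rewrite Imz mulf_neq0 ?oppr_eq0 ?gt_eqF.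
rewrite cots_cotq// /cotq.
have q1 : 1 + v * a <= cmod (qpar z).
  rewrite cmod_cexp Re_twopii Imz; apply: le_trans (expR_ge1Dx _); rewrite /v.
  by rewrite le_eqVlt; apply/orP; left; apply/eqP; ring.
have va0 : 0 < v * a by rewrite mulr_gt0.
have q2 : v * a <= cmod (qpar z - 1).
  by have := cmodB_ge (qpar z) 1; rewrite cmod1; lra.
have q0 : qpar z - 1 != 0 by rewrite -cmod_gt0; apply: lt_le_trans q2.
have zV : z^-1 = tau / ofreal a by rewrite /z /z_of invf_div.
have oa0 : ofreal a != 0 :> C by rewrite -cmod_eq0 cmod_ofreal normr_eq0 gt_eqF.
rewrite zV.
have -> : tau^-1 * (T / 2 * ((qpar z + 1) / (qpar z - 1)) - tau / ofreal a) - T / 2 / tau =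
   tau^-1 * (T / (qpar z - 1) - tau / ofreal a) by field; rewrite q0 tn0 oa0.
rewrite cmodM cmodV /D -mulrA ler_wpM2l ?invr_ge0 ?cmod_ge0//.
apply: le_trans (cmodD _ _) _; rewrite cmodN !cmod_div cmod_ofreal (gtr0_norm a0) mulrDl.
rewrite lerD// -mulrA -invfM ler_wpM2l ?cmod_ge0//.
by rewrite lef_pV2 ?posrE// (lt_le_trans va0).
Qed.

(** [g] may be summed in either order. By rows it yields the lattice sum at [tau]; by columns, after
    extracting [tau ^- 2], the one at [- 1 / tau]. The telescoping parts differ by the limit of
    [kappa], the source of the term linear in [tau]. *)
Lemma E2_S : E2 (- tau^-1) = tau ^+ 2 * E2 tau + 12 / T * tau.
Proof.
have T0 := twopii_neq0 R.
have tau'0 : upper (- tau^-1).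
  have := Im_z_of 1; rewrite /upper /= ImN /z_of ofreal1 div1r => ->.
  by rewrite mulN1r opprK divr_gt0// exprn_gt0// cmod_gt0.
have [aA SA] := sum_lip_E2 tau0; have [aB SB] := sum_lip_E2 tau'0.
have acr n : asum (c n).
  apply: asumD; first exact: asum_inv_sqr_neg.
  by apply/(asumS (fun m => (x n + m%:R) ^- 2)); exact: asum_inv_sqr_pos.
have xz m n : x n + m = tau * (m / tau + n.+1%:R) by rewrite /x; field.
have acc m : asum (fun n => c n m).
  apply: asumD.
    rewrite (_ : (fun n => _) = fun n => tau ^- 2 * (- m.+1%:R / tau + n.+1%:R) ^- 2).
      by apply: asumZ; apply/(asumS (fun n => (_ + n%:R) ^- 2)); exact: asum_inv_sqr_pos.
    by apply: funext => n; rewrite xz exprMn invfM.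
  rewrite (_ : (fun n => _) = fun n => tau ^- 2 * (m.+1%:R / tau + n.+1%:R) ^- 2).
    by apply: asumZ; apply/(asumS (fun n => (_ + n%:R) ^- 2)); exact: asum_inv_sqr_pos.
  by apply: funext => n; rewrite xz exprMn invfM.
pose a n := sumC (c n); pose b m := sumC (fun n => c n m).
have aE n : lip (x n) = x n ^- 2 + a n by exact: lip_split.
have axi : asum (fun n => x n ^- 2).
  rewrite (_ : (fun n => _) = fun n => tau ^- 2 * n.+1%:R ^- 2); first exact: asumZ (asum_zeta2 R).
  by apply: funext => n; rewrite /x mulrC exprMn invfM.
have aa : asum a.
  rewrite (_ : a = fun n => lip (x n) - x n ^- 2); last by apply: funext => n; rewrite aE addrC addKr.
  by apply: asumD => //; exact: asumN.
have SA' : sumC a = T ^+ 2 / 24 * (1 - E2 tau) + tau ^- 2 * T ^+ 2 / 24.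
  rewrite -SA (_ : a = fun n => lip (x n) - x n ^- 2); last by apply: funext => n; rewrite aE addrC addKr.
  rewrite sumCB//; congr (_ + _).
  rewrite (_ : (fun n => _) = fun n => tau ^- 2 * n.+1%:R ^- 2); last first.
    by apply: funext => n; rewrite /x mulrC exprMn invfM.
  by rewrite sumCZ; [rewrite -/(zeta2 R) zeta2E; ring | exact: asum_zeta2].
(* A column lacks its term with [n = 0], which [lip] contains and which equals [(m + 1)^-2] after
   scaling. *)
have bE m : b m = tau ^- 2 * lip (m.+1%:R * - tau^-1) - m.+1%:R ^- 2.
  set z := m.+1%:R * _.
  have a1 := asum_inv_sqr_pos z; have a2 := asum_inv_sqr_neg z.
  have m0 : m.+1%:R != 0 :> C by rewrite pnatr_eq0.
  rewrite /lip sumCD// (sumCS a1) addr0 !mulrDr.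
  have -> : tau ^- 2 * z ^- 2 = m.+1%:R ^- 2.
    by rewrite /z; move: m0; move: (m.+1%:R : C) => M m0; field; rewrite tn0 m0.
  rewrite -!sumCZ//; last by apply/(asumS (fun k => (z + k%:R) ^- 2)).
  set P := sumC _; set N := sumC _; have -> : m.+1%:R ^- 2 + P + N - m.+1%:R ^- 2 = P + N by ring.
  rewrite /P /N -sumCD; last 2 first.
  - by apply: asumZ; apply/(asumS (fun k => (z + k%:R) ^- 2)).
  - exact: asumZ.
  apply: eq_sumC => n; rewrite /c (xz m.+1%:R) (xz (- m.+1%:R)) !exprMn ![(tau ^+ 2 * _)^-1]invfM.
  have -> : - m.+1%:R / tau + n.+1%:R = z + n.+1%:R by rewrite /z; ring.
  have -> : m.+1%:R / tau + n.+1%:R = - (z - n.+1%:R) by rewrite /z; ring.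
  by rewrite sqrrN.
have ab : asum b.
  rewrite (_ : b = fun m => tau ^- 2 * lip (m.+1%:R * - tau^-1) - m.+1%:R ^- 2); last exact: funext.
  by apply: asumD; [exact: asumZ | apply: asumN; exact: asum_zeta2].
have SB' : sumC b = tau ^- 2 * (T ^+ 2 / 24 * (1 - E2 (- tau^-1))) + T ^+ 2 / 24.
  rewrite (_ : b = fun m => tau ^- 2 * lip (m.+1%:R * - tau^-1) - m.+1%:R ^- 2); last exact: funext.
  rewrite sumCB; [|exact: asumZ|exact: asum_zeta2].
  by rewrite sumCZ// SB -/(zeta2 R) zeta2E; ring.
have half0 : 1 / 2 != 0 :> R by rewrite lt0r_neq0// divr_gt0.
have [aK _] := K_asum_kappa half0; rewrite -halfE in aK.
(* Within a row [e] telescopes to [K n (1/2)], the other end tending to 0. *)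
have G1 : sumC (fun n => sumC (g n)) = sumC a - kappa (1 / 2).
  rewrite -sumCB//; apply: eq_sumC => n; apply: cvg_sumC.
  have cv0 (z : C) : cvgs (fun N => (z + (N%:R + 1 / 2))^-1) 0.
    have := cvgs_inv_shift (z + 1 / 2).
    by rewrite (_ : (fun N => _) = (fun N => (z + (N%:R + 1 / 2))^-1))//; apply: funext => N; congr (_^-1); ring.
  have cK : cvgs (fun N => K n (N%:R + 1 / 2)) 0.
    have := cvgsD (cv0 (x n)) (cv0 (- x n)).
    rewrite addr0 (_ : (fun N => (_ : C)) = (fun N => K n (N%:R + 1 / 2)))//.
    by apply: funext => N; rewrite /K -invrN opprB [X in _ + X^-1]addrC.
  have := cvgsB (asum_cvg (acr n)) (cvgsB (cvgs_cst (K n (1 / 2))) cK).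
  rewrite subr0 (_ : (fun N => (_ : C)) = (fun N => \sum_(0 <= m < N) g n m))//.
  apply: funext => N; elim: N => [|N IH]; first by rewrite !big_nil (add0r (1 / 2)) subrr subr0.
  by rewrite !big_nat_recr//= -IH /g /e; ring.
(* Summed over [n] first, the far end of the telescope is [kappa (m + 1/2)], which does not tend to
   0. *)
have G2 : sumC (fun m => sumC (fun n => g n m)) = sumC b - kappa (1 / 2) + T / 2 / tau.
  have gE m : sumC (fun n => g n m) = b m - (kappa (m%:R + 1 / 2) - kappa (m.+1%:R + 1 / 2)).
    have aKm (k : nat) : asum (fun n => K n (k%:R + 1 / 2)).
      have k0 : k%:R + 1 / 2 != 0 :> R by rewrite lt0r_neq0// ltr_wpDl// divr_gt0.
      by have [+ _] := K_asum_kappa k0; rewrite ofrealD ofreal_nat -halfE.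
    rewrite /g sumCB//; last by apply: asumD => //; exact: asumN.
    by congr (_ - _); rewrite /e sumCB.
  rewrite (eq_sumC gE); apply: cvg_sumC.
  have := cvgsD (cvgsB (asum_cvg ab) (cvgs_cst (kappa (1 / 2)))) kappa_lim.
  rewrite (_ : (fun N => (_ : C)) = (fun N => \sum_(0 <= m < N) (b m - (kappa (m%:R + 1 / 2) - kappa (m.+1%:R + 1 / 2)))))//.
  apply: funext => N; elim: N => [|N IH]; first by rewrite !big_nil (add0r (1 / 2)) add0r addNr.
  by rewrite !big_nat_recr//= -IH; ring.
have := sumC_exchange g_asum2; rewrite G1 G2 SA' SB' => H.
exact: E2_S_algebra tn0 T0 H.
Qed.

End EisensteinTwo.

(** * Liouville's identities on the solutions of [a x + b y = n] *)

Section DivisorConvolutions.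
Variable F : numFieldType.
Variable n : nat.

(** Cutting all variables at [n] loses nothing: a positive solution has all four entries at most
    [n]. *)
Definition qsum (P : nat -> nat -> nat -> nat -> bool)
    (f : nat -> nat -> nat -> nat -> F) : F :=
  \sum_(1 <= b < n.+1) \sum_(1 <= x < n.+1) \sum_(1 <= y < n.+1)
    \sum_(1 <= a < n.+1)
      if (a * x + b * y == n)%N && P a b x y then f a b x y else 0.

Lemma eq_qsum (P Q : nat -> nat -> nat -> nat -> bool) f g :
  (forall a b x y, (0 < a)%N -> (0 < b)%N -> (0 < x)%N -> (0 < y)%N ->
     (a * x + b * y = n)%N -> P a b x y = Q a b x y /\ (P a b x y -> f a b x y = g a b x y)) ->
  qsum P f = qsum Q g.
Proof.
move=> H; rewrite /qsum big_nat_cond [RHS]big_nat_cond; apply: eq_bigr => b; rewrite andbT => /andP[b0 _].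
rewrite big_nat_cond [RHS]big_nat_cond; apply: eq_bigr => x; rewrite andbT => /andP[x0 _].
rewrite big_nat_cond [RHS]big_nat_cond; apply: eq_bigr => y; rewrite andbT => /andP[y0 _].
rewrite big_nat_cond [RHS]big_nat_cond; apply: eq_bigr => a; rewrite andbT => /andP[a0 _].
case: eqP => //= E; have [-> PE] := H a b x y a0 b0 x0 y0 E.
by case: ifP => // Q0; apply: PE; have [-> _] := H a b x y a0 b0 x0 y0 E.
Qed.

Lemma qsumD P f g : qsum P (fun a b x y => f a b x y + g a b x y) = qsum P f + qsum P g.
Proof.
rewrite /qsum -big_split/=; apply: eq_bigr => b _; rewrite -big_split/=; apply: eq_bigr => x _.
rewrite -big_split/=; apply: eq_bigr => y _; rewrite -big_split/=; apply: eq_bigr => a _.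
by case: ifP => // _; rewrite addr0.
Qed.

Lemma qsumZ P (k : F) f : qsum P (fun a b x y => k * f a b x y) = k * qsum P f.
Proof.
rewrite /qsum mulr_sumr; apply: eq_bigr => b _; rewrite mulr_sumr; apply: eq_bigr => x _.
rewrite mulr_sumr; apply: eq_bigr => y _; rewrite mulr_sumr; apply: eq_bigr => a _.
by case: ifP => // _; rewrite mulr0.
Qed.

Lemma qsum_split P Q f : qsum P f =
  qsum (fun a b x y => P a b x y && Q a b x y) f +
  qsum (fun a b x y => P a b x y && ~~ Q a b x y) f.
Proof.
rewrite /qsum -big_split/=; apply: eq_bigr => b _; rewrite -big_split/=; apply: eq_bigr => x _.
rewrite -big_split/=; apply: eq_bigr => y _; rewrite -big_split/=; apply: eq_bigr => a _.
by case: (_ == _) => //=; rewrite ?addr0//; case: (P a b x y); case: (Q a b x y) => /=; rewrite ?addr0 ?add0r.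
Qed.

Lemma shift_sum (G : nat -> F) (b : nat) : (forall a, (n < a)%N -> G a = 0) ->
  \sum_(1 <= a < n.+1) (if (b < a)%N then G a else 0) = \sum_(1 <= a < n.+1) G (a + b)%N.
Proof.
move=> G0.
have -> : \sum_(1 <= a < n.+1) G (a + b)%N = \sum_(1 + b <= a < n.+1 + b) G a.
  by rewrite big_addn addnK.
have cut (m : nat) : (n < m)%N -> \sum_(1 <= a < m) (if (b < a)%N then G a else 0)
    = \sum_(1 <= a < n.+1) (if (b < a)%N then G a else 0).
  move=> nm; rewrite (big_cat_nat (isT : (1 <= n.+1)%N) nm)/= [X in _ + X](_ : _ = 0) ?addr0//.
  by rewrite big_nat_cond big1// => a; rewrite andbT => /andP[na _]; case: ifP => // _; rewrite G0.
rewrite -(cut (n.+1 + b)%N); last by rewrite addSn ltnS leq_addr.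
rewrite (@big_cat_nat _ _ _ (1 + b)%N) ?leq_addr//=; last by rewrite leq_add2r.
rewrite big_nat_cond big1 ?add0r; last first.
  by move=> a; rewrite andbT add1n ltnS => /andP[_ ab]; rewrite ltnNge ab.
rewrite big_nat_cond [RHS]big_nat_cond; apply: eq_bigr => a; rewrite andbT add1n => /andP[ba _].
by rewrite ba.
Qed.

(** Liouville's bijection [(a, b, x, y) -> (a + b, b, x, y - x)], which preserves the equation
    because [(a + b) x + b (y - x) = a x + b y]. *)
Lemma qsum_shift f :
  qsum (fun a b x y => b < a)%N f =
  qsum (fun a b x y => x < y)%N (fun a b x y => f (a + b)%N b x (y - x)%N).
Proof.
rewrite /qsum big_nat_cond [RHS]big_nat_cond; apply: eq_bigr => b; rewrite andbT => /andP[b0 _].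
rewrite big_nat_cond [RHS]big_nat_cond; apply: eq_bigr => x; rewrite andbT => /andP[x0 _].
pose G a y := if (a * x + b * y == n)%N then f a b x y else 0.
transitivity (\sum_(1 <= y < n.+1) \sum_(1 <= a < n.+1) G (a + b)%N y).
  apply: eq_bigr => y _; rewrite -(@shift_sum (fun a => G a y)); last first.
    by move=> a na; rewrite /G; case: eqP => // H; exfalso; nia.
  by apply: eq_bigr => a _; rewrite /G; case: (b < a)%N; rewrite ?andbT ?andbF.
rewrite exchange_big/= [RHS]exchange_big/=; apply: eq_bigr => a _.
pose H y := if (a * x + b * y == n)%N then f (a + b)%N b x (y - x)%N else 0.
transitivity (\sum_(1 <= y < n.+1) H (y + x)%N).
  apply: eq_bigr => y _; rewrite /G /H addnK mulnDl mulnDr -addnA.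
  by rewrite (addnC (b * x)%N).
rewrite -(@shift_sum H); last by move=> y ny; rewrite /H; case: eqP => // E; exfalso; nia.
by apply: eq_bigr => y _; rewrite /H; case: (x < y)%N; rewrite ?andbT ?andbF.
Qed.

Lemma qsum_swap P f :
  qsum P f = qsum (fun a b x y => P b a y x) (fun a b x y => f b a y x).
Proof.
rewrite /qsum.
under eq_bigr => b _.
  under eq_bigr => x _ do rewrite exchange_big/=.
  rewrite exchange_big/=.
  over.
rewrite exchange_big/=; apply: eq_bigr => a _.
under eq_bigr => b _ do rewrite exchange_big/=.
rewrite exchange_big/=; apply: eq_bigr => y _.
rewrite exchange_big/=; apply: eq_bigr => x _; apply: eq_bigr => b _.
by rewrite addnC.
Qed.

Lemma qsum_shift' f :
  qsum (fun a b x y => a < b)%N f =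
  qsum (fun a b x y => y < x)%N (fun a b x y => f a (b + a)%N (x - y)%N y).
Proof. by rewrite qsum_swap qsum_shift qsum_swap. Qed.

Local Notation all4 := (fun _ _ _ _ => true).

Lemma qsum_tri_ab f : qsum all4 f =
  qsum (fun a b _ _ => b < a)%N f + qsum (fun a b _ _ => a < b)%N f
  + qsum (fun a b _ _ => a == b) f.
Proof.
rewrite (qsum_split _ (fun a b _ _ => b < a)%N) -addrA; congr (_ + _).
rewrite (qsum_split _ (fun a b _ _ => a < b)%N); congr (_ + _); apply: eq_qsum => a b x y *; split=> //=; lia.
Qed.

Lemma qsum_tri_xy f : qsum all4 f =
  qsum (fun _ _ x y => x < y)%N f + qsum (fun _ _ x y => y < x)%N f
  + qsum (fun _ _ x y => x == y) f.
Proof.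
rewrite (qsum_split _ (fun _ _ x y => x < y)%N) -addrA; congr (_ + _).
rewrite (qsum_split _ (fun _ _ x y => y < x)%N); congr (_ + _); apply: eq_qsum => a b x y *; split=> //=; lia.
Qed.

Local Notation eq_ab := (fun a b _ _ => a == b).
Local Notation eq_xy := (fun _ _ x y => x == y).

(* Moving one step along the chains (b + ka, x - ky) for fixed a, y. *)
Lemma qsum_chain (f g : nat -> nat -> F) : (forall a b, f a b = g a (b + a)%N) ->
  qsum (fun _ _ x y => x < y)%N (fun a b _ _ => f a b) + qsum eq_xy (fun a b _ _ => f a b)
  - qsum (fun a b _ _ => b < a)%N (fun a b _ _ => g a b) - qsum eq_ab (fun a b _ _ => g a b)
  = qsum all4 (fun a b _ _ => f a b) - qsum all4 (fun a b _ _ => g a b).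
Proof.
move=> fg; rewrite (qsum_tri_xy (fun a b _ _ => f a b)) (qsum_tri_ab (fun a b _ _ => g a b)).
rewrite (qsum_shift' (fun a b _ _ => g a b)).
rewrite (@eq_qsum (fun _ _ x y => y < x)%N (fun _ _ x y => y < x)%N
  (fun a b _ _ => f a b) (fun a b _ _ => g a (b + a)%N)); last first.
  by move=> a b x y *; split => //; rewrite fg.
by ring.
Qed.

(** The sum of [f (a - b)] is split by comparing [a] and [b], that of [f (a + b)] by comparing [x]
    and [y]. The bijection reduces both to sums of [f a], whose index sets [x < y] and [b < a] are
    related by [qsum_chain]. *)
Lemma liouville (f : F -> F) : (forall u, f (- u) = f u) ->
  qsum all4 (fun a b _ _ => f (a%:R - b%:R) - f (a%:R + b%:R)) =
  2 * qsum eq_ab (fun a _ _ _ => f a%:R) - 2 * qsum eq_xy (fun a _ _ _ => f a%:R)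
  + qsum eq_ab (fun _ _ _ _ => f 0) - qsum eq_xy (fun a b _ _ => f (a%:R + b%:R)).
Proof.
move=> fe.
have -> : qsum all4 (fun a b _ _ => f (a%:R - b%:R) - f (a%:R + b%:R)) =
    qsum all4 (fun a b _ _ => f (a%:R - b%:R)) - qsum all4 (fun a b _ _ => f (a%:R + b%:R)).
  rewrite -mulN1r -qsumZ -qsumD; apply: eq_qsum => a b x y *; split=> // _.
  by rewrite mulN1r.
have e1 : qsum (fun a b _ _ => b < a)%N (fun a b _ _ => f (a%:R - b%:R)) =
    qsum (fun _ _ x y => x < y)%N (fun a _ _ _ => f a%:R).
  rewrite qsum_shift; apply: eq_qsum => a b x y *; split=> // _.
  by rewrite natrD addrK.
have e2 : qsum (fun a b _ _ => a < b)%N (fun a b _ _ => f (a%:R - b%:R)) =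
    qsum (fun _ _ x y => x < y)%N (fun a _ _ _ => f a%:R).
  rewrite qsum_swap -e1; apply: eq_qsum => a b x y *; split=> // _.
  by rewrite -fe opprB.
have e3 : qsum (fun _ _ x y => x < y)%N (fun a b _ _ => f (a%:R + b%:R)) =
    qsum (fun a b _ _ => b < a)%N (fun a _ _ _ => f a%:R).
  by rewrite qsum_shift; apply: eq_qsum => a b x y *; split=> // _; rewrite natrD.
have e4 : qsum (fun _ _ x y => y < x)%N (fun a b _ _ => f (a%:R + b%:R)) =
    qsum (fun a b _ _ => b < a)%N (fun a _ _ _ => f a%:R).
  by rewrite qsum_swap -e3; apply: eq_qsum => a b x y *; split=> // _; rewrite addrC.
have e5 : qsum eq_ab (fun a b _ _ => f (a%:R - b%:R)) = qsum eq_ab (fun _ _ _ _ => f 0).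
  by apply: eq_qsum => a b x y *; split=> // /eqP ->; rewrite subrr.
rewrite qsum_tri_ab (qsum_tri_xy (fun a b _ _ => f (a%:R + b%:R))) e1 e2 e3 e4 e5.
have := qsum_chain (f := fun a _ => f a%:R) (g := fun a _ => f a%:R) (fun _ _ => erefl).
rewrite subrr => H.
have -> : qsum (fun _ _ x y => x < y)%N (fun a _ _ _ => f a%:R) =
    qsum (fun a b _ _ => b < a)%N (fun a _ _ _ => f a%:R)
    + qsum eq_ab (fun a _ _ _ => f a%:R) - qsum eq_xy (fun a _ _ _ => f a%:R).
  by apply/eqP; rewrite -subr_eq0 -[X in _ == X]H; apply/eqP; ring.
by ring.
Qed.

(** Even powers in [liouville] mix [a^3 b^3] with [a b^5]; the weight [a b] separates them. [P + Q]
    equals [2 Z(a,b) + 2 Z(b,a) + 12 a^3 b^3], and the pair [U], [V], chosen with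
    [U(a,b) = V(a,a+b)] and [U - V = 2 Z], eliminates [Z] through the chain identity. *)
Lemma liouville_weighted :
  12 * qsum all4 (fun a b _ _ => a%:R ^+ 3 * b%:R ^+ 3) =
  qsum eq_xy (fun a b _ _ => a%:R * b%:R * (a%:R + b%:R) ^+ 4
                             - 2 * (a%:R + b%:R) * b%:R * a%:R ^+ 4).
Proof.
pose U (a b : nat) : F := (a%:R + b%:R) * b%:R * a%:R ^+ 4.
pose V (a b : nat) : F := b%:R * (b%:R - a%:R) * a%:R ^+ 4.
pose P (a b : nat) : F := a%:R * b%:R * (a%:R - b%:R) ^+ 4.
pose Q (a b : nat) : F := a%:R * b%:R * (a%:R + b%:R) ^+ 4.
pose Z (a b : nat) : F := a%:R ^+ 5 * b%:R.
have e1 : qsum (fun a b _ _ => b < a)%N (fun a b _ _ => P a b) =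
    qsum (fun _ _ x y => x < y)%N (fun a b _ _ => U a b).
  by rewrite qsum_shift; apply: eq_qsum => a b x y *; split=> // _; rewrite /P /U natrD; ring.
have e2 : qsum (fun a b _ _ => a < b)%N (fun a b _ _ => P a b) =
    qsum (fun _ _ x y => x < y)%N (fun a b _ _ => U a b).
  by rewrite qsum_swap -e1; apply: eq_qsum => a b x y *; split=> // _; rewrite /P; ring.
have e3 : qsum (fun _ _ x y => x < y)%N (fun a b _ _ => Q a b) =
    - qsum (fun a b _ _ => b < a)%N (fun a b _ _ => V a b).
  rewrite -mulN1r -qsumZ qsum_shift; apply: eq_qsum => a b x y *; split=> // _.
  by rewrite /Q /V natrD; ring.
have e4 : qsum (fun _ _ x y => y < x)%N (fun a b _ _ => Q a b) =
    - qsum (fun a b _ _ => b < a)%N (fun a b _ _ => V a b).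
  by rewrite qsum_swap -e3; apply: eq_qsum => a b x y *; split=> // _; rewrite /Q; ring.
have e5 : qsum eq_ab (fun a b _ _ => P a b) = 0.
  rewrite -(mul0r (qsum eq_ab (fun a b _ _ => P a b))) -qsumZ; apply: eq_qsum => a b x y *.
  by split=> // /eqP ->; rewrite /P; ring.
have e6 : qsum eq_ab (fun a b _ _ => V a b) = 0.
  rewrite -(mul0r (qsum eq_ab (fun a b _ _ => P a b))) -qsumZ; apply: eq_qsum => a b x y *.
  by split=> // /eqP ->; rewrite /V; ring.
have e7 : qsum all4 (fun a b _ _ => U a b) - qsum all4 (fun a b _ _ => V a b) =
    2 * qsum all4 (fun a b _ _ => Z a b).
  rewrite -mulN1r -!qsumZ -qsumD; apply: eq_qsum => a b x y *; split=> // _.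
  by rewrite /U /V /Z; ring.
have e8 : qsum all4 (fun a b _ _ => Z b a) = qsum all4 (fun a b _ _ => Z a b).
  by rewrite qsum_swap.
have e9 : qsum all4 (fun a b _ _ => P a b) + qsum all4 (fun a b _ _ => Q a b) =
    2 * qsum all4 (fun a b _ _ => Z a b) + 2 * qsum all4 (fun a b _ _ => Z b a)
    + 12 * qsum all4 (fun a b _ _ => a%:R ^+ 3 * b%:R ^+ 3).
  rewrite -!qsumZ -!qsumD; apply: eq_qsum => a b x y *; split=> // _.
  by rewrite /P /Q /Z; ring.
have := qsum_chain (f := U) (g := V).
rewrite e6 e7 subr0 => H.
have {}H : qsum (fun _ _ x y => x < y)%N (fun a b _ _ => U a b) =
    qsum (fun a b _ _ => b < a)%N (fun a b _ _ => V a b) - qsum eq_xy (fun a b _ _ => U a b)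
    + 2 * qsum all4 (fun a b _ _ => Z a b).
  rewrite -H; first by ring.
  by move=> a b; rewrite /U /V natrD; ring.
rewrite (qsum_tri_ab (fun a b _ _ => P a b)) (qsum_tri_xy (fun a b _ _ => Q a b)) in e9.
rewrite e1 e2 e3 e4 e5 e8 H in e9.
have -> : qsum eq_xy (fun a b _ _ => a%:R * b%:R * (a%:R + b%:R) ^+ 4
      - 2 * (a%:R + b%:R) * b%:R * a%:R ^+ 4) =
    qsum eq_xy (fun a b _ _ => Q a b) + (- 2) * qsum eq_xy (fun a b _ _ => U a b).
  rewrite -!qsumZ -!qsumD; apply: eq_qsum => a b x y *; split=> // _.
  by rewrite /Q /U; ring.
apply/eqP; rewrite -subr_eq0; apply/eqP; move/eqP: e9; rewrite eq_sym -subr_eq0 => /eqP e9.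
by rewrite -[RHS]e9; ring.
Qed.

End DivisorConvolutions.

(** * Evaluation of the quadruple sums by divisors *)

Section DivisorConvolutionValues.
Variable F : numFieldType.
Variable n : nat.
Hypothesis n0 : (0 < n)%N.
Local Notation all4 := (fun _ _ _ _ => true).
Local Notation eq_ab := (fun a b _ _ => a == b).
Local Notation eq_xy := (fun _ _ x y => x == y).

Lemma sum_nat_pred1 (c : nat -> F) z :
  \sum_(1 <= x < n.+1) (if x == z then c x else 0) = if (0 < z <= n)%N then c z else 0.
Proof.
rewrite -big_mkcond big_nat1_eq.
by rewrite ltnS.
Qed.

Lemma sum_nat_dvd (c : F) a m : (0 < a)%N -> (0 < m <= n)%N ->
  \sum_(1 <= x < n.+1) (if (a * x == m)%N then c else 0) = if (a %| m)%N then c else 0.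
Proof.
move=> a0 /andP[m0 mn]; case: ifP => [/dvdnP[k kE]|nd].
  rewrite (eq_bigr (fun x => if x == k then c else 0)); last first.
    by move=> x _; rewrite kE mulnC eqn_pmul2r.
  by rewrite sum_nat_pred1; case: ifP => // /negP[]; apply/andP; split; nia.
rewrite big1// => x _; case: eqP => // E; move: nd.
by rewrite -E dvdn_mulr.
Qed.

Lemma sum_divisors (g : nat -> F) m : (0 < m <= n)%N ->
  \sum_(d <- divisors m) g d = \sum_(1 <= a < n.+1) if (a %| m)%N then g a else 0.
Proof.
case: m => // m /andP[_ mn].
rewrite (big_divisors g) [RHS]big_add1 big_mkcond/=.
rewrite [RHS](big_cat_nat (leq0n m.+1) mn)/= [X in _ + X](_ : _ = 0) ?addr0//.
by rewrite big_nat_cond big1// => a; rewrite andbT => /andP[ma _]; rewrite gtnNdvd.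
Qed.

(** For [x = y] the equation reads [(a + b) x = n], so [d = a + b] divides [n]. *)
Lemma qsum_eq_xy (g : nat -> nat -> F) :
  qsum n eq_xy (fun a b _ _ => g a b) =
  \sum_(d <- divisors n) \sum_(1 <= a < d) g a (d - a)%N.
Proof.
rewrite sum_divisors ?n0 ?leqnn//.
transitivity (\sum_(1 <= b < n.+1) \sum_(1 <= a < n.+1) if (a + b %| n)%N then g a b else 0).
  rewrite /qsum big_nat_cond [RHS]big_nat_cond; apply: eq_bigr => b; rewrite andbT => /andP[b0 _].
  under eq_bigr => x _ do rewrite exchange_big/=.
  rewrite exchange_big/=.
  rewrite big_nat_cond [RHS]big_nat_cond; apply: eq_bigr => a; rewrite andbT => /andP[a0 _].
  rewrite -(sum_nat_dvd (g a b) (a := a + b)%N) ?n0 ?leqnn// ?addn_gt0 ?a0//.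
  rewrite big_nat_cond [RHS]big_nat_cond; apply: eq_bigr => x; rewrite andbT ltnS => /andP[x0 xn].
  rewrite (eq_bigr (fun y => if y == x then (if (a * x + b * y == n)%N then g a b else 0) else 0)); last first.
    by move=> y _; rewrite (eq_sym x y); case: (y == x); rewrite ?andbT ?andbF.
  by rewrite sum_nat_pred1 x0 xn/= mulnDl.
rewrite exchange_big/=.
transitivity (\sum_(1 <= a < n.+1) \sum_(1 <= d < n.+1)
   if (a < d)%N then (if (d %| n)%N then g a (d - a)%N else 0) else 0).
  apply: eq_bigr => a _.
  rewrite (@shift_sum _ _ (fun d => if (d %| n)%N then g a (d - a)%N else 0)); last first.
    by move=> d nd; rewrite gtnNdvd.
  by apply: eq_bigr => b _; rewrite addnK addnC.
rewrite exchange_big/= big_nat_cond [RHS]big_nat_cond; apply: eq_bigr => d; rewrite andbT => /andP[d0 dn].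
case: ifP => dv; last by rewrite big1// => a _; case: ifP.
rewrite (@big_cat_nat _ _ _ d)//=; last exact: ltnW.
rewrite [X in _ + X](_ : _ = 0) ?addr0.
  by rewrite big_nat_cond [RHS]big_nat_cond; apply: eq_bigr => a; rewrite andbT => /andP[_ ->].
by rewrite big_nat_cond big1// => a; rewrite andbT => /andP[da _]; rewrite ltnNge da.
Qed.

(** For [a = b = d] the equation reads [x + y = n / d], which has [n / d - 1] positive solutions. *)
Lemma qsum_eq_ab (g : nat -> F) :
  qsum n eq_ab (fun a _ _ _ => g a) =
  \sum_(d <- divisors n) ((n %/ d)%:R - 1) * g d.
Proof.
rewrite sum_divisors ?n0 ?leqnn// /qsum.
rewrite big_nat_cond [RHS]big_nat_cond; apply: eq_bigr => b; rewrite andbT ltnS => /andP[b0 bn].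
transitivity (\sum_(1 <= x < n.+1) \sum_(1 <= y < n.+1) if (b * (y + x) == n)%N then g b else 0).
  apply: eq_bigr => x _; apply: eq_bigr => y _.
  rewrite (eq_bigr (fun a => if a == b then (if (a * x + b * y == n)%N then g a else 0) else 0)); last first.
    by move=> a _; case: (a == b); rewrite ?andbT ?andbF.
  by rewrite sum_nat_pred1 b0 bn/= mulnDr addnC.
transitivity (\sum_(1 <= x < n.+1) if (b %| n)%N && (x < n %/ b)%N then g b else 0).
  apply: eq_bigr => x _.
  rewrite -(@shift_sum _ _ (fun z => if (b * z == n)%N then g b else 0)); last first.
    by move=> z nz; case: eqP => // E; exfalso; nia.
  case: (boolP (b %| n)%N) => /= [bd|nb].
    have [k kE] := dvdnP bd; have kn : (0 < k <= n)%N by apply/andP; split; nia.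
    rewrite (eq_bigr (fun z => if z == k then (if (x < z)%N then g b else 0) else 0)); last first.
      by move=> z _; rewrite {1}kE mulnC eqn_pmul2r//; case: (z == k); case: ifP.
    by rewrite sum_nat_pred1 kn kE mulnK.
  rewrite big1// => z _; case: ifP => // _; case: eqP => // E.
  by move: nb; rewrite -E dvdn_mulr.
case: ifP => bd /=; last by rewrite big1.
rewrite -big_mkcond -(big_nat_widen 1 _ n.+1 predT); last first.
  by rewrite (leq_trans (leq_div _ _)).
by rewrite sumr_const_nat -[LHS]mulr_natl natrB// divn_gt0//.
Qed.

(** The solutions are grouped by the value [m] of [a x]. *)
Lemma qsum_mul (g h : nat -> F) :
  qsum n all4 (fun a b _ _ => g a * h b) =
  \sum_(1 <= m < n) (\sum_(d <- divisors m) g d) * (\sum_(e <- divisors (n - m)) h e).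
Proof.
have E m : (0 < m <= n)%N -> forall f : nat -> F, \sum_(d <- divisors m) f d =
   \sum_(1 <= a < n.+1) \sum_(1 <= x < n.+1) if (a * x == m)%N then f a else 0.
  move=> mn f; rewrite sum_divisors//.
  rewrite big_nat_cond [RHS]big_nat_cond; apply: eq_bigr => a; rewrite andbT => /andP[a0 _].
  by rewrite sum_nat_dvd.
symmetry; transitivity (\sum_(1 <= m < n) \sum_(1 <= b < n.+1) \sum_(1 <= x < n.+1)
    \sum_(1 <= y < n.+1) \sum_(1 <= a < n.+1)
      if (a * x == m)%N then (if (b * y == n - m)%N then g a * h b else 0) else 0).
  rewrite big_nat_cond [RHS]big_nat_cond; apply: eq_bigr => m; rewrite andbT => /andP[m0 mn].
  rewrite E; last by rewrite m0 ltnW.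
  rewrite (E (n - m)%N); last by rewrite subn_gt0 mn leq_subr.
  rewrite mulr_sumr; apply: eq_bigr => b _.
  rewrite exchange_big/= mulr_suml; apply: eq_bigr => x _.
  rewrite mulr_sumr; apply: eq_bigr => y _; rewrite mulr_suml; apply: eq_bigr => a _.
  by case: ifP; case: ifP; rewrite ?mul0r ?mulr0.
rewrite exchange_big/= /qsum big_nat_cond [RHS]big_nat_cond; apply: eq_bigr => b; rewrite andbT => /andP[b0 _].
rewrite exchange_big/= big_nat_cond [RHS]big_nat_cond; apply: eq_bigr => x; rewrite andbT => /andP[x0 _].
rewrite exchange_big/= big_nat_cond [RHS]big_nat_cond; apply: eq_bigr => y; rewrite andbT => /andP[y0 _].
rewrite exchange_big/= big_nat_cond [RHS]big_nat_cond; apply: eq_bigr => a; rewrite andbT => /andP[a0 _].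
rewrite andbT; have by0 : (0 < b * y)%N by rewrite muln_gt0 b0.
have ax0 : (0 < a * x)%N by rewrite muln_gt0 a0.
rewrite big_nat_cond (eq_bigr (fun m => if m == (a * x)%N then (if (a * x + b * y == n)%N then g a * h b else 0) else 0)).
  rewrite -big_nat_cond -big_mkcond big_nat1_eq.
  by case: eqP => E1; case: ifP => // /negP[]; apply/andP; split; lia.
move=> m; rewrite andbT => /andP[m0 mn]; rewrite (eq_sym m); case: eqP => // ->.
by congr (if _ then _ else _); apply/eqP/eqP; lia.
Qed.

End DivisorConvolutionValues.

(** * Convolutions of divisor sums *)

Section RamanujanConvolutions.
Variable F : numFieldType.

Definition sg k n : F := (sigma_ k n)%:R.

Lemma sgE k n : sg k n = \sum_(d <- divisors n) d%:R ^+ k.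
Proof. by rewrite /sg /sigma_ natr_sum; apply: eq_bigr => d _; rewrite natrX. Qed.

Definition sconv i j n : F := \sum_(1 <= m < n) sg i m * sg j (n - m)%N.

Lemma sconvC i j n : sconv i j n = sconv j i n.
Proof.
rewrite /sconv big_nat_rev/= big_nat_cond [RHS]big_nat_cond; apply: eq_bigr => m.
rewrite andbT => /andP[m0 mn]; rewrite mulrC add1n subSS subKn//; exact: ltnW.
Qed.

Lemma qsum_pow i j n : (0 < n)%N ->
  qsum n (fun _ _ _ _ => true) (fun a b _ _ => a%:R ^+ i * b%:R ^+ j) = sconv i j n.
Proof.
move=> n0; rewrite (qsum_mul n0 (fun a => a%:R ^+ i) (fun b => b%:R ^+ j)).
by apply: eq_bigr => m _; rewrite !sgE.
Qed.

(** Power sums are found by checking the differences of a closed form; [c] clears its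
    denominators. *)
Lemma sum_nat_pos (f : nat -> F) (g : F -> F) (c : F) :
  g 1 = 0 -> (forall d : nat, (0 < d)%N -> c * f d = g (d%:R + 1) - g d%:R) ->
  forall d, (0 < d)%N -> c * \sum_(1 <= a < d) f a = g d%:R.
Proof.
move=> g1 H d; elim: d => // -[_ _|d IH _]; first by rewrite big_nil mulr0 g1.
rewrite big_nat_recr//= mulrDr IH// H// addrC subrK natr1.
by [].
Qed.

Lemma eq_sum_divisors n (f g : nat -> F) : (0 < n)%N ->
  (forall d, (0 < d)%N -> (d %| n)%N -> f d = g d) ->
  \sum_(d <- divisors n) f d = \sum_(d <- divisors n) g d.
Proof.
move=> n0 fg; rewrite big_seq [RHS]big_seq; apply: eq_bigr => d.
by rewrite -dvdn_divisors// => dn; apply: fg => //; exact: dvdn_gt0 dn.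
Qed.

Lemma natr_divn n d : (0 < d)%N -> (d %| n)%N -> n%:R = (n %/ d)%:R * d%:R :> F.
Proof. by move=> d0 dn; rewrite -natrM divnK. Qed.

Lemma liouville_divisors (f : F -> F) n : (0 < n)%N -> (forall u, f (- u) = f u) ->
  qsum n (fun _ _ _ _ => true) (fun a b _ _ => f (a%:R - b%:R) - f (a%:R + b%:R)) =
  \sum_(d <- divisors n)
    (((n %/ d)%:R - 1) * (2 * f d%:R + f 0) - \sum_(1 <= a < d) (2 * f a%:R + f d%:R)).
Proof.
move=> n0 fe; rewrite liouville// (qsum_eq_ab n0 (fun a => f a%:R)) (qsum_eq_ab n0 (fun=> f 0)).
rewrite (qsum_eq_xy n0 (fun a _ => f a%:R)) (qsum_eq_xy n0 (fun a b => f (a%:R + b%:R))).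
rewrite !mulr_sumr -!sumrB -big_split/= -!sumrB; apply: eq_bigr => d _.
rewrite big_split/= -mulr_sumr [X in _ - X = _](_ : _ = \sum_(1 <= a < d) f d%:R); first by ring.
rewrite big_nat_cond [RHS]big_nat_cond; apply: eq_bigr => a; rewrite andbT => /andP[_ ad].
by rewrite -natrD subnKC// ltnW.
Qed.

(** [f u = u^2] in Liouville's identity, as [(a - b)^2 - (a + b)^2 = - 4 a b]. The next power [u^4]
    gives [sconv 1 3] in the same way. *)
Lemma sconv11 n : (0 < n)%N ->
  12 * sconv 1 1 n = 5 * sg 3 n + sg 1 n - 6 * n%:R * sg 1 n.
Proof.
move=> n0; have := liouville_divisors (f := fun u => u ^+ 2) n0 (fun u => sqrrN u).
rewrite (@eq_qsum _ _ _ (fun _ _ _ _ => true) _ (fun a b _ _ => (- 4) * (a%:R ^+ 1 * b%:R ^+ 1))); last first.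
  by move=> a b x y *; split=> // _; ring.
rewrite qsumZ qsum_pow// => H.
have -> : 12 * sconv 1 1 n = (- 3) * (- 4 * sconv 1 1 n) by ring.
rewrite H mulr_sumr !sgE !mulr_sumr -big_split/= -sumrB; apply: eq_sum_divisors => // d d0 dn.
rewrite (natr_divn d0 dn).
have HS := sum_nat_pos (f := fun a => 2 * a%:R ^+ 2 + d%:R ^+ 2) (c := 3)
  (g := fun x => x * (x - 1) * (2 * x - 1) + 3 * (x - 1) * d%:R ^+ 2) _ _ d0.
have {}HS : 3 * \sum_(1 <= a < d) (2 * a%:R ^+ 2 + d%:R ^+ 2) = d%:R * (d%:R - 1) * (2 * d%:R - 1) + 3 * (d%:R - 1) * d%:R ^+ 2 :> F.
  by apply: HS => [|e _]; ring.
move: HS; set S := \sum_(1 <= a < d) _; move: S (d%:R : F) ((n %/ d)%:R : F) => S D N HS.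
by rewrite mulrBr !mulNr opprK HS; ring.
Qed.

Lemma sconv13 n : (0 < n)%N ->
  240 * sconv 1 3 n = 21 * sg 5 n + 10 * sg 3 n - 30 * n%:R * sg 3 n - sg 1 n.
Proof.
move=> n0; have := liouville_divisors (f := fun u => u ^+ 4) n0 (fun u => _ : (- u) ^+ 4 = u ^+ 4).
rewrite (@eq_qsum _ _ _ (fun _ _ _ _ => true) _ (fun a b _ _ => (- 8) * (a%:R ^+ 3 * b%:R ^+ 1) + (- 8) * (a%:R ^+ 1 * b%:R ^+ 3))); last first.
  by move=> a b x y *; split=> // _; ring.
rewrite qsumD !qsumZ !qsum_pow// (sconvC 3) => H.
have -> : 240 * sconv 1 3 n = (- 15) * (- 8 * sconv 1 3 n + - 8 * sconv 1 3 n) by ring.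
rewrite H; last by move=> u; ring.
rewrite mulr_sumr !sgE !mulr_sumr -!big_split/= -!sumrB; apply: eq_sum_divisors => // d d0 dn.
rewrite (natr_divn d0 dn).
have HS := sum_nat_pos (f := fun a => 2 * a%:R ^+ 4 + d%:R ^+ 4) (c := 15)
  (g := fun x => x * (x - 1) * (2 * x - 1) * (3 * x ^+ 2 - 3 * x - 1) + 15 * (x - 1) * d%:R ^+ 4) _ _ d0.
have {}HS : 15 * \sum_(1 <= a < d) (2 * a%:R ^+ 4 + d%:R ^+ 4) = d%:R * (d%:R - 1) * (2 * d%:R - 1) * (3 * d%:R ^+ 2 - 3 * d%:R - 1) + 15 * (d%:R - 1) * d%:R ^+ 4 :> F.
  by apply: HS => [|e _]; ring.
move: HS; set S := \sum_(1 <= a < d) _; move: S (d%:R : F) ((n %/ d)%:R : F) => S D N HS.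
by rewrite mulrBr !mulNr opprK HS; ring.
Qed.

Lemma sconv33 n : (0 < n)%N -> 120 * sconv 3 3 n = sg 7 n - sg 3 n.
Proof.
move=> n0; have := liouville_weighted F n.
rewrite (qsum_pow 3 3 n0) (qsum_eq_xy n0 (fun a b => a%:R * b%:R * (a%:R + b%:R) ^+ 4
   - 2 * (a%:R + b%:R) * b%:R * a%:R ^+ 4)) => H.
have -> : 120 * sconv 3 3 n = 10 * (12 * sconv 3 3 n) by ring.
rewrite H mulr_sumr !sgE -sumrB; apply: eq_sum_divisors => // d d0 dn.
rewrite (_ : \sum_(1 <= a < d) _ = \sum_(1 <= a < d)
   (a%:R * (d%:R - a%:R) * d%:R ^+ 4 - 2 * d%:R * (d%:R - a%:R) * a%:R ^+ 4)); last first.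
  rewrite big_nat_cond [RHS]big_nat_cond; apply: eq_bigr => a; rewrite andbT => /andP[_ ad].
  by rewrite natrB ?(ltnW ad)//; congr (_ - _); ring.
have s1 := sum_nat_pos (f := fun a => a%:R) (c := 2) (g := fun x => x * (x - 1)) _ _ d0.
have s2 := sum_nat_pos (f := fun a => a%:R ^+ 2) (c := 6) (g := fun x => x * (x - 1) * (2 * x - 1)) _ _ d0.
have s4 := sum_nat_pos (f := fun a => a%:R ^+ 4) (c := 30)
  (g := fun x => x * (x - 1) * (2 * x - 1) * (3 * x ^+ 2 - 3 * x - 1)) _ _ d0.
have s5 := sum_nat_pos (f := fun a => a%:R ^+ 5) (c := 12)
  (g := fun x => x ^+ 2 * (x - 1) ^+ 2 * (2 * x ^+ 2 - 2 * x - 1)) _ _ d0.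
have -> : \sum_(1 <= a < d) (a%:R * (d%:R - a%:R) * d%:R ^+ 4 - 2 * d%:R * (d%:R - a%:R) * a%:R ^+ 4) =
   d%:R ^+ 5 * \sum_(1 <= a < d) a%:R - d%:R ^+ 4 * \sum_(1 <= a < d) a%:R ^+ 2
   - 2 * d%:R ^+ 2 * \sum_(1 <= a < d) a%:R ^+ 4 + 2 * d%:R * \sum_(1 <= a < d) a%:R ^+ 5 :> F.
  rewrite !mulr_sumr -!sumrB -big_split/=; apply: eq_bigr => a _; ring.
move: s1 s2 s4 s5.
set S1 := \sum_(1 <= a < d) a%:R; set S2 := \sum_(1 <= a < d) a%:R ^+ 2.
set S4 := \sum_(1 <= a < d) a%:R ^+ 4; set S5 := \sum_(1 <= a < d) a%:R ^+ 5.
move: S1 S2 S4 S5 (d%:R : F) => S1 S2 S4 S5 D s1 s2 s4 s5.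
have {}s1 : S1 = D * (D - 1) / 2 by rewrite -s1 => [|//|e _]; [field|ring|ring].
have {}s2 : S2 = D * (D - 1) * (2 * D - 1) / 6 by rewrite -s2 => [|//|e _]; [field|ring|ring].
have {}s4 : S4 = D * (D - 1) * (2 * D - 1) * (3 * D ^+ 2 - 3 * D - 1) / 30.
  by rewrite -s4 => [|//|e _]; [field|ring|ring].
have {}s5 : S5 = D ^+ 2 * (D - 1) ^+ 2 * (2 * D ^+ 2 - 2 * D - 1) / 12.
  by rewrite -s5 => [|//|e _]; [field|ring|ring].
by rewrite s1 s2 s4 s5; field.
Qed.

(** [f u = u^6] yields [- 12 (a^5 b + a b^5) - 40 a^3 b^3], hence the recourse to [sconv33]. *)
Lemma sconv15 n : (0 < n)%N ->
  504 * sconv 1 5 n = 20 * sg 7 n + 21 * sg 5 n - 42 * n%:R * sg 5 n + sg 1 n.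
Proof.
move=> n0; have := liouville_divisors (f := fun u => u ^+ 6) n0 (fun u => _ : (- u) ^+ 6 = u ^+ 6).
rewrite (@eq_qsum _ _ _ (fun _ _ _ _ => true) _ (fun a b _ _ =>
   ((- 12) * (a%:R ^+ 5 * b%:R ^+ 1) + (- 12) * (a%:R ^+ 1 * b%:R ^+ 5)) + (- 40) * (a%:R ^+ 3 * b%:R ^+ 3))); last first.
  by move=> a b x y *; split=> // _; ring.
rewrite !qsumD !qsumZ !qsum_pow// (sconvC 5) => H.
have s33 : sconv 3 3 n = (sg 7 n - sg 3 n) / 120.
  by rewrite -sconv33//; field.
have -> : 504 * sconv 1 5 n = (- 21) * (- 12 * sconv 1 5 n + - 12 * sconv 1 5 n + - 40 * sconv 3 3 n)
   - 7 * (sg 7 n - sg 3 n) by rewrite s33; field.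
rewrite H; last by move=> u; ring.
rewrite !sgE !(mulr_sumr, =^~ sumrB, =^~ big_split)/=; apply: eq_sum_divisors => // d d0 dn.
rewrite (natr_divn d0 dn).
have HS := sum_nat_pos (f := fun a => 2 * a%:R ^+ 6 + d%:R ^+ 6) (c := 21)
  (g := fun x => x * (x - 1) * (2 * x - 1) * (3 * x ^+ 4 - 6 * x ^+ 3 + 3 * x + 1) + 21 * (x - 1) * d%:R ^+ 6) _ _ d0.
have {}HS : 21 * \sum_(1 <= a < d) (2 * a%:R ^+ 6 + d%:R ^+ 6) = d%:R * (d%:R - 1) * (2 * d%:R - 1) * (3 * d%:R ^+ 4 - 6 * d%:R ^+ 3 + 3 * d%:R + 1) + 21 * (d%:R - 1) * d%:R ^+ 6 :> F.
  by apply: HS => [|e _]; ring.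
move: HS; set S := \sum_(1 <= a < d) _; move: S (d%:R : F) ((n %/ d)%:R : F) => S D N HS.
by rewrite mulrBr !mulNr opprK HS; ring.
Qed.

End RamanujanConvolutions.

(** * Ramanujan's differential equations *)

Section RamanujanODE.
Variable R : realType.
Local Notation C := (cplx R).
Implicit Types (tau : C) (a : nat -> C).
Local Notation T := (twopii R).

Lemma upper_near tau x : upper tau -> cmod (x - tau) < complex.Im tau -> upper x.
Proof.
rewrite /upper /= => t0 H; have := cmod_Im (x - tau); rewrite ImD ImN ler_norml.
by move=> /andP[h _]; lra.
Qed.

Lemma cder_upper (f g : C -> C) tau l : upper tau ->
  (forall x, upper x -> f x = g x) -> cder f tau l -> cder g tau l.
Proof.
move=> t0 fg; apply: cder_local (t0 : 0 < complex.Im tau) _ => x /(upper_near t0).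
exact: fg.
Qed.

Lemma cder_ev_qpar a tau : conv a -> upper tau ->
  cder (fun x => ev a (qpar x)) tau (T * ev (theta a) (qpar tau)).
Proof.
move=> ca t0; have q1 := upper_qpar t0.
apply: cder_eq (cder_comp (cder_qpar tau) (cder_ev ca q1)) _.
by rewrite ev_theta//; ring.
Qed.

Lemma cauchy_prod_eis (c d : C) i j n :
  cauchy_prod (eis_coef c i) (eis_coef d j) n.+1 =
  d * sg C j n.+1 + c * sg C i n.+1 + c * d * sconv C i j n.+1.
Proof.
rewrite /cauchy_prod big_ord_recl big_ord_recr/= subn0 subnn mul1r mulr1.
rewrite -addrA; congr (_ + _); rewrite addrC; congr (_ + _).
rewrite /sconv big_add1 big_mkord mulr_sumr; apply: eq_bigr => k _.
rewrite /bump /= add1n subSS.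
have -> : (n - k = (n - k).-1.+1)%N by have := ltn_ord k; lia.
rewrite /eis_coef /sg; ring.
Qed.

Definition e2c := eis_coef (- 24%:R : C) 1.
Definition e4c := eis_coef (240%:R : C) 3.
Definition e6c := eis_coef (- 504%:R : C) 5.

Lemma conv_e2 : conv e2c. Proof. exact: conv_eis. Qed.
Lemma conv_e4 : conv e4c. Proof. exact: conv_eis. Qed.
Lemma conv_e6 : conv e6c. Proof. exact: conv_eis. Qed.

Lemma E2_ev tau : upper tau -> E2 tau = ev e2c (qpar tau).
Proof. exact: eisenstein_ev. Qed.
Lemma E4_ev tau : upper tau -> E4 tau = ev e4c (qpar tau).
Proof. exact: eisenstein_ev. Qed.
Lemma E6_ev tau : upper tau -> E6 tau = ev e6c (qpar tau).
Proof. exact: eisenstein_ev. Qed.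

Lemma eval_combination (a b c d : nat -> C) (k : C) q : conv a -> conv b -> conv c ->
  cmod q < 1 -> (forall n, d n = k * (cauchy_prod a b n - c n)) ->
  ev d q = k * (ev a q * ev b q - ev c q).
Proof.
move=> ca cb cc q1 /funext ->.
have cab := conv_cauchy_prod ca cb; have cc' := convZ (-1) cc.
rewrite -ev_cauchy_prod// -[- ev c q]mulN1r -evZ// -evD// -evZ//; last exact: convD.
by apply: eq_ev => n; rewrite mulN1r.
Qed.

(** A comparison of [q]-coefficients: that of index [n] in [E2^2] contains [sconv 1 1 n]. The
    products [E2 * E4], [E2 * E6] and [E4^2] below use the other convolutions likewise. *)
Lemma cder_E2 tau : upper tau -> cder (@E2 R) tau (T * ((E2 tau ^+ 2 - E4 tau) / 12)).
Proof.
move=> t0; have q1 := upper_qpar t0.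
apply: (cder_upper t0 (fun x => @esym _ _ _ \o @E2_ev x)).
apply: cder_eq (cder_ev_qpar conv_e2 t0) _; congr (_ * _).
rewrite E2_ev// E4_ev// expr2 mulrC.
apply: eval_combination => // [| | |n]; [exact: conv_e2..|exact: conv_e4|].
case: n => [|n]; first by rewrite /theta mul0r /cauchy_prod big_ord_recl big_ord0 /=; ring.
rewrite cauchy_prod_eis /theta /e2c /e4c /eis_coef -/(sg C 1 n.+1) -/(sg C 3 n.+1).
have -> : sconv C 1 1 n.+1 = (5 * sg C 3 n.+1 + sg C 1 n.+1 - 6 * n.+1%:R * sg C 1 n.+1) / 12.
  by rewrite -sconv11//; field.
by field.
Qed.

Lemma cder_E4 tau : upper tau ->
  cder (@E4 R) tau (T * ((E2 tau * E4 tau - E6 tau) / 3)).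
Proof.
move=> t0; have q1 := upper_qpar t0.
apply: (cder_upper t0 (fun x => @esym _ _ _ \o @E4_ev x)).
apply: cder_eq (cder_ev_qpar conv_e4 t0) _; congr (_ * _).
rewrite E2_ev// E4_ev// E6_ev// mulrC.
apply: eval_combination => // [| | |n]; [exact: conv_e2|exact: conv_e4|exact: conv_e6|].
case: n => [|n]; first by rewrite /theta mul0r /cauchy_prod big_ord_recl big_ord0 /=; ring.
rewrite cauchy_prod_eis /theta /e4c /e6c /eis_coef -/(sg C 3 n.+1) -/(sg C 5 n.+1).
have -> : sconv C 1 3 n.+1 = (21 * sg C 5 n.+1 + 10 * sg C 3 n.+1 - 30 * n.+1%:R * sg C 3 n.+1 - sg C 1 n.+1) / 240.
  by rewrite -sconv13//; field.
by field.
Qed.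

Lemma cder_E6 tau : upper tau ->
  cder (@E6 R) tau (T * ((E2 tau * E6 tau - E4 tau ^+ 2) / 2)).
Proof.
move=> t0; have q1 := upper_qpar t0.
apply: (cder_upper t0 (fun x => @esym _ _ _ \o @E6_ev x)).
apply: cder_eq (cder_ev_qpar conv_e6 t0) _; congr (_ * _).
have c44 := conv_cauchy_prod conv_e4 conv_e4.
have -> : E4 tau ^+ 2 = ev (cauchy_prod e4c e4c) (qpar tau).
  by rewrite ev_cauchy_prod// ?E4_ev//; exact: conv_e4.
rewrite E2_ev// E6_ev// mulrC.
apply: eval_combination => // [| |n]; [exact: conv_e2|exact: conv_e6|].
case: n => [|n]; first by rewrite /theta mul0r /cauchy_prod !big_ord_recl !big_ord0 /=; ring.
rewrite !cauchy_prod_eis /theta /e6c /eis_coef -/(sg C 5 n.+1).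
have -> : sconv C 1 5 n.+1 = (20 * sg C 7 n.+1 + 21 * sg C 5 n.+1 - 42 * n.+1%:R * sg C 5 n.+1 + sg C 1 n.+1) / 504.
  by rewrite -sconv15//; field.
have -> : sconv C 3 3 n.+1 = (sg C 7 n.+1 - sg C 3 n.+1) / 120.
  by rewrite -sconv33//; field.
by field.
Qed.

End RamanujanODE.

(** * Transformation of [E_2], [E_4] and [E_6] under the modular group *)

Section ModularLaws.
Variable R : realType.
Local Notation C := (cplx R).
Implicit Types (tau : C) (a b c d : int).
Local Notation T := (twopii R).
Local Notation "z %:c" := (z%:~R : C) (at level 2, format "z %:c").

Lemma Im_int (n : int) : complex.Im (n%:c) = 0.
Proof. by rewrite -ofreal_int. Qed.

Lemma Re_int (n : int) : complex.Re (n%:c) = n%:~R.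
Proof. by rewrite -ofreal_int. Qed.

Lemma cden_neq0_int c d tau : upper tau -> (c != 0) || (d != 0) -> c%:c * tau + d%:c != 0.
Proof.
move=> t0 cd; apply/eqP => H; have := congr1 (@complex.Im R) H.
rewrite ImD ImM !Im_int mul0r !addr0 Re_int => /eqP.
have t1 : complex.Im tau != 0 by exact: upper_Im_neq0.
rewrite mulf_eq0 (negbTE t1) orbF intr_eq0 => /eqP c0.
move: H cd; rewrite c0 mul0r add0r => /eqP; rewrite intr_eq0 => /eqP ->.
by rewrite eqxx.
Qed.

Lemma det1_neq0 a b c d : a * d - b * c = 1 -> (c != 0) || (d != 0).
Proof.
by case: eqVneq => //= ->; case: eqVneq => //= ->; rewrite !mulr0 subr0.
Qed.

Lemma mobius_upper_int a b c d tau : a * d - b * c = 1 -> upper tau ->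
  upper ((a%:c * tau + b%:c) / (c%:c * tau + d%:c)).
Proof.
move=> det t0; have u0 := cden_neq0_int t0 (det1_neq0 det).
set u := _ + d%:c in u0 *.
rewrite /upper /=; set w := a%:c * tau + b%:c.
have -> : w / u = ofreal ((cmod u ^+ 2)^-1) * (w * conjc u).
  by rewrite ofrealV ofrealX -normCE [u^-1]invc_norm mulrCA.
rewrite ImM /= mul0r addr0 mulr_gt0 ?invr_gt0 ?exprn_gt0 ?cmod_gt0//.
have -> : complex.Im (w * conjc u) = (a * d - b * c)%:~R * complex.Im tau.
  rewrite /w /u -!ofreal_int intrB !intrM.
  case: tau t0 @u @w u0 => p r _ _ _ _ /=; ring.
by rewrite det mul1r.
Qed.

Lemma upper_S tau : upper tau -> upper (- tau^-1).
Proof.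
move=> t0; have := @mobius_upper_int 0 (-1) 1 0 tau.
have -> : (0%:c * tau + (-1)%:c) / (1%:c * tau + 0%:c) = - tau^-1.
  by rewrite mul0r add0r mul1r addr0 mulrNz mulN1r.
by apply.
Qed.

Lemma E2_periodic tau (n : int) : upper tau -> upper (tau + n%:c) /\ E2 (tau + n%:c) = E2 tau.
Proof.
move=> t0; have t1 : upper (tau + n%:c) by rewrite /upper /= ImD Im_int addr0.
by split; [exact: t1 | rewrite (E2_ev t1) (E2_ev t0) qparD qpar_int mulr1].
Qed.

(** Euclid's algorithm on the lower row: with [n = - (d div c)], the image of [tau] is the image of
    [- 1 / (tau - n)] under a matrix whose lower left entry is [d mod c]. For [c = 0] only
    translations remain. *)
Lemma E2_modular a b c d tau : a * d - b * c = 1 -> upper tau ->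
  E2 ((a%:c * tau + b%:c) / (c%:c * tau + d%:c)) =
  (c%:c * tau + d%:c) ^+ 2 * E2 tau + 12 / T * c%:c * (c%:c * tau + d%:c).
Proof.
have [m] := ubnP `|c|%N; elim: m a b c d tau => // m IH a b c d tau cm det t0.
have [c0|c0] := eqVneq c 0.
  move: det; rewrite c0 mulr0 subr0 => ad.
  have [[-> ->]|[-> ->]] : (a = 1 /\ d = 1) \/ (a = -1 /\ d = -1).
    have /eqP : (`|a| * `|d|)%N = 1%N by rewrite -abszM ad.
    by rewrite muln_eq1 => /andP[/eqP a1 /eqP d1]; lia.
  - by rewrite mul0r add0r divr1 mul1r expr1n mul1r mulr0 mul0r addr0; have [] := E2_periodic b t0.
  - rewrite mul0r add0r mulrNz !mulr0 mul0r addr0 sqrrN expr1n mul1r invrN invr1 mulrN1.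
    have -> : - (- 1%:c * tau + b%:c) = tau + (- b)%:c by rewrite mulrNz; ring.
    by have [] := E2_periodic (- b) t0.
pose n : int := - (d %/ c)%Z.
have c'E : n * c + d = (d %% c)%Z by rewrite /n {2}(divz_eq d c); ring.
have c'lt : (`|(n * c + d)%R| < m)%N.
  rewrite c'E; have := ltz_mod d c0; have := modz_ge0 d c0; lia.
have det' : (n * a + b) * (- c) - (- a) * (n * c + d) = 1 by rewrite -det; ring.
have t1 : upper (tau - n%:c) by have [] := E2_periodic (- n) t0; rewrite mulrNz.
have E2t1 : E2 (tau - n%:c) = E2 tau by have [] := E2_periodic (- n) t0; rewrite mulrNz.
set v := tau - n%:c in t1 E2t1; have v0 := upper_neq0 t1.
have s0 : upper (- v^-1).
  exact: upper_S.
have := IH _ _ _ _ (- v^-1) c'lt det' s0.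
have u0 := cden_neq0_int t0 (det1_neq0 det).
have lin (A B N : C) : tau = v + N -> (N * A + B) * - v^-1 + - A = - ((A * tau + B) / v).
  by move=> ->; field.
have tv : tau = v + n%:c by rewrite subrK.
have e1 : (n * a + b)%:c * - v^-1 + (- a)%:c = - ((a%:c * tau + b%:c) / v).
  by rewrite intrD intrM mulrNz (lin _ _ _ tv).
have e2 : (n * c + d)%:c * - v^-1 + (- c)%:c = - ((c%:c * tau + d%:c) / v).
  by rewrite intrD intrM mulrNz (lin _ _ _ tv).
rewrite e1 e2 invrN mulrNN invf_div mulrA (divfK v0) (E2_S t1) E2t1 => ->.
rewrite intrD intrM; have T0 := twopii_neq0 R.
have -> : n%:c * c%:c + d%:c = c%:c * tau + d%:c - c%:c * v by rewrite /v; ring.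
move: (E2 tau) (c%:c) (c%:c * tau + d%:c) => e k u.
by field; rewrite v0 T0.
Qed.

Lemma cder_mobius a b c d tau : a * d - b * c = 1 -> upper tau ->
  cder (fun x => (a%:c * x + b%:c) / (c%:c * x + d%:c)) tau ((c%:c * tau + d%:c) ^- 2).
Proof.
move=> det t0; have u0 := cden_neq0_int t0 (det1_neq0 det).
have lin (k l : int) : cder (fun x => k%:c * x + l%:c) tau (k%:c).
  apply: cder_eq (cderD (cderZ k%:c (cder_id tau)) (cder_cst l%:c tau)) _.
  by rewrite mulr1 addr0.
apply: cder_eq (cderM (lin a b) (cderV (f := fun x => c%:c * x + d%:c) u0 (lin c d))) _.
have -> : a%:c * (c%:c * tau + d%:c)^-1 + (a%:c * tau + b%:c) * (- c%:c * (c%:c * tau + d%:c)^-1 ^+ 2) =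
  (a * d - b * c)%:c * (c%:c * tau + d%:c) ^- 2 by rewrite intrB !intrM; field.
by rewrite det mul1r.
Qed.

Lemma cder_cden c d tau n :
  cder (fun x => (c%:c * x + d%:c) ^+ n) tau (n%:R * (c%:c * tau + d%:c) ^+ n.-1 * c%:c).
Proof.
apply: cderX; apply: cder_eq (cderD (cderZ c%:c (cder_id tau)) (cder_cst d%:c tau)) _.
by rewrite mulr1 addr0.
Qed.

(** By its differential equation, [E_4] is [E_2^2 - (12 / T) E_2']. The law of [E_2] is
    differentiated, and the anomalous terms of the square and of the derivative cancel. *)
Lemma E4_modular a b c d tau : a * d - b * c = 1 -> upper tau ->
  E4 ((a%:c * tau + b%:c) / (c%:c * tau + d%:c)) = (c%:c * tau + d%:c) ^+ 4 * E4 tau.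
Proof.
move=> det t0; have s0 := mobius_upper_int det t0.
have u0 := cden_neq0_int t0 (det1_neq0 det); have T0 := twopii_neq0 R.
have dl := cder_comp (cder_mobius det t0) (cder_E2 s0).
have dr := cderD (cderM (cder_cden c d tau 2) (cder_E2 t0)) (cderZ (12 / T * c%:c) (cder_cden c d tau 1)).
have {}dl := cder_upper t0 (fun x => @E2_modular a b c d x det) dl.
have := cder_unique dl dr.
rewrite E2_modular//= !expr0 !expr1; move: u0; move: (c%:c) (c%:c * tau + d%:c) => k u u0 H.
move: (E2 tau) (E4 tau) (E4 _) H => e f g H.
have -> : g = ((u ^+ 2 * e + 12 / T * k * u) ^+ 2
   - 12 / T * u ^+ 2 * (T * (((u ^+ 2 * e + 12 / T * k * u) ^+ 2 - g) / 12) * u ^- 2)).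
  by field; rewrite u0 T0.
by rewrite H; field; rewrite T0.
Qed.

Lemma E6_modular a b c d tau : a * d - b * c = 1 -> upper tau ->
  E6 ((a%:c * tau + b%:c) / (c%:c * tau + d%:c)) = (c%:c * tau + d%:c) ^+ 6 * E6 tau.
Proof.
move=> det t0; have s0 := mobius_upper_int det t0.
have u0 := cden_neq0_int t0 (det1_neq0 det); have T0 := twopii_neq0 R.
have dl := cder_comp (cder_mobius det t0) (cder_E4 s0).
have dr := cderM (cder_cden c d tau 4) (cder_E4 t0).
have {}dl := cder_upper t0 (fun x => @E4_modular a b c d x det) dl.
have := cder_unique dl dr.
rewrite E2_modular// E4_modular//=; move: u0; move: (c%:c) (c%:c * tau + d%:c) => k u u0 H.
move: (E2 tau) (E4 tau) (E6 tau) (E6 _) H => e f g h H.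
have -> : h = ((u ^+ 2 * e + 12 / T * k * u) * (u ^+ 4 * f)
   - 3 / T * u ^+ 2 * (T * (((u ^+ 2 * e + 12 / T * k * u) * (u ^+ 4 * f) - h) / 3) * u ^- 2)).
  by field; rewrite u0 T0.
by rewrite H; field; rewrite T0.
Qed.

End ModularLaws.

(** * The product [Delta] and the discriminant relation *)

Section Discriminant.
Variable R : realType.
Local Notation C := (cplx R).
Implicit Types (tau x q : C).
Local Notation T := (twopii R).

Definition log1m_coef (k : nat) : C := - (k%:R)^-1.

Lemma conv_log1m : conv log1m_coef.
Proof.
apply: (@conv_le _ _ 1 0) => -[|n]; rewrite /log1m_coef cmodN mul1r expr0.
  by rewrite invr0 cmod0.
by rewrite cmodV cmod_nat invf_le1 ?ltr0n// ler1n.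
Qed.

Lemma cexp_log1m x : cmod x < 1 -> cexp (ev log1m_coef x) = 1 - x.
Proof.
move=> x1; have cl := conv_log1m.
have H : (1 - 0) * cexp (- ev log1m_coef 0) = (1 - x) * cexp (- ev log1m_coef x).
  apply: (@cder0_const R (fun y : C => (1 - y) * cexp (- ev log1m_coef y)) (0 : C) x).
  move=> t /andP[t0 t1]; rewrite add0r subr0; set y := ofreal t * x.
  have y1 : cmod y < 1.
    rewrite cmodM cmod_ofreal ger0_norm//; apply: le_lt_trans x1.
    by rewrite ler_piMl ?cmod_ge0.
  apply: cder_eq (cderM (cderB (cder_cst 1 y) (cder_id y))
    (cder_comp (cderN (cder_ev cl y1)) (cder_cexp _))) _.
  have -> : ev (diffs log1m_coef) y = - (1 - y)^-1.
    rewrite -ev_geometric// -mulN1r -evZ//; last exact: conv_cst.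
    apply: eq_ev => n; rewrite /diffs /log1m_coef mulrN mulfV ?mulN1r ?pnatr_eq0//.
  by have := neq1_of_cmod_lt1 y1; move: (cexp _) => e y0; field.
move: H; rewrite subr0 mul1r ev_zero [log1m_coef 0](_ : _ = 0) ?oppr0 ?cexp0 => [H|]; last first.
  by rewrite /log1m_coef invr0 oppr0.
by apply: (mulIf (cexp_neq0 (- ev log1m_coef x))); rewrite cexpNr.
Qed.

Lemma ev_log1m x : cmod x < 1 ->
  ev log1m_coef x = sumC (fun k => log1m_coef k.+1 * x ^+ k.+1).
Proof.
move=> x1; have ct := conv_tail conv_log1m; rewrite ev_split//; last exact: conv_log1m.
rewrite [X in X + _](_ : _ = 0) ?add0r; last by rewrite /log1m_coef invr0 oppr0.
by rewrite -evZ//; apply: eq_sumC => k; rewrite exprS mulrCA mulrA.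
Qed.

(** The coefficients of the logarithm of [prod (1 - q^n)]: collecting the terms [- q^(n k) / k] with
    [n k = N] gives [- sigma_1(N) / N]. *)
Definition eta_log (n : nat) : C := - ((sigma_ 1 n)%:R / n%:R).

Lemma conv_eta_log : conv eta_log.
Proof.
apply: (@conv_le _ _ 1 1) => -[|n]; rewrite /eta_log cmodN mul1r expr1.
  by rewrite invr0 mulr0 cmod0.
rewrite cmod_div !cmod_nat ler_pdivrMr ?ltr0n// -natrM ler_nat.
have := sigma_le 1 n; rewrite expnS expn1; nia.
Qed.

(** This is why the logarithmic derivative of [Delta] is [T E_2]. *)
Lemma theta_eta_log n : e2c R n = (n == 0%N)%:R + 24 * theta eta_log n.
Proof.
case: n => [|n]; first by rewrite /theta mul0r mulr0 addr0.
rewrite /theta /eta_log /e2c /eis_coef add0r mulrN (mulrC n.+1%:R) divfK ?pnatr_eq0//.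
ring.
Qed.

Lemma eta_product q : cmod q < 1 ->
  cvgs (fun N => \prod_(1 <= n < N) (1 - q ^+ n)) (cexp (ev eta_log q)).
Proof.
move=> q1; have cl := conv_log1m.
have [a1 a2] := lambert cl q1.
have qn n : cmod (q ^+ n.+1) < 1 by rewrite cmodX exprn_ilt1 ?cmod_ge0.
have E : ev eta_log q = sumC (fun n => ev log1m_coef (q ^+ n.+1)).
  rewrite ev_split//; last exact: conv_eta_log.
  rewrite {1}/eta_log invr0 mulr0 oppr0 add0r -evZ//; last by apply: conv_tail; exact: conv_eta_log.
  transitivity (sumC (fun N => divsum log1m_coef N.+1 * q ^+ N.+1)).
    apply: eq_sumC => N; rewrite exprS -mulrA (mulrCA q); congr (_ * _).
    rewrite /divsum -(divisors_codivisor log1m_coef N) /eta_log /sigma_ natr_sum mulr_suml -sumrN.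
    rewrite big_seq [RHS]big_seq; apply: eq_bigr => d; rewrite -dvdn_divisors// => dn.
    have d0 := dvdn_gt0 (ltn0Sn N) dn.
    rewrite /log1m_coef expn1 -[in LHS](divnK dn) natrM.
    have n0 : (N.+1 %/ d)%:R != 0 :> C by rewrite pnatr_eq0 -lt0n divn_gt0// dvdn_leq.
    have dd0 : d%:R != 0 :> C by rewrite pnatr_eq0 -lt0n.
    by move: n0 dd0; move: (d%:R : C) ((N.+1 %/ d)%:R : C) => D M M0 D0; field; rewrite M0 D0.
  rewrite -a2; apply: eq_sumC => n.
  by rewrite (ev_log1m (qn n)); apply: eq_sumC => k; congr (_ * _); rewrite -exprM.
have aE : asum (fun n => ev log1m_coef (q ^+ n.+1)).
  rewrite (_ : (fun n => _) = fun n => sumC (fun k => log1m_coef k.+1 * q ^+ (n.+1 * k.+1)))//.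
  apply: funext => n.
  by rewrite (ev_log1m (qn n)); apply: eq_sumC => k; congr (_ * _); rewrite -exprM.
apply/cvgsS; rewrite E; have := cvgs_comp_cont (cder_cexp _) (asum_cvg aE).
rewrite (_ : (fun n => cexp _) = (fun N => \prod_(1 <= n < N.+1) (1 - q ^+ n)))//.
apply: funext => N; rewrite big_add1/=; elim: N => [|N IH]; first by rewrite !big_nil cexp0.
by rewrite !big_nat_recr//= cexpD IH cexp_log1m.
Qed.

Lemma Delta_ev tau : upper tau ->
  Delta tau = qpar tau * cexp (24 * ev eta_log (qpar tau)).
Proof.
move=> t0; rewrite /Delta /dedekind_eta.
have -> : limn (fun N => \prod_(1 <= n < N) (1 - qpar tau ^+ n)) = cexp (ev eta_log (qpar tau)).
  by apply: cvg_lim => //; apply/cvgCP; apply: eta_product; exact: upper_qpar.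
rewrite exprMn -!cexpMn; congr (_ * _); rewrite /qpar; congr cexp.
by field.
Qed.

Lemma Delta_neq0 tau : upper tau -> Delta tau != 0.
Proof. by move=> t0; rewrite Delta_ev// mulf_neq0 ?cexp_neq0. Qed.

Lemma cder_Delta tau : upper tau -> cder (@Delta R) tau (T * (E2 tau * Delta tau)).
Proof.
move=> t0; have q1 := upper_qpar t0; have ce := conv_eta_log.
have DE x : upper x -> qpar x * cexp (24 * ev eta_log (qpar x)) = Delta x by move=> /Delta_ev ->.
apply: (cder_upper t0 DE).
have dL := cderZ 24 (cder_ev_qpar ce t0).
apply: cder_eq (cderM (cder_qpar tau) (cder_comp dL (cder_cexp _))) _.
rewrite Delta_ev// E2_ev//.
have -> : ev (e2c R) (qpar tau) = 1 + 24 * ev (theta eta_log) (qpar tau).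
  have ct := conv_theta ce.
  have c1 : conv (fun n => (n == 0%N)%:R : C).
    by apply: (@conv_le _ _ 1 0) => n; rewrite cmod_nat mul1r expr0; case: (n == _); rewrite ?lexx.
  rewrite (eq_ev _ theta_eta_log) evD//; last exact: convZ.
  rewrite evZ//; congr (_ + _).
  rewrite (ev_fin (N := 1)) ?big_nat1 ?expr0 ?mulr1// => n n1.
  by case: n n1.
ring.
Qed.

Definition disc tau : C := E4 tau ^+ 3 - E6 tau ^+ 2.

Lemma cder_disc tau : upper tau -> cder disc tau (T * (E2 tau * disc tau)).
Proof.
move=> t0; apply: cder_eq (cderB (cderX 3 (cder_E4 t0)) (cderX 2 (cder_E6 t0))) _.
by rewrite /disc /=; field.
Qed.

Definition disc_coef : nat -> C := fun n =>
  cauchy_prod (e4c R) (cauchy_prod (e4c R) (e4c R)) n - cauchy_prod (e6c R) (e6c R) n.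

Lemma conv_disc : conv disc_coef.
Proof.
have c4 := @conv_e4 R; have c6 := @conv_e6 R.
have -> : disc_coef = (fun n => cauchy_prod (e4c R) (cauchy_prod (e4c R) (e4c R)) n
   + (-1) * cauchy_prod (e6c R) (e6c R) n) by apply: funext => n; rewrite /disc_coef mulN1r.
apply: convD; first by do 2!apply: conv_cauchy_prod => //.
by apply: convZ; exact: conv_cauchy_prod.
Qed.

Lemma disc_ev tau : upper tau -> disc tau = ev disc_coef (qpar tau).
Proof.
move=> t0; have q1 := upper_qpar t0.
have c4 := @conv_e4 R; have c6 := @conv_e6 R.
rewrite (eq_ev (b := fun n => cauchy_prod (e4c R) (cauchy_prod (e4c R) (e4c R)) n
   + (-1) * cauchy_prod (e6c R) (e6c R) n)) => [|n]; last by rewrite /disc_coef mulN1r.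
have c44 := conv_cauchy_prod c4 c4.
have c444 := conv_cauchy_prod c4 c44; have c66 := conv_cauchy_prod c6 c6.
rewrite evD// ?evZ// ?ev_cauchy_prod//; last exact: convZ.
by rewrite /disc E4_ev// E6_ev//; ring.
Qed.

Lemma sigma1 k : sigma_ k 1 = 1%N.
Proof. by rewrite /sigma_ (_ : divisors 1 = [:: 1%N])// big_seq1 exp1n. Qed.

Lemma disc_coef0 : disc_coef 0 = 0.
Proof. by rewrite /disc_coef /cauchy_prod !big_ord1 /= !mulr1 subrr. Qed.

Lemma disc_coef1 : disc_coef 1 = 1728.
Proof.
have cp1 (a b : nat -> C) : cauchy_prod a b 1 = a 0%N * b 1%N + a 1%N * b 0%N.
  by rewrite /cauchy_prod big_ord_recl big_ord1.
have cp0 (a b : nat -> C) : cauchy_prod a b 0 = a 0%N * b 0%N by rewrite /cauchy_prod big_ord1.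
rewrite /disc_coef !cp1 !cp0 /e4c /e6c /eis_coef !sigma1; ring.
Qed.

Lemma qpar_seq : exists u : nat -> C, (forall n, upper (u n)) /\ cvgs (fun n => qpar (u n)) 0.
Proof.
exists (fun n => Complex 0 n.+1%:R); split=> [n|e e0]; first by rewrite /upper /= ltr0n.
have [M HM] := nat_above (e^-1); exists M => n /HM h.
rewrite subr0 cmod_cexp Re_twopii /= -[e]invrK expRN ltf_pV2 ?posrE ?expR_gt0 ?invr_gt0//.
apply: lt_le_trans (expR_ge1Dx _).
have := pi_ge2 R; rewrite -natr1; have := ler0n R n; nra.
Qed.

Lemma upper_convex a b t : upper a -> upper b -> 0 <= t <= 1 -> upper (a + ofreal t * (b - a) : C).
Proof.
rewrite /upper /= => a0 b0 /andP[t0 t1].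
rewrite ImD ImM ImD ImN /= mul0r addr0; nra.
Qed.

Lemma discE tau : upper tau -> E4 tau ^+ 3 - E6 tau ^+ 2 = 1728 * Delta tau.
Proof.
move=> t0; rewrite -/(disc tau).
have const x y : upper x -> upper y -> disc x / Delta x = disc y / Delta y.
  move=> x0 y0; apply: (@cder0_const R (fun z => disc z / Delta z)) => t t01.
  have z0 := upper_convex x0 y0 t01; set z := _ + _ in z0 *.
  have D0 := Delta_neq0 z0.
  apply: cder_eq (cderM (cder_disc z0) (cderV D0 (cder_Delta z0))) _.
  by field.
have [u [u0 uq]] := qpar_seq.
suff : disc tau / Delta tau = 1728 by move=> <-; rewrite divfK// Delta_neq0.
have ct := conv_tail conv_disc; have ce := conv_eta_log.
(* The quotient as a function of [q], with the common factor [q] removed so that it can be evaluated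
   at the cusp [q = 0]. *)
pose h q := ev (fun n => disc_coef n.+1) q * cexp (- (24 * ev eta_log q)).
have hE x : upper x -> disc x / Delta x = h (qpar x).
  move=> x0; rewrite disc_ev// ev_split ?upper_qpar//; last exact: conv_disc.
  rewrite disc_coef0 add0r Delta_ev// /h cexpN.
  by have := qpar_neq0 x; have := cexp_neq0 (24 * ev eta_log (qpar x)); move=> a b; field; rewrite a b.
have h0 : h 0 = 1728 by rewrite /h !ev_zero disc_coef1 /eta_log invr0 !(oppr0, mulr0) cexp0 mulr1.
rewrite -h0; apply: (@cvgs_unique _ (fun n => h (qpar (u n)))).
  have hu n : h (qpar (u n)) = disc tau / Delta tau.
    by rewrite -(hE _ (u0 n)); apply: const; [exact: u0 | exact: t0].
  by rewrite (funext hu); exact: cvgs_cst.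
have z1 : cmod (0 : C) < 1 by rewrite cmod0 ltr01.
apply: (cvgs_comp_cont (f := h)) uq.
exact: cderM (cder_ev ct z1) (cder_comp (cderN (cderZ 24 (cder_ev ce z1))) (cder_cexp _)).
Qed.

End Discriminant.

(** * Expansions [q^s] times a power series *)

Section LaurentExpansions.
Variable R : realType.
Local Notation C := (cplx R).
Implicit Types (a b c l : nat -> C) (s tau q : C) (F G : C -> C).
Local Notation T := (twopii R).

Lemma conv_bounded a :
  (forall t : R, 0 < t < 1 -> exists K : R, forall n, cmod (a n) * t ^+ n <= K) -> conv a.
Proof.
move=> H r /andP[r0 r1]; pose t := (r + 1) / 2.
have t0 : 0 < t by rewrite /t; lra.
have t1 : t < 1 by rewrite /t; lra.
have rt : 0 <= r / t < 1.
  by rewrite divr_ge0 ?(ltW t0)//= ltr_pdivrMr// mul1r /t; lra.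
have [|K HK] := H t; first by rewrite t0 t1.
exists (K * (1 - r / t)^-1) => N.
apply: le_trans (_ : \sum_(0 <= n < N) K * (r / t) ^+ n <= _); last first.
  rewrite -mulr_sumr ler_wpM2l ?geometric_bound//.
  by apply: le_trans (HK 0%N); rewrite mulr_ge0 ?cmod_ge0 ?exprn_ge0 ?(ltW t0).
apply: ler_sum => n _; have := ler_wpM2r (exprn_ge0 n (proj1 (andP rt))) (HK n).
by rewrite -mulrA -exprMn [t * _]mulrC divfK ?gt_eqF.
Qed.

(** The coefficients [c] of the exponential of the series [l], by the recursion [(n + 1) c_(n+1) =
    sum_k (k + 1) l_(k+1) c_(n-k)] read off from [c' = l' c]. The whole list is returned because
    each coefficient needs all earlier ones. *)
Fixpoint expcoefs l n : seq C :=
  if n is m.+1 then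
    rcons (expcoefs l m)
      (m.+1%:R^-1 * \sum_(k < m.+1) diffs l k * nth 0 (expcoefs l m) (m - k)%N)
  else [:: cexp (l 0%N)].

Definition expcoef l n : C := nth 0 (expcoefs l n) n.

Lemma size_expcoefs l n : size (expcoefs l n) = n.+1.
Proof. by elim: n => //= n IH; rewrite size_rcons IH. Qed.

Lemma nth_expcoefs l m n : (n <= m)%N -> nth 0 (expcoefs l m) n = expcoef l n.
Proof.
elim: m => [|m IH]; first by rewrite leqn0 => /eqP ->.
rewrite leq_eqVlt => /predU1P[->//|]; rewrite ltnS => nm /=.
by rewrite nth_rcons size_expcoefs ltnS nm IH.
Qed.

Lemma diffs_expcoef l n : diffs (expcoef l) n = cauchy_prod (diffs l) (expcoef l) n.
Proof.
rewrite /diffs {1}/expcoef /= nth_rcons size_expcoefs ltnn eqxx mulrA mulfV ?pnatr_eq0// mul1r.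
by apply: eq_bigr => k _; rewrite nth_expcoefs// leq_subr.
Qed.

(** The recursion bounds [(n + 1) |c_(n+1)| t^(n+1)] by [A' K] as soon as [K] bounds the earlier
    [|c_m| t^m]. Beyond [A'] the factor [n + 1] absorbs [A'], so a [K] covering the first [M + 1]
    terms bounds them all. *)
Lemma conv_expcoef l : conv l -> conv (expcoef l).
Proof.
move=> cl; apply: conv_bounded => t /andP[t0 t1]; pose s := (t + 1) / 2.
have s0 : 0 < s by rewrite /s; lra.
have ts : 0 <= t / s < 1.
  by rewrite divr_ge0 ?(ltW s0) ?(ltW t0)//= ltr_pdivrMr// mul1r /s; lra.
have s01 : 0 <= s < 1 by rewrite (ltW s0)/= /s; lra.
have [A A0 HA] := conv_coef_bound (conv_diffs cl) s01.
pose A' := A * (1 - t / s)^-1.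
have [M HM] := nat_above A'.
pose K := \sum_(0 <= m < M.+1) cmod (expcoef l m) * t ^+ m.
have term0 m : 0 <= cmod (expcoef l m) * t ^+ m by rewrite mulr_ge0 ?cmod_ge0 ?exprn_ge0 ?(ltW t0).
have K0 : 0 <= K by apply: sumr_ge0 => m _.
exists K; elim/ltn_ind => n IH; have [nM|Mn] := leqP n M.
  have nin : n \in index_iota 0 M.+1 by rewrite mem_index_iota.
  rewrite /K (bigD1_seq n nin (iota_uniq _ _))/= lerDl.
  by apply: sumr_ge0 => m _.
case: n Mn IH => // n Mn IH.
have n0 : 0 < n.+1%:R :> R by rewrite ltr0n.
rewrite -(ler_pM2l n0) mulrA -[n.+1%:R in leLHS](cmod_nat R) -cmodM -/(diffs _ n) diffs_expcoef.
apply: le_trans (_ : A' * K <= _); last first.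
  by apply: ler_wpM2r => //; exact: HM _ (ltnW Mn).
have step : cmod (cauchy_prod (diffs l) (expcoef l) n) * t ^+ n.+1 <=
    \sum_(k < n.+1) A * (t / s) ^+ k * K.
  apply: le_trans (ler_wpM2r (exprn_ge0 _ (ltW t0)) (cmod_sum _ _ _)) _.
  rewrite mulr_suml; apply: ler_sum => k _; rewrite cmodM.
  have kn : (k <= n)%N by rewrite -ltnS.
  have -> : t ^+ n.+1 = t * (t ^+ k * t ^+ (n - k)) by rewrite -exprD subnKC// exprS.
  have IHk : cmod (expcoef l (n - k)) * t ^+ (n - k) <= K by apply: IH; rewrite ltnS leq_subr.
  have HAk : cmod (diffs l k) * t ^+ k <= A * (t / s) ^+ k.
    rewrite expr_div_n mulrA ler_pdivlMr ?exprn_gt0// mulrAC.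
    by rewrite ler_wpM2r ?exprn_ge0// ltW.
  have a0 : 0 <= cmod (diffs l k) * t ^+ k by rewrite mulr_ge0 ?cmod_ge0 ?exprn_ge0// ltW.
  apply: le_trans (ler_pM a0 (term0 _) HAk IHk).
  rewrite [leLHS](_ : _ = t * (cmod (diffs l k) * t ^+ k * (cmod (expcoef l (n - k)) * t ^+ (n - k)))); last by ring.
  exact: ler_piMl (mulr_ge0 a0 (term0 _)) (ltW t1).
apply: le_trans step _; rewrite -mulr_suml ler_wpM2r// -mulr_sumr /A' ler_wpM2l//.
by rewrite -(big_mkord xpredT (fun k => (t / s) ^+ k)) geometric_bound.
Qed.

Lemma cexp_ev l q : conv l -> cmod q < 1 -> cexp (ev l q) = ev (expcoef l) q.
Proof.
move=> cl q1; have cc := conv_expcoef cl.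
have H : ev (expcoef l) 0 * cexp (- ev l 0) = ev (expcoef l) q * cexp (- ev l q).
  apply: (@cder0_const R (fun y : C => ev (expcoef l) y * cexp (- ev l y)) (0 : C) q).
  move=> t /andP[t0 t1]; rewrite add0r subr0; set y := ofreal t * q.
  have y1 : cmod y < 1.
    rewrite cmodM cmod_ofreal ger0_norm//; apply: le_lt_trans q1.
    by rewrite ler_piMl ?cmod_ge0.
  apply: cder_eq (cderM (cder_ev cc y1) (cder_comp (cderN (cder_ev cl y1)) (cder_cexp _))) _.
  rewrite (eq_ev _ (diffs_expcoef l)) (ev_cauchy_prod (conv_diffs cl) cc y1).
  ring.
apply: (mulIf (cexp_neq0 (- ev l q))); rewrite -H cexpNr !ev_zero /expcoef /=.
by rewrite cexpNr.
Qed.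

(* [s] is an arbitrary complex exponent, so that it also absorbs the order of a pole. *)
Definition lexp s a F := conv a /\
  forall tau, upper tau -> F tau = cexp (T * tau * s) * ev a (qpar tau).

Lemma lexp_eq s a F G : (forall tau, upper tau -> F tau = G tau) -> lexp s a F -> lexp s a G.
Proof. by move=> FG [ca HF]; split=> // tau t0; rewrite -FG// HF. Qed.

Lemma lexp_eqs s s' a b F : s = s' -> a =1 b -> lexp s a F -> lexp s' b F.
Proof. by move=> <- /funext <-. Qed.

Lemma lexp_ev0 a F : conv a -> (forall tau, upper tau -> F tau = ev a (qpar tau)) -> lexp 0 a F.
Proof. by move=> ca HF; split=> // tau t0; rewrite HF// mulr0 cexp0 mul1r. Qed.

Lemma lexpD s a b F G : lexp s a F -> lexp s b G ->
  lexp s (fun n => a n + b n) (fun tau => F tau + G tau).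
Proof.
move=> [ca HF] [cb HG]; split=> [|tau t0]; first exact: convD.
by rewrite HF// HG// (evD ca cb (upper_qpar t0)) mulrDr.
Qed.

Lemma lexpZ s a k F : lexp s a F -> lexp s (fun n => k * a n) (fun tau => k * F tau).
Proof.
move=> [ca HF]; split=> [|tau t0]; first exact: convZ.
by rewrite HF// (evZ _ ca (upper_qpar t0)) mulrCA.
Qed.

Lemma lexp0 s : lexp s (fun=> 0) (fun=> 0).
Proof.
split=> [|tau t0]; first exact: conv0.
by rewrite (@ev_fin _ _ 0) ?big_geq ?mulr0.
Qed.

Lemma lexp_sum (I : Type) (r : seq I) s (a : I -> nat -> C) (F : I -> C -> C) :
  (forall i, lexp s (a i) (F i)) ->
  lexp s (fun n => \sum_(i <- r) a i n) (fun tau => \sum_(i <- r) F i tau).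
Proof.
move=> H; elim: r => [|i r IH].
  by apply: lexp_eqs (lexp_eq _ (lexp0 s)) => // [n|tau _]; rewrite big_nil.
apply: lexp_eqs (lexp_eq _ (lexpD (H i) IH)) => // [n|tau _]; rewrite big_cons//.
Qed.

Lemma lexpM s s' a b F G : lexp s a F -> lexp s' b G ->
  lexp (s + s') (cauchy_prod a b) (fun tau => F tau * G tau).
Proof.
move=> [ca HF] [cb HG]; split=> [|tau t0]; first exact: conv_cauchy_prod.
rewrite HF// HG// (ev_cauchy_prod ca cb (upper_qpar t0)) mulrDr cexpD.
by rewrite mulrACA.
Qed.

Definition shiftn k a n : C := if (k <= n)%N then a (n - k)%N else 0.

Lemma lexp_shift s k a F : lexp s a F -> lexp (s - k%:R) (shiftn k a) F.
Proof.
elim: k s a => [|k IH] s a HF.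
  apply: lexp_eqs HF; first by rewrite subr0.
  by move=> n; rewrite /shiftn subn0.
have [ca {}HF] := HF; have := IH (s - 1) (fun n => if n is m.+1 then a m else 0).
have -> : s - 1 - k%:R = s - k.+1%:R by rewrite -[k.+1%:R]natr1; ring.
move=> H; apply: lexp_eqs (H _) => //.
  move=> n; rewrite /shiftn; case: (ltngtP k n) => [kn|//|->]; last by rewrite subnn.
  by rewrite -[(n - k)%N]prednK ?subn_gt0// subnS.
split=> [|tau t0]; first exact: conv_cons.
rewrite HF// (ev_cons _ ca (upper_qpar t0)) add0r mulrBr cexpB mulr1 -/(qpar tau).
by rewrite mulrA divfK// qpar_neq0.
Qed.

Lemma cder_lexp s a F tau : lexp s a F -> upper tau ->
  cder F tau (T * (cexp (T * tau * s) * ev (fun n => (s + n%:R) * a n) (qpar tau))).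
Proof.
move=> [ca HF] t0; have q1 := upper_qpar t0.
apply: (cder_upper t0 (fun x x0 => esym (HF x x0))).
have dl : cder (fun x => T * x * s) tau (T * s).
  apply: (@cder_local _ (fun x => T * s * x) _ _ _ 1) => //; first by move=> x _; rewrite mulrAC.
  by apply: cder_eq (cderZ (T * s) (cder_id tau)) _; rewrite mulr1.
apply: cder_eq (cderM (cder_comp dl (cder_cexp _)) (cder_ev_qpar ca t0)) _.
have -> : ev (fun n => (s + n%:R) * a n) (qpar tau) = s * ev a (qpar tau) + ev (theta a) (qpar tau).
  rewrite -evZ// -evD//; [|exact: convZ|exact: conv_theta].
  by apply: eq_ev => n; rewrite mulrDl.
ring.
Qed.

Lemma conv_lexp_derive s a : conv a -> conv (fun n => (s + n%:R) * a n).
Proof.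
move=> ca; have -> : (fun n => (s + n%:R) * a n) = (fun n => s * a n + theta a n).
  by apply: funext => n; rewrite mulrDl.
by apply: convD; [exact: convZ | exact: conv_theta].
Qed.

Lemma lexp_derive s a F : lexp s a F ->
  lexp s (fun n => (s + n%:R) * a n) (fun tau => T^-1 * derive1 F tau).
Proof.
move=> HF; split=> [|tau t0]; first by apply: conv_lexp_derive; case: HF.
by rewrite (cder_derive1 (cder_lexp HF t0)) mulKf// twopii_neq0.
Qed.

Lemma lexp_coef0 s a F : lexp s a F -> (forall tau, upper tau -> F tau = 0) -> forall n, a n = 0.
Proof.
move=> [ca HF] F0; have [u [u0 uq]] := qpar_seq R.
apply: (ev_eq0 ca uq) => n; split; first exact: qpar_neq0.
split; first exact: upper_qpar.
have := HF _ (u0 n); rewrite (F0 _ (u0 n)) => /esym/eqP.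
by rewrite mulf_eq0 (negbTE (cexp_neq0 _)) => /eqP.
Qed.

Lemma lexp_unique s a b F : lexp s a F -> lexp s b F -> a =1 b.
Proof.
move=> HF HG n; apply/eqP; rewrite -subr_eq0; apply/eqP.
have := lexpD HF (lexpZ (-1) HG) => H.
have := lexp_coef0 H; rewrite /= => H'; rewrite -(H' _ n) ?mulN1r// => tau _.
by rewrite mulN1r subrr.
Qed.

(** Division, up to order [K], by a series with nonzero constant term. *)
Lemma cauchy_prod_eq0 a b K : a 0%N != 0 ->
  (forall n, (n < K)%N -> cauchy_prod a b n = 0) -> forall n, (n < K)%N -> b n = 0.
Proof.
move=> a0 H; elim/ltn_ind => n IH nK; have := H n nK.
rewrite /cauchy_prod big_ord_recl subn0 big1 ?addr0 => [/eqP|i _]; last first.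
  rewrite IH ?mulr0//= /bump /=; first by rewrite subnS; have := ltn_ord i; lia.
  by apply: leq_ltn_trans nK; rewrite leq_subr.
by rewrite mulf_eq0 (negbTE a0) => /eqP.
Qed.

Lemma cauchy_prod0 a b : cauchy_prod a b 0 = a 0%N * b 0%N.
Proof. by rewrite /cauchy_prod big_ord1. Qed.

Lemma cauchy_prod1 a b : cauchy_prod a b 1 = a 0%N * b 1%N + a 1%N * b 0%N.
Proof. by rewrite /cauchy_prod big_ord_recl big_ord1. Qed.

Definition invDelta_coef := expcoef (fun n => - (24%:R * eta_log R n)).

Lemma lexp_invDelta : lexp (-1) invDelta_coef (fun tau => (Delta tau)^-1).
Proof.
have cl : conv (fun n => - (24 * eta_log R n)).
  have -> : (fun n => - (24 * eta_log R n)) = (fun n => (- 24) * eta_log R n).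
    by apply: funext => n; rewrite mulNr.
  by apply: convZ; exact: conv_eta_log.
split=> [|tau t0]; first exact: conv_expcoef.
rewrite (Delta_ev t0) invfM -(cexp_ev cl (upper_qpar t0)) mulrN1.
congr (_ * _); rewrite -cexpN; congr cexp.
rewrite -mulNr -evZ ?upper_qpar//; last exact: conv_eta_log.
by apply: eq_ev => n; rewrite mulNr.
Qed.

Lemma invDelta_coef0 : invDelta_coef 0 = 1.
Proof. by rewrite /invDelta_coef /expcoef /= /eta_log invr0 !mulr0 !oppr0 mulr0 oppr0 cexp0. Qed.

Lemma invDelta_coef1 : invDelta_coef 1 = 24.
Proof.
have := diffs_expcoef (fun n => - (24%:R * eta_log R n)) 0.
rewrite cauchy_prod0 /diffs !mul1r -/invDelta_coef invDelta_coef0 mulr1 => ->.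
by rewrite /eta_log sigma1 divr1 mulrN1 opprK.
Qed.

Definition kleinJ_coef := cauchy_prod (cauchy_prod (e4c R) (cauchy_prod (e4c R) (e4c R))) invDelta_coef.

Lemma lexp_E4 : lexp 0 (e4c R) (@E4 R).
Proof. by apply: lexp_ev0; [exact: conv_e4 | exact: E4_ev]. Qed.

Lemma lexp_E6 : lexp 0 (e6c R) (@E6 R).
Proof. by apply: lexp_ev0; [exact: conv_e6 | exact: E6_ev]. Qed.

Lemma lexp_E2 : lexp 0 (e2c R) (@E2 R).
Proof. by apply: lexp_ev0; [exact: conv_e2 | exact: E2_ev]. Qed.

Lemma lexp_kleinJ : lexp (-1) kleinJ_coef (@kleinJ R).
Proof.
have := lexpM (lexpM lexp_E4 (lexpM lexp_E4 lexp_E4)) lexp_invDelta.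
by rewrite !add0r; apply: lexp_eq => tau _; rewrite /kleinJ !exprS expr0 mulr1.
Qed.

Lemma kleinJ_coef0 : kleinJ_coef 0 = 1.
Proof. by rewrite /kleinJ_coef !cauchy_prod0 invDelta_coef0 /e4c /eis_coef /=; ring. Qed.

Lemma kleinJ_coef1 : kleinJ_coef 1 = 744.
Proof.
rewrite /kleinJ_coef !cauchy_prod1 !cauchy_prod0 invDelta_coef0 invDelta_coef1.
rewrite /e4c /eis_coef !sigma1; ring.
Qed.

(** [J^n] starts with [q^-n]. The order [n] may exceed the degree, the leading coefficient then
    being 0, so that polynomials of different degrees share one pole order. *)
Lemma lexp_kleinJ_poly (p : {poly C}) n : (size p <= n.+1)%N ->
  exists2 a, lexp (- n%:R) a (fun tau => p.[kleinJ tau]) & a 0%N = p`_n.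
Proof.
elim/poly_ind: p n => [|p c IH] n; first by move=> _; exists (fun=> 0); 
  [apply: lexp_eq (lexp0 _) => tau _; rewrite horner0 | rewrite coef0].
have cst k : lexp (- k%:R) (shiftn k (fun m => if m is _.+1 then 0 else c)) (fun=> c).
  rewrite -[- _]add0r; apply: lexp_shift; apply: lexp_ev0; first by apply: conv_cons; exact: conv0.
  move=> tau _; rewrite (@ev_fin _ _ 1) ?big_nat1 ?expr0 ?mulr1// => -[|m]//.
case: n => [|n] sp.
  exists (shiftn 0 (fun m => if m is _.+1 then 0 else c)).
    apply: lexp_eq (cst 0%N) => tau _.
    have p0 : p = 0.
      apply/eqP; apply: contraTT sp => p0.
      rewrite size_MXaddC (negbTE p0)/= -ltnNge ltnS size_poly_gt0//.
    by rewrite p0 mul0r add0r hornerC.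
  by rewrite coefD coefMX coefC /= add0r.
have sp' : (size p <= n.+1)%N.
  by move: sp; rewrite size_MXaddC; case: ifP => [/andP[/eqP -> _]|_//]; rewrite size_poly0.
have [a Ha a0] := IH n sp'.
exists (fun m => cauchy_prod a kleinJ_coef m + shiftn n.+1 (fun m => if m is _.+1 then 0 else c) m).
  have := lexpD (lexp_eqs (esym _) (frefl _) (lexpM Ha lexp_kleinJ)) (cst n.+1).
  rewrite -natr1 opprD => /(_ erefl); apply: lexp_eq => tau _.
  by rewrite hornerD hornerM hornerX hornerC.
by rewrite cauchy_prod0 kleinJ_coef0 mulr1 a0 /shiftn addr0 coefD coefMX coefC addr0.
Qed.

End LaurentExpansions.

(** * Derivatives of inverse functions, logarithm and complex powers *)

Section ComplexPowers.
Variable R : realType.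
Local Notation C := (cplx R).
Implicit Types (f g : C -> C) (z w tau : C).

Definition ccont g z := forall e : R, 0 < e -> exists2 d : R, 0 < d &
  forall x, cmod (x - z) < d -> cmod (g x - g z) < e.

(** A right inverse needs to be merely continuous. This serves the logarithm and, later, the
    branches of the inverse of [J]. *)
Lemma cder_inverse f g z l (r : R) : 0 < r -> (forall x, cmod (x - z) < r -> f (g x) = x) ->
  ccont g z -> cder f (g z) l -> l != 0 -> cder g z l^-1.
Proof.
move=> r0 fg cg df l0 e e0; have L0 : 0 < cmod l by rewrite cmod_gt0.
set L := cmod l in L0; pose e' := Num.min (L / 2) (e * L ^+ 2 / 2).
have e'0 : 0 < e' by rewrite lt_min !divr_gt0 ?mulr_gt0 ?exprn_gt0.
have [d d0 Hd] := df _ e'0; have [d' d'0 Hd'] := cg _ d0.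
exists (Num.min r d') => [|h]; first by rewrite lt_min r0 d'0.
rewrite lt_min => /andP[hr hd]; have hz : z + h - z = h by rewrite addrC addKr.
set k := g (z + h) - g z.
have {}Hd : cmod (h - l * k) <= e' * cmod k.
  have gk : g z + k = g (z + h) by rewrite /k addrC subrK.
  have := Hd k; rewrite gk (fg z) ?subrr ?cmod0// (fg (z + h)) ?hz//; apply.
  by apply: Hd'; rewrite hz.
have [e1 e2] : e' <= L / 2 /\ e' <= e * L ^+ 2 / 2 by rewrite !ge_min !lexx ?orbT.
have k0 := cmod_ge0 k; have h0 := cmod_ge0 h.
have kh : L * cmod k <= 2 * cmod h.
  have := cmodB_ge (l * k) h; rewrite cmodC cmodM -/L => H1.
  have := ler_wpM2r k0 e1 => H2; lra.
have -> : k - l^-1 * h = - l^-1 * (h - l * k) by field.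
rewrite cmodM cmodN cmodV -/L mulrC ler_pdivrMr//.
apply: le_trans Hd _.
have H3 : e' * cmod k * L <= e * L ^+ 2 * cmod h.
  have H4 := ler_wpM2l (ltW e'0) kh; have H5 := ler_wpM2r h0 e2.
  by rewrite -mulrA [cmod k * L]mulrC; lra.
rewrite -(ler_pM2r L0); apply: le_trans H3 _.
by rewrite [leRHS](_ : _ = e * L ^+ 2 * cmod h)//; ring.
Qed.

Lemma real_ccont (f : R -> R) (x : R) : {for x, continuous f} -> forall e : R, 0 < e ->
  exists2 d : R, 0 < d & forall y, `|y - x| < d -> `|f y - f x| < e.
Proof.
move=> cf e e0; have /cvgrPdist_lt/(_ _ e0)/nbhs_ballP[d /= d0 Hd] := cf.
exists d => // y yx; rewrite distrC; apply: (Hd y).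
by rewrite /ball /= distrC.
Qed.

Definition Log z : C := ofreal (ln (cmod z)) + iunit R * ofreal (Arg z).

Lemma ReIm_Log z : complex.Re (Log z) = ln (cmod z) /\ complex.Im (Log z) = Arg z.
Proof. by rewrite /Log ReD ImD ReM ImM /=; split; ring. Qed.

Lemma cos_arg_range z : complex.Im z != 0 -> -1 < complex.Re z / cmod z < 1.
Proof.
move=> z0; have c0 : 0 < cmod z.
  by rewrite cmod_gt0; apply: contra_neq z0 => ->.
rewrite ltr_pdivlMr// ltr_pdivrMr// mulN1r mul1r -ltr_norml.
rewrite -ltr_sqr ?nnegrE ?normr_ge0 ?ltW// real_normK ?num_real// sqr_cmod.
by rewrite ltrDl lt_neqAle sqr_ge0 eq_sym sqrf_eq0 z0.
Qed.

Lemma cexp_Log z : complex.Im z != 0 -> cexp (Log z) = z.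
Proof.
move=> z0; have zz : z != 0 by apply: contra_neq z0 => ->.
have c0 : 0 < cmod z by rewrite cmod_gt0.
have /andP[r1 r2] := cos_arg_range z0.
have r12 : -1 <= complex.Re z / cmod z <= 1 by rewrite !ltW.
have [/andP[a0 a1] ca] := acos_def r12.
have [re im] := ReIm_Log z; rewrite cexpE re im lnK ?posrE//.
have cA : cos (Arg z) = complex.Re z / cmod z.
  by rewrite /Arg; case: ifP => _; rewrite ?cosN ca.
have sa : sin (acos (complex.Re z / cmod z)) = `|complex.Im z| / cmod z.
  transitivity (Num.sqrt ((`|complex.Im z| / cmod z) ^+ 2)); last first.
    by rewrite sqrtr_sqr ger0_norm ?divr_ge0 ?cmod_ge0.
  rewrite (sin_acos r12); congr Num.sqrt; rewrite !expr_div_n real_normK ?num_real//.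
  have c2 : cmod z ^+ 2 != 0 by rewrite expf_neq0// gt_eqF.
  by apply: (mulIf c2); rewrite mulrBl mul1r !divfK// {1}sqr_cmod addrC addKr.
have sA : sin (Arg z) = complex.Im z / cmod z.
  rewrite /Arg (negbTE z0) andFb orbF; case: ltP => im0.
    by rewrite sa gtr0_norm.
  by rewrite sinN sa ler0_norm// mulNr opprK.
by apply: complex_eq; rewrite ?ReM ?ImM /= ?cA ?sA; field; rewrite gt_eqF.
Qed.

(** Within distance [|Im z|] the imaginary part keeps its sign, so [Arg] stays on the same branch of
    plus or minus [acos]. *)
Lemma Log_ccont z : complex.Im z != 0 -> ccont Log z.
Proof.
move=> z0 e e0; have zz : z != 0 by apply: contra_neq z0 => ->.
have c0 : 0 < cmod z by rewrite cmod_gt0.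
have i0 : 0 < `|complex.Im z| by rewrite normr_gt0.
have e2 : 0 < e / 2 by rewrite divr_gt0.
have [d1 d10 H1] := real_ccont (continuous_ln c0) e2.
have [d2 d20 H2] := real_ccont (continuous_acos (cos_arg_range z0)) e2.
exists (Num.min (Num.min d1 (d2 * cmod z / 2)) `|complex.Im z|) => [|x].
  by rewrite !lt_min d10 i0 !mulr_gt0 ?invr_gt0.
rewrite !lt_min -andbA => /and3P[x1 x2 x3].
have xim : `|complex.Im x - complex.Im z| < `|complex.Im z|.
  by apply: le_lt_trans x3; rewrite -ImN -ImD; exact: cmod_Im.
have xz0 : complex.Im x != 0.
  by apply/eqP => x0; move: xim; rewrite x0 sub0r normrN ltxx.
have sg : (0 < complex.Im x) = (0 < complex.Im z).
  by move: xim z0; case: (ltrgt0P (complex.Im z)) => // i1; rewrite ltr_norml => /andP[]; lra.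
have cx : 0 < cmod x by rewrite cmod_gt0; apply: contra_neq xz0 => ->.
have L1 : `|ln (cmod x) - ln (cmod z)| < e / 2.
  apply: H1; apply: le_lt_trans x1; rewrite ler_norml cmodB_ge andbT.
  by rewrite lerNl opprB cmodC cmodB_ge.
have L2 : `|Arg x - Arg z| < e / 2.
  have -> : `|Arg x - Arg z| = `|acos (complex.Re x / cmod x) - acos (complex.Re z / cmod z)|.
    rewrite /Arg (negbTE xz0) (negbTE z0) !andFb !orbF sg; case: ifP => // _.
    by rewrite -opprD normrN.
  apply: H2.
  have -> : complex.Re x / cmod x - complex.Re z / cmod z =
    (complex.Re (x - z) + complex.Re x / cmod x * (cmod z - cmod x)) / cmod z.
    by rewrite ReD ReN; field; rewrite !gt_eqF.
  rewrite normrM normfV (gtr0_norm c0) ltr_pdivrMr//.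
  apply: le_lt_trans (ler_normD _ _) _; rewrite normrM.
  have R1 := cmod_Re (x - z).
  have /andP[r1 r2] := cos_arg_range xz0.
  have R2 : `|complex.Re x / cmod x| <= 1 by rewrite ler_norml !ltW.
  have R3 : `|cmod z - cmod x| <= cmod (x - z).
    by rewrite ler_norml lerNl opprB cmodB_ge/= cmodC cmodB_ge.
  have R4 : `|complex.Re x / cmod x| * `|cmod z - cmod x| <= cmod (x - z).
    by apply: le_trans R3; rewrite ler_piMl.
  lra.
apply: le_lt_trans (cmod_le_ReIm _) _.
have [re im] := ReIm_Log x; have [rez imz] := ReIm_Log z.
by rewrite ReD ImD ReN ImN re im rez imz; lra.
Qed.

Lemma cder_cpow w z : complex.Im z != 0 -> cder (fun x => cpow x w) z (w / z * cpow z w).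
Proof.
move=> z0; have zz : z != 0 by apply: contra_neq z0 => ->.
have i0 : 0 < `|complex.Im z| by rewrite normr_gt0.
have dL : cder Log z z^-1.
  apply: (cder_inverse i0 _ (Log_ccont z0) _ zz).
    move=> x xz; apply: cexp_Log; apply/eqP => x0; move: xz; apply/negP; rewrite -leNgt.
    by apply: le_trans (cmod_Im _); rewrite ImD ImN x0 sub0r normrN.
  by apply: cder_eq (cder_cexp _) (cexp_Log z0).
apply: cder_eq (cder_comp (cderZ w dL) (cder_cexp _)) _.
by rewrite mulrC.
Qed.

(** The cut of [Arg] is never crossed: [c tau + d] is real only for [c = 0], and then it is
    constant. *)
Lemma cder_cpow_linear (c d : int) w tau : upper tau -> (c != 0) || (d != 0) ->
  cder (fun x => cpow (c%:~R * x + d%:~R) w) tau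
    (w * c%:~R / (c%:~R * tau + d%:~R) * cpow (c%:~R * tau + d%:~R) w).
Proof.
move=> t0 cd; have [->|c0] := eqVneq c 0.
  rewrite mulr0 !mul0r; apply: (@cder_local _ (fun=> cpow d%:~R w) _ _ _ 1) => //.
    by move=> x _; rewrite mul0r add0r.
  exact: cder_cst.
have im : complex.Im (c%:~R * tau + d%:~R : C) != 0.
  rewrite ImD ImM !Im_int Re_int mul0r !addr0 mulf_neq0 ?intr_eq0//.
  exact: upper_Im_neq0.
have dl : cder (fun x : C => c%:~R * x + d%:~R) tau c%:~R.
  by apply: cder_eq (cderD (cderZ c%:~R (cder_id tau)) (cder_cst d%:~R tau)) _; rewrite mulr1 addr0.
by apply: cder_eq (cder_comp dl (cder_cpow w im)) _; ring.
Qed.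

End ComplexPowers.

(** * Matrix-valued expansions and principal parts *)

Section VectorExpansions.
Variable R : realType.
Local Notation C := (cplx R).
Implicit Types (a b : nat -> C) (tau q : C) (N : nat).
Local Notation T := (twopii R).

Lemma cvgs_terms_bounded (u : nat -> C) (l : C) : cvgs (fun K => \sum_(0 <= k < K) u k) l ->
  exists B : R, forall k, cmod (u k) <= B.
Proof.
move=> ul; have [M HM] := ul 1 ltr01.
exists (2 + \sum_(0 <= k < M) cmod (u k)) => k.
have S0 : 0 <= \sum_(0 <= k < M) cmod (u k) by apply: sumr_ge0 => i _; exact: cmod_ge0.
have [Mk|kM] := leqP M k.
  have h1 := HM _ Mk; have h2 := HM _ (leqW Mk).
  have : cmod (u k) <= cmod (\sum_(0 <= i < k.+1) u i - l) + cmod (\sum_(0 <= i < k) u i - l).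
    apply: le_trans (_ : cmod (\sum_(0 <= i < k.+1) u i - l - (\sum_(0 <= i < k) u i - l)) <= _).
      by rewrite opprB addrA subrK big_nat_recr//= addrC addKr.
    by apply: le_trans (cmodD _ _) _; rewrite cmodN.
  lra.
have kin : k \in index_iota 0 M by rewrite mem_index_iota.
rewrite (bigD1_seq k kin (iota_uniq _ _))/= addrCA lerDl addr_ge0//.
by apply: sumr_ge0 => i _; exact: cmod_ge0.
Qed.

Lemma qpar_surjR (t : R) : 0 < t < 1 -> exists2 tau : C, upper tau & qpar tau = ofreal t.
Proof.
move=> /andP[t0 t1]; exists (Complex 0 (- ln t / (2 * pi))) => /=.
  by rewrite /upper /= divr_gt0 ?mulr_gt0 ?pi_gt0// oppr_gt0 ln_lt0// t0 t1.
have pi0 : pi != 0 :> R by rewrite gt_eqF ?pi_gt0.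
rewrite /qpar cexpE Re_twopii Im_twopii /= mulr0 /cis cos0 sin0.
have -> : - (2 * pi * (- ln t / (2 * pi))) = ln t.
  by rewrite mulNr mulrN opprK mulrC divfK ?mulf_neq0.
by rewrite lnK ?posrE// mulr1.
Qed.

(** [has_qexp] reindexed by naturals, the pole order [N] being moved into the exponent, with
    absolute convergence on the whole disc included. *)
Definition vexp d m (L : 'M[C]_d) N (A : nat -> 'M[C]_(d, m)) (F : C -> 'M[C]_(d, m)) :=
  forall i j, lexp (L i i - N%:R) (fun n => A n i j) (fun tau => F tau i j).

Lemma cexp_shift tau (s : C) N : cexp (T * tau * (s - N%:R)) = cexp (T * tau * s) / qpar tau ^+ N.
Proof. by rewrite mulrBr cexpB [_ * N%:R]mulrC cexpMn. Qed.

Lemma qexp_partial d m (L : 'M[C]_d) N (a : int -> 'M[C]_(d, m)) tau i j K :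
  (qpow L tau *m \sum_(0 <= k < K) qpar tau ^ (k%:Z - N%:Z) *: a (k%:Z - N%:Z)) i j =
  cexp (T * tau * (L i i - N%:R)) * \sum_(0 <= k < K) (a (k%:Z - N%:Z) i j * qpar tau ^+ k).
Proof.
rewrite /qpow mul_diag_mx !mxE summxE cexp_shift -[RHS]mulrA; congr (_ * _).
rewrite mulr_sumr; apply: eq_bigr => k _; rewrite mxE expfzDr ?qpar_neq0// -exprnN -exprnP.
by rewrite [a _ _ _ * _]mulrC mulrA [_^-1 * _]mulrC.
Qed.

Lemma vexp_has_qexp d m (L : 'M[C]_d) N (A : nat -> 'M[C]_(d, m)) (F : C -> 'M[C]_(d, m))
    (a : int -> 'M[C]_(d, m)) :
  (forall n : int, n < - N%:Z -> a n = 0) -> (forall k, a (k%:Z - N%:Z) = A k) ->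
  vexp L N A F -> has_qexp L F a.
Proof.
move=> a0 aA HF; exists N => // tau t0 i j; apply/cvgCP.
rewrite (funext (fun K => qexp_partial L N a tau i j K)).
have [ca ->//] := HF i j; apply: cvgsZ.
rewrite (_ : (fun n => _) = fun K => \sum_(0 <= k < K) A k i j * qpar tau ^+ k).
  by apply: asum_cvg; apply: (conv_asum ca); exact: upper_qpar.
by apply: funext => K; apply: eq_bigr => k _; rewrite aA.
Qed.

(** Abel's argument: convergence of the partial sums at points where [q] is any real [t] in []0, 1[]
    bounds the terms, which gives absolute convergence for smaller [|q|]. *)
Lemma has_qexp_vexp d m (L : 'M[C]_d) (F : C -> 'M[C]_(d, m)) (a : int -> 'M[C]_(d, m)) :
  has_qexp L F a -> exists2 N, (forall n : int, n < - N%:Z -> a n = 0) &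
    vexp L N (fun k => a (k%:Z - N%:Z)) F.
Proof.
move=> [N a0 HF]; exists N => // i j; set u := fun n => _.
have S tau : upper tau -> cvgs (fun K => \sum_(0 <= k < K) u k * qpar tau ^+ k)
    ((cexp (T * tau * (L i i - N%:R)))^-1 * F tau i j).
  move=> t0; have /cvgCP := HF tau t0 i j.
  rewrite (funext (fun K => qexp_partial L N a tau i j K)) => /(cvgsZ (cexp (T * tau * (L i i - N%:R)))^-1).
  congr cvgs; apply: funext => K; rewrite mulKf// cexp_neq0//.
have cu : conv u.
  apply: conv_bounded => t t01; have [tau t0 qt] := qpar_surjR t01.
  have [B HB] := cvgs_terms_bounded (S _ t0); exists B => k.
  have := HB k; rewrite qt cmodM cmodX cmod_ofreal ger0_norm//.
  by case/andP: t01 => /ltW.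
split=> // tau t0; have := cvgs_unique (S _ t0) (asum_cvg (conv_asum cu (upper_qpar t0))).
by move/(canRL (mulKf (invr_neq0 (cexp_neq0 _)))) => ->; rewrite invrK.
Qed.

Lemma vexp_shift d m (L : 'M[C]_d) N k (A : nat -> 'M[C]_(d, m)) F : vexp L N A F ->
  vexp L (N + k) (fun n => if (k <= n)%N then A (n - k)%N else 0) F.
Proof.
move=> HF i j; apply: lexp_eqs (lexp_shift k (HF i j)) => [|n].
  by rewrite natrD opprD addrA.
by rewrite /shiftn; case: ifP => // _; rewrite mxE.
Qed.

Lemma has_qexp_unique d m (L : 'M[C]_d) (F : C -> 'M[C]_(d, m)) (a b : int -> 'M[C]_(d, m)) :
  has_qexp L F a -> has_qexp L F b -> a = b.
Proof.
suff main (a' b' : int -> 'M[C]_(d, m)) N M : (forall n : int, n < - N%:Z -> a' n = 0) ->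
    vexp L N (fun k => a' (k%:Z - N%:Z)) F -> (forall n : int, n < - M%:Z -> b' n = 0) ->
    vexp L M (fun k => b' (k%:Z - M%:Z)) F -> a' = b'.
  by move=> /has_qexp_vexp[N aN HN] /has_qexp_vexp[M bM HM]; exact: main aN HN bM HM.
move=> aN HN bM HM; apply: funext => n.
have [n0|n0] := ltrP n (- (N + M)%:Z).
  by rewrite aN ?bM//; move: n0; rewrite PoszD opprD; lia.
have nE : n = (absz (n + (N + M)%:Z))%:Z - (N + M)%:Z by lia.
set k := absz _ in nE; apply/matrixP => i j.
have e : L i i - (M + N)%:R = L i i - (N + M)%:R by rewrite [(M + N)%N]addnC.
have := lexp_unique (vexp_shift M HN i j) (lexp_eqs e (frefl _) (vexp_shift N HM i j)) k.
rewrite /= nE.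
have sh (c : int -> 'M[C]_(d, m)) K K' : (forall n : int, n < - K%:Z -> c n = 0) ->
    (if (K' <= k)%N then c ((k - K')%N%:Z - K%:Z) else 0) = c (k%:Z - (K + K')%:Z).
  move=> c0; case: leqP => kK; first by congr c; rewrite -subzn// PoszD; ring.
  by rewrite c0//; lia.
by rewrite (sh a')// (sh b')// [(M + N)%N]addnC.
Qed.

Lemma qcoefE d m (L : 'M[C]_d) (F : C -> 'M[C]_(d, m)) (a : int -> 'M[C]_(d, m)) :
  has_qexp L F a -> qcoef L F = a.
Proof. by move=> Ha; apply: xget_unique => // b Hb; exact: has_qexp_unique Hb Ha. Qed.

Definition zcoef d m N (A : nat -> 'M[C]_(d, m)) (n : int) : 'M[C]_(d, m) :=
  if 0 <= n + N%:Z then A (absz (n + N%:Z)) else 0.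

Lemma vexp_zcoef d m (L : 'M[C]_d) N (A : nat -> 'M[C]_(d, m)) F : vexp L N A F ->
  has_qexp L F (zcoef N A).
Proof.
apply: vexp_has_qexp => [n n0|k]; rewrite /zcoef.
  by rewrite ifF//; apply/negbTE; rewrite -ltNge; lia.
by rewrite subrK.
Qed.

(** Both choices made by [xget] are resolved: that of [qcoef] by uniqueness of the expansion, that
    of [principal_part] by exhibiting the polynomials. *)
Lemma principal_partE d (L : 'M[C]_d) N (A : nat -> 'cV[C]_d) (X : C -> 'cV[C]_d) n i :
  vexp L N A X -> (principal_part L X i 0)`_n = if (n <= N)%N then A (N - n)%N i 0 else 0.
Proof.
move=> /vexp_zcoef/qcoefE qE.
have E m k : zcoef N A (- m%:Z) k 0 = if (m <= N)%N then A (N - m)%N k 0 else 0.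
  rewrite /zcoef; case: leqP => mN.
    by rewrite ifT; [congr (A _ _ _); lia | lia].
  by rewrite ifF ?mxE//; apply/negbTE; rewrite -ltNge; lia.
rewrite -E; pose p : 'cV[{poly C}]_d := \col_k \poly_(m < N.+1) zcoef N A (- m%:Z) k 0.
have pE m k : (p k 0)`_m = zcoef N A (- m%:Z) k 0.
  by rewrite mxE coef_poly ltnS E; case: leqP.
rewrite /principal_part; case: xgetP => [p' _ -> //|/(_ p) H]; first by rewrite qE.
by exfalso; apply: H => m k; rewrite qE.
Qed.

Lemma vexp_eq d m (L : 'M[C]_d) N (A : nat -> 'M[C]_(d, m)) F G :
  (forall tau, upper tau -> F tau = G tau) -> vexp L N A F -> vexp L N A G.
Proof. by move=> FG HF i j; apply: lexp_eq (HF i j) => tau /FG ->. Qed.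

Lemma vexp_unique d m (L : 'M[C]_d) N (A B : nat -> 'M[C]_(d, m)) F :
  vexp L N A F -> vexp L N B F -> A =1 B.
Proof. by move=> HA HB n; apply/matrixP => i j; exact: lexp_unique (HA i j) (HB i j) n. Qed.

Lemma vexpD d m (L : 'M[C]_d) N (A B : nat -> 'M[C]_(d, m)) F G :
  vexp L N A F -> vexp L N B G -> vexp L N (fun n => A n + B n) (fun tau => F tau + G tau).
Proof.
move=> HA HB i j; apply: lexp_eqs (lexp_eq _ (lexpD (HA i j) (HB i j))) => //.
  by move=> n; rewrite mxE.
by move=> tau _; rewrite mxE.
Qed.

Lemma vexpZ d m (L : 'M[C]_d) N (A : nat -> 'M[C]_(d, m)) F c :
  vexp L N A F -> vexp L N (fun n => c *: A n) (fun tau => c *: F tau).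
Proof.
move=> HA i j; apply: lexp_eqs (lexp_eq _ (lexpZ c (HA i j))) => //.
  by move=> n; rewrite mxE.
by move=> tau _; rewrite mxE.
Qed.

Lemma vexp_mulmx d m p (L : 'M[C]_d) N (A : nat -> 'M[C]_(d, m)) F (B : 'M[C]_(m, p)) :
  vexp L N A F -> vexp L N (fun n => A n *m B) (fun tau => F tau *m B).
Proof.
move=> HA i j.
have := lexp_sum (index_enum 'I_m) (fun k => lexpZ (B k j) (HA i k)).
move=> H; apply: lexp_eqs (lexp_eq _ H) => //.
  by move=> n; rewrite mxE; apply: eq_bigr => k _; rewrite mulrC.
by move=> tau _; rewrite mxE; apply: eq_bigr => k _; rewrite mulrC.
Qed.

Lemma vexpM d m (L : 'M[C]_d) N M b (phi : C -> C) (A : nat -> 'M[C]_(d, m)) F :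
  lexp (- N%:R) b phi -> vexp L M A F ->
  vexp L (N + M) (fun n => \matrix_(i, j) cauchy_prod b (fun n => A n i j) n)
    (fun tau => phi tau *: F tau).
Proof.
move=> Hb HA i j; apply: lexp_eqs (lexp_eq _ (lexpM Hb (HA i j))) => //.
- by rewrite natrD opprD; ring.
- by move=> n; rewrite mxE.
- by move=> tau _; rewrite mxE.
Qed.

Definition Dw_coef d m (L : 'M[C]_d) N (w : C) (A : nat -> 'M[C]_(d, m)) n : 'M[C]_(d, m) :=
  \matrix_(i, j) ((L i i - N%:R + n%:R) * A n i j - w / 12 * cauchy_prod (e2c R) (fun n => A n i j) n).

Lemma vexp_Dw d m (L : 'M[C]_d) N w (A : nat -> 'M[C]_(d, m)) F :
  vexp L N A F -> vexp L N (Dw_coef L N w A) (Dw w F).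
Proof.
move=> HA i j.
have H1 := lexp_derive (HA i j).
have H2 := lexp_eqs (add0r _) (frefl _) (lexpM (@lexp_E2 R) (HA i j)).
apply: lexp_eqs (lexp_eq _ (lexpD H1 (lexpZ (- (w / 12)) H2))) => //.
  by move=> n; rewrite mxE mulNr.
by move=> tau _; rewrite !mxE mulNr mulrA.
Qed.

Lemma vexp_cder d m (L : 'M[C]_d) N (A : nat -> 'M[C]_(d, m)) F tau i j :
  vexp L N A F -> upper tau -> cder (fun x => F x i j) tau (mxderive F tau i j).
Proof.
move=> HA t0; rewrite mxE; have H := cder_lexp (HA i j) t0.
by rewrite (cder_derive1 H).
Qed.

End VectorExpansions.

(** * Scalar forms of weight [k] and matrix-valued forms of weight [w + k] *)

Section Forms.
Variables (R : realType) (d : nat).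
Local Notation C := (cplx R).
Local Notation T := (twopii R).
Variables (rho : 'M[int]_2 -> 'M[C]_d) (w : C) (L : 'M[C]_d).
Implicit Types (tau : C) (g : 'M[int]_2) (k l m : nat).

Lemma SL2Z_det g : g \in SL2Z -> g 0 0 * g 1 1 - g 0 1 * g 1 0 = 1.
Proof.
rewrite inE => /eqP <-; rewrite (expand_det_row g 0) !big_ord_recl big_ord0 /cofactor.
rewrite !det_mx11 !mxE /= addr0 expr0 mul1r expr1 mulN1r mulrN.
by congr (_ * g _ _ - g _ _ * g _ _); apply: val_inj.
Qed.

Lemma mobius_upper g tau : g \in SL2Z -> upper tau -> upper (mobius g tau).
Proof. by move=> /SL2Z_det; exact: mobius_upper_int. Qed.

Lemma cden_neq0 g tau : g \in SL2Z -> upper tau -> cden g tau != 0.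
Proof. by move=> /SL2Z_det/det1_neq0 g1 t0; exact: cden_neq0_int. Qed.

Definition modf k (phi : C -> C) :=
  (forall g tau, g \in SL2Z -> upper tau -> phi (mobius g tau) = cden g tau ^+ k * phi tau)
  /\ exists N a, lexp (- N%:R) a phi.

Lemma modf_E4 : modf 4 (@E4 R).
Proof.
split=> [g tau /SL2Z_det gE t0|]; first exact: E4_modular.
by exists 0%N, (e4c R); rewrite oppr0; exact: lexp_E4.
Qed.

Lemma modf_E6 : modf 6 (@E6 R).
Proof.
split=> [g tau /SL2Z_det gE t0|]; first exact: E6_modular.
by exists 0%N, (e6c R); rewrite oppr0; exact: lexp_E6.
Qed.

(** The product shows no transformation law; that of [Delta] is inherited from [E4] and [E6]. *)
Lemma Delta_E46 tau : upper tau -> Delta tau = 1728^-1 * (E4 tau ^+ 3 - E6 tau ^+ 2).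
Proof.
move=> t0; have c0 : 1728 != 0 :> C by rewrite pnatr_eq0.
by apply: (canRL (mulKf c0)); rewrite discE.
Qed.

Lemma Delta_modular g tau : g \in SL2Z -> upper tau ->
  Delta (mobius g tau) = cden g tau ^+ 12 * Delta tau.
Proof.
move=> g1 t0; rewrite (Delta_E46 (mobius_upper g1 t0)) (Delta_E46 t0).
have [H4 _] := modf_E4; have [H6 _] := modf_E6.
rewrite (H4 _ _ g1 t0) (H6 _ _ g1 t0); move: (1728^-1) (cden g tau) (E4 tau) (E6 tau) => c u e f; ring.
Qed.

Lemma modf_Delta : modf 12 (@Delta R).
Proof.
split=> [g tau|]; first exact: Delta_modular.
exists 0%N; eexists; rewrite oppr0.
have c4 := @lexp_E4 R; have c6 := @lexp_E6 R.
have H4 := lexpM c4 (lexpM c4 c4); have H6 := lexpM c6 c6.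
rewrite !addr0 in H4 H6.
apply: lexp_eq (lexpZ 1728^-1 (lexpD H4 (lexpZ (-1) H6))) => tau t0.
by rewrite (Delta_E46 t0) mulN1r !exprS expr0 !mulr1.
Qed.

Lemma kleinJ_invariant g tau : g \in SL2Z -> upper tau -> kleinJ (mobius g tau) = kleinJ tau.
Proof.
move=> g1 t0; rewrite /kleinJ (Delta_modular g1 t0); have [-> // _] := modf_E4.
have u0 := cden_neq0 g1 t0; have D0 := Delta_neq0 t0.
by rewrite exprMn -exprM invfM mulrACA divff ?mul1r// expf_neq0.
Qed.

Lemma modf_kleinJ_poly (p : {poly C}) : modf 0 (fun tau => p.[kleinJ tau]).
Proof.
split=> [g tau g1 t0|]; first by rewrite kleinJ_invariant// expr0 mul1r.
by exists (size p); have [a Ha _] := lexp_kleinJ_poly (leqnSn (size p)); exists a.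
Qed.

(** Weight [w + k], with the integral part of the weight as an ordinary power next to [rho_tilde],
    which avoids laws of complex powers. Holomorphy is implied by the expansion, and any number of
    columns is allowed. *)
Definition form k m (F : C -> 'M[C]_(d, m)) :=
  (forall g tau, g \in SL2Z -> upper tau ->
     F (mobius g tau) = cden g tau ^+ k *: (rho_tilde rho w g tau *m F tau))
  /\ exists N A, vexp L N A F.

Lemma form_eq k m (F G : C -> 'M[C]_(d, m)) :
  (forall tau, upper tau -> F tau = G tau) -> form k F -> form k G.
Proof.
move=> FG [HF [N [A HA]]]; split=> [g tau g1 t0|].
  by rewrite -!FG ?HF//; exact: mobius_upper.
by exists N, A; exact: vexp_eq HA.
Qed.

Lemma formD k m (F G : C -> 'M[C]_(d, m)) :
  form k F -> form k G -> form k (fun tau => F tau + G tau).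
Proof.
move=> [HF [N [A HA]]] [HG [M [B HB]]]; split=> [g tau g1 t0|].
  by rewrite HF// HG// mulmxDr scalerDr.
have HB' := vexp_shift N HB; rewrite addnC in HB'.
by exists (N + M)%N; eexists; exact: vexpD (vexp_shift M HA) HB'.
Qed.

Lemma formZ k m (c : C) (F : C -> 'M[C]_(d, m)) : form k F -> form k (fun tau => c *: F tau).
Proof.
move=> [HF [N [A HA]]]; split=> [g tau g1 t0|].
  by rewrite HF// -scalemxAr scalerA mulrC -scalerA.
by exists N; eexists; exact: vexpZ HA.
Qed.

Lemma form_mulmx k m p (F : C -> 'M[C]_(d, m)) (B : 'M[C]_(m, p)) :
  form k F -> form k (fun tau => F tau *m B).
Proof.
move=> [HF [N [A HA]]]; split=> [g tau g1 t0|]; first by rewrite HF// -scalemxAl mulmxA.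
by exists N; eexists; exact: vexp_mulmx HA.
Qed.

Lemma formM k l m (phi : C -> C) (F : C -> 'M[C]_(d, m)) :
  modf k phi -> form l F -> form (k + l) (fun tau => phi tau *: F tau).
Proof.
move=> [Hp [N [b Hb]]] [HF [M [A HA]]]; split=> [g tau g1 t0|].
  rewrite HF// Hp// -scalemxAr !scalerA; congr (_ *: _).
  by rewrite exprD mulrAC.
by exists (N + M)%N; eexists; exact: vexpM Hb HA.
Qed.

Lemma form_divDelta k m (F : C -> 'M[C]_(d, m)) :
  form (k + 12) F -> form k (fun tau => (Delta tau)^-1 *: F tau).
Proof.
move=> [HF [M [A HA]]]; split=> [g tau g1 t0|].
  rewrite HF// (Delta_modular g1 t0) -scalemxAr !scalerA; congr (_ *: _).
  have u0 := expf_neq0 12 (cden_neq0 g1 t0).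
  by rewrite exprD invfM [LHS]mulrC mulrA mulfK.
have HD : lexp (- 1%:R) (invDelta_coef R) (fun tau => (Delta tau)^-1) := @lexp_invDelta R.
by exists (1 + M)%N; eexists; exact: vexpM HD HA.
Qed.

Lemma cder_sum (I : Type) (r : seq I) (l' : I -> C) (f : I -> C -> C) tau :
  (forall i, cder (f i) tau (l' i)) ->
  cder (fun x => \sum_(i <- r) f i x) tau (\sum_(i <- r) l' i).
Proof.
move=> H; elim: r => [|i r IH].
  rewrite big_nil (_ : (fun x => _) = fun=> 0); first exact: cder_cst.
  by apply: funext => x; rewrite big_nil.
rewrite big_cons (_ : (fun x => _) = fun x => f i x + \sum_(i <- r) f i x).
  exact: cderD.
by apply: funext => x; rewrite big_cons.
Qed.

Lemma DwE m (s : C) (F : C -> 'M[C]_(d, m)) tau i j :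
  Dw s F tau i j = T^-1 * mxderive F tau i j - s / 12 * E2 tau * F tau i j.
Proof. by rewrite !mxE. Qed.

(** The law of [F] is differentiated by the chain rule. The derivative of the factor
    [(c tau + d)^(w + k)] is cancelled by the anomaly of [E_2]. *)
Lemma form_Dw k m (F : C -> 'M[C]_(d, m)) : form k F -> form k.+2 (Dw (w + k%:R) F).
Proof.
move=> [HF [N [A HA]]]; split=> [g tau g1 t0|]; last first.
  by exists N; eexists; exact: vexp_Dw HA.
have s0 := mobius_upper g1 t0; have u0 := cden_neq0 g1 t0; have T0 := twopii_neq0 R.
apply/matrixP => i j.
pose G x := (rho g *m F x) i j; pose G' := (rho g *m mxderive F tau) i j.
have dG : cder G tau G'.
  have := cder_sum (index_enum 'I_d) (fun l : 'I_d => cderZ (rho g i l) (vexp_cder l j HA t0)).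
  rewrite /G' mxE; congr cder.
  by apply: funext => x; rewrite /G mxE.
have dl := cder_comp (cder_mobius (SL2Z_det g1) t0) (vexp_cder i j HA s0).
have dp := cder_cpow_linear w t0 (det1_neq0 (SL2Z_det g1)).
have dr := cderM (cderM (cder_cden (g 1 0) (g 1 1) tau k) dp) dG.
have E x : upper x -> F (mobius g x) i j = cden g x ^+ k * cpow (cden g x) w * G x.
  by move=> x0; rewrite HF// /rho_tilde -scalemxAl !mxE mulrA /G mxE.
have {}dl := cder_upper t0 E dl; have := cder_unique dl dr.
rewrite -/(mobius g tau) -/(cden g tau) => D.
have RE : (rho_tilde rho w g tau *m Dw (w + k%:R) F tau) i j =
    cpow (cden g tau) w * (T^-1 * G' - (w + k%:R) / 12 * E2 tau * G tau).
  by rewrite /rho_tilde /Dw -scalemxAl mulmxBr -!scalemxAr !mxE /G' /G !mxE.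
rewrite [RHS]mxE RE DwE (E _ t0) (E2_modular (SL2Z_det g1) t0) -/(cden g tau).
rewrite -(divfK (expf_neq0 2 u0) (mxderive F _ i j)) D.
have kE : k%:R * cden g tau ^+ k.-1 = k%:R * cden g tau ^+ k / cden g tau.
  by case: k {HF E dl dr D RE} => [|k]; rewrite ?mul0r// exprSr mulrA mulfK.
rewrite kE !exprS expr0 mulr1.
clear HF dG dp dr dl D E RE kE; clearbody G G'.
move: ((g 1 0)%:~R : C) (cden g tau) u0 (cpow (cden g tau) w) (cden g tau ^+ k) (E2 tau) G' (G tau).
by clear -T0 => c u u0 P uk e x y; field; rewrite T0 u0.
Qed.
End Forms.

(** * Weakly holomorphic forms and the bijective exponent *)

Section WeaklyHolomorphic.
Variables (R : realType) (d : nat).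
Local Notation C := (cplx R).
Local Notation T := (twopii R).
Variables (rho : 'M[int]_2 -> 'M[C]_d) (w : C) (L : 'M[C]_d).
Hypothesis bijL : bijective_exponent rho w L.
Implicit Types (tau : C).
Local Notation form := (form rho w L).
Local Notation M := (Mweak rho w).

(** [Mweak] asks for functions that vanish off the upper half-plane. *)
Definition mask m (F : C -> 'M[C]_(d, m)) tau := if 0 < complex.Im tau then F tau else 0.

Lemma maskE m (F : C -> 'M[C]_(d, m)) tau : upper tau -> mask F tau = F tau.
Proof. by rewrite /mask /upper /= => ->. Qed.

Lemma exponent_integral (lam : 'M[C]_d) : is_exponent rho lam ->
  forall j, exists n : int, lam j j = L j j + n%:~R.
Proof.
have [[_ EL] _ _] := bijL => -[_ El] j; have := EL; rewrite -El => /matrixP/(_ j j).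
rewrite !mxE eqxx !mulr1n => e.
have [|n] := @cexp_eq1 R (T * lam j j - T * L j j).
  by rewrite cexpB e divff// cexp_neq0.
rewrite -mulrBr => /(mulfI (twopii_neq0 R)) H; exists n.
by rewrite -H addrC subrK.
Qed.

(** Meromorphy at the cusp refers to some exponent. Two exponents differ by integers, and a further
    pole order [K] makes all the row shifts nonnegative. *)
Lemma vexp_exponent (lam : 'M[C]_d) m N (A : nat -> 'M[C]_(d, m)) F : is_exponent rho lam ->
  vexp lam N A F -> exists N' A', vexp L N' A' F.
Proof.
move=> /exponent_integral/choice[n nE] HF; pose K := (\sum_j absz (n j))%N.
have nK j : (absz (n j) <= K)%N by rewrite /K (bigD1 j)//= leq_addr.
exists (N + K)%N, (fun k => \matrix_(i, j) shiftn (absz (n i + K%:Z)) (fun k => A k i j) k).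
move=> i j; apply: lexp_eqs (lexp_shift (absz (n i + K%:Z)) (HF i j)) => [|k]; last by rewrite mxE.
have nn : (absz (n i + K%:Z))%:Z = n i + K%:Z by have := nK i; lia.
have -> : (absz (n i + K%:Z))%:R = (n i)%:~R + K%:R :> C.
  by have := congr1 (fun x : int => x%:~R : C) nn; rewrite /= intrD.
rewrite nE natrD; ring.
Qed.

Lemma Mweak_form X : M X -> form 0 X.
Proof.
move=> [_ _ HX [lam El [a /has_qexp_vexp[N _ HA]]]]; split.
  by move=> g tau g1 t0; rewrite HX// expr0 scale1r.
exact: vexp_exponent El HA.
Qed.

Lemma form_Mweak (X : C -> 'cV[C]_d) : form 0 X -> M (mask X).
Proof.
move=> [HX [N [A HA]]]; split.
- by move=> tau /negP t0; rewrite /mask (negbTE t0).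
- move=> tau t0 i j; apply: (@cder_derivable _ _ _ (mxderive X tau i j)).
  have E x : upper x -> X x i j = mask X x i j by move=> x0; rewrite maskE.
  exact: cder_upper t0 E (vexp_cder i j HA t0).
- move=> g tau g1 t0; rewrite !maskE//; last exact: mobius_upper.
  by rewrite HX// expr0 scale1r.
- have [exL _ _] := bijL; exists L => //; exists (zcoef N A); apply: vexp_zcoef.
  by apply: vexp_eq HA => tau t0; rewrite maskE.
Qed.

Lemma form0 k m : form k (fun=> 0 : 'M[C]_(d, m)).
Proof.
split=> [g tau _ _|]; first by rewrite mulmx0 scaler0.
exists 0%N, (fun=> 0) => i j; apply: lexp_eqs (lexp_eq _ (lexp0 _)) => //.
  by move=> n; rewrite mxE.
by move=> tau _; rewrite mxE.
Qed.

Lemma principal_part_inj X Y : M X -> M Y -> principal_part L X = principal_part L Y -> X = Y.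
Proof. by have [_ _ [_ inj _]] := bijL => MX MY; apply: inj; rewrite inE. Qed.

Lemma vexp0 m N : vexp L N (fun=> 0 : 'M[C]_(d, m)) (fun=> 0).
Proof.
move=> i j; apply: lexp_eqs (lexp_eq _ (lexp0 _)) => //.
  by move=> n; rewrite mxE.
by move=> tau _; rewrite mxE.
Qed.

(** Injectivity of the principal part map, column by column. All later vanishing of matrix-valued
    forms rests on it. *)
Lemma form_principal0 m N A (F : C -> 'M[C]_(d, m)) : form 0 F -> vexp L N A F ->
  (forall n, (n <= N)%N -> A n = 0) -> forall tau, upper tau -> F tau = 0.
Proof.
move=> fF HA A0 tau t0; apply/matrixP => i j; rewrite [RHS]mxE.
pose X x : 'cV[C]_d := F x *m delta_mx j 0.
have fX : form 0 X by exact: form_mulmx.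
have HX : vexp L N (fun n => A n *m delta_mx j 0) (mask X).
  by apply: vexp_eq (vexp_mulmx _ HA) => x x0; rewrite maskE.
have M0 := form_Mweak (form0 0%N 1%N).
have H0 : vexp L 0 (fun=> 0 : 'cV[C]_d) (mask (fun=> 0)).
  by apply: vexp_eq (vexp0 _) => x x0; rewrite maskE.
have E : mask X = mask (fun=> 0).
  apply: principal_part_inj (form_Mweak fX) M0 _; apply/matrixP => k l; rewrite (ord1 l).
  apply/polyP => n.
  apply: etrans (principal_partE n k HX) (etrans _ (esym (principal_partE n k H0))).
  rewrite A0 ?leq_subr// mul0mx.
  by case: ifP => _; case: ifP => _; rewrite ?mxE.
have : mask X tau i 0 = 0 by rewrite E maskE// mxE.
by rewrite maskE// /X -colE mxE.
Qed.

Lemma lexp_unshift (s : C) N (a : nat -> C) F : lexp (s - N%:R) a F ->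
  (forall n, (n < N)%N -> a n = 0) -> lexp s (fun n => a (n + N)%N) F.
Proof.
elim: N s a => [|N IH] s a HF a0.
  by apply: lexp_eqs HF; rewrite ?subr0// => n; rewrite addn0.
apply: (lexp_eqs (a := fun n => a (n + N).+1) erefl) => [n|]; first by rewrite addnS.
apply: (IH s (fun n => a n.+1)) => [|n nN]; last exact: a0.
have [ca HF'] := HF; split=> [|tau t0]; first exact: conv_tail.
rewrite HF'// (ev_split ca (upper_qpar t0)) a0// add0r mulrA.
congr (_ * _); rewrite !cexp_shift.
move: (qpar tau) (qpar_neq0 tau) (cexp _) => q q0 c.
by rewrite exprSr invfM mulrA divfK.
Qed.

Lemma XjnP j n : M (Xjn rho w L j n) /\ principal_part L (Xjn rho w L j n) = 'X^n *: delta_mx j 0.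
Proof.
have [_ _ [_ _ surj]] := bijL.
have [X MX pX] := surj ('X^n *: delta_mx j 0) I.
by have := @xgetPex _ (fun=> 0) [set X | M X /\ principal_part L X = 'X^n *: delta_mx j 0]
  (ex_intro _ X (conj MX pX)).
Qed.

Lemma Xjn0_vexp j : exists2 A, vexp L 0 A (Xjn rho w L j 0) & A 0%N = delta_mx j 0.
Proof.
have [MX pX] := XjnP j 0; have [_ [N [A HA]]] := Mweak_form MX.
have pE n i : (if (n <= N)%N then A (N - n)%N i 0 else 0) = ((i == j) && (n == 0))%:R.
  rewrite -(principal_partE n i HA) pX expr0 scale1r !mxE eqxx andbT coefMn coef1.
  by case: (i == j).
have A0 n : (n < N)%N -> A n = 0.
  move=> nN; apply/matrixP => i k; rewrite (ord1 k) mxE; have := pE (N - n)%N i.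
  rewrite leq_subr subKn ?(ltnW nN)// => ->.
  by rewrite subn_eq0 leqNgt nN andbF.
exists (fun n => A (n + N)%N).
  move=> i k; rewrite subr0; apply: lexp_unshift (HA i k) _ => n nN.
  by rewrite A0// mxE.
apply/matrixP => i k; rewrite (ord1 k) mxE eqxx andbT add0n.
by have := pE 0%N i; rewrite leq0n subn0 eqxx andbT.
Qed.

Local Notation Xi := (Xi rho w L).

Lemma Xi_vexp : exists A, [/\ vexp L 0 A Xi, A 0%N = 1%:M & A 1%N = chi rho w L].
Proof.
have H j : exists A, vexp L 0 A (Xjn rho w L j 0) /\ A 0%N = delta_mx j 0.
  by have [A HA A0] := Xjn0_vexp j; exists A.
have [A {H}HA] := choice H.
pose B n : 'M[C]_d := \matrix_(i, j) A j n i 0.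
have HB : vexp L 0 B Xi.
  move=> i j; have [H _] := HA j; apply: lexp_eqs (lexp_eq _ (H i 0)) => //.
    by move=> n; rewrite mxE.
  by move=> tau _; rewrite mxE.
exists B; split=> //.
  by apply/matrixP => i j; rewrite !mxE; have [_ ->] := HA j; rewrite mxE eqxx andbT.
by rewrite /chi (qcoefE (vexp_zcoef HB)) /zcoef.
Qed.

Lemma Xi_form : form 0 Xi.
Proof.
split; last by have [A [HA _ _]] := Xi_vexp; exists 0%N, A.
move=> g tau g1 t0; apply/matrixP => i j; rewrite expr0 scale1r mxE.
have [/Mweak_form[H _] _] := XjnP j 0; rewrite H// expr0 scale1r !mxE.
by apply: eq_bigr => k _; congr (_ * _); rewrite mxE.
Qed.

End WeaklyHolomorphic.

(** * Freeness over the polynomials in [J] *)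

Section FreeModule.
Variables (R : realType) (d : nat).
Local Notation C := (cplx R).
Variables (rho : 'M[int]_2 -> 'M[C]_d) (w : C) (L : 'M[C]_d).
Hypothesis bijL : bijective_exponent rho w L.
Implicit Types (tau : C).
Local Notation form := (form rho w L).
Local Notation M := (Mweak rho w).
Local Notation B j := (Xjn rho w L j 0).

Lemma form_Mweak_vanishing (X : C -> 'cV[C]_d) :
  (forall tau, ~ upper tau -> X tau = 0) -> form 0 X -> M X.
Proof.
move=> X0 /(form_Mweak bijL); congr Mweak.
by apply: funext => tau; rewrite /mask; case: ifP => // /negP/X0.
Qed.

Lemma Mweak_CJ_module : CJ_module M.
Proof.
split=> [|X Y MX MY|p X MX].
- by apply: form_Mweak_vanishing => //; exact: form0.
- apply: form_Mweak_vanishing (formD (Mweak_form bijL MX) (Mweak_form bijL MY)).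
  by move=> tau t0; have [-> // _ _ _] := MX; have [-> // _ _ _] := MY; rewrite addr0.
- apply: form_Mweak_vanishing (formM (modf_kleinJ_poly p) (Mweak_form bijL MX)).
  by move=> tau t0; have [-> // _ _ _] := MX; rewrite scaler0.
Qed.

Definition CJcomb (p : 'cV[{poly C}]_d) tau := \sum_j (p j 0).[kleinJ tau] *: B j tau.

Lemma vexp_sum m (r : seq 'I_d) N (A : 'I_d -> nat -> 'M[C]_(d, m)) F :
  (forall k, vexp L N (A k) (F k)) ->
  vexp L N (fun n => \sum_(k <- r) A k n) (fun tau => \sum_(k <- r) F k tau).
Proof.
move=> H i j; apply: lexp_eqs (lexp_eq _ (lexp_sum r (fun k => H k i j))) => //.
  by move=> n; rewrite summxE.
by move=> tau _; rewrite summxE.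
Qed.

(** [J^n] starts with [q^-n] and the generator [j] with [e_j], so the leading vector lists the
    coefficients of degree [n]. *)
Lemma CJcomb_leading (p : 'cV[{poly C}]_d) n : (forall j, (size (p j 0%R) <= n.+1)%N) ->
  exists2 A, vexp L n A (CJcomb p) & forall i, A 0%N i 0 = (p i 0)`_n.
Proof.
move=> sp.
have H j : exists A, vexp L n A (fun tau => (p j 0).[kleinJ tau] *: B j tau) /\
    forall i, A 0%N i 0 = (p j 0)`_n * (i == j)%:R.
  have [a Ha a0] := lexp_kleinJ_poly (sp j); have [A HA A0] := Xjn0_vexp bijL j.
  have := vexpM Ha HA; rewrite addn0 => HM; eexists; split; first exact: HM.
  by move=> i; rewrite mxE cauchy_prod0 a0 A0 mxE eqxx andbT.
have [A {H}HA] := choice H.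
exists (fun n => \sum_j A j n); first by apply: vexp_sum => j; have [] := HA j.
move=> i; rewrite summxE (bigD1 i)//= big1 => [|j ji].
  by have [_ ->] := HA i; rewrite eqxx mulr1 addr0.
by have [_ ->] := HA j; rewrite eq_sym (negbTE ji) mulr0.
Qed.

Lemma CJcomb_Mweak p : M (CJcomb p).
Proof.
have [M0 MD MZ] := Mweak_CJ_module; rewrite /CJcomb.
elim: (index_enum _) => [|j r IH].
  by move: M0; congr Mweak; apply: funext => tau; rewrite big_nil.
have := MD _ _ (MZ (p j 0) _ (XjnP bijL j 0).1) IH.
by congr Mweak; apply: funext => tau; rewrite big_cons.
Qed.

Lemma CJcombD p q tau : CJcomb (p + q) tau = CJcomb p tau + CJcomb q tau.
Proof.
rewrite /CJcomb -big_split; apply: eq_bigr => j _ /=.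
by rewrite mxE hornerD scalerDl.
Qed.

Lemma CJcombN p tau : CJcomb (- p) tau = - CJcomb p tau.
Proof.
rewrite /CJcomb -sumrN; apply: eq_bigr => j _ /=.
by rewrite mxE hornerN scaleNr.
Qed.

Lemma principal_part0 : principal_part L (fun=> 0 : 'cV[C]_d) = 0.
Proof.
apply/matrixP => i k; rewrite (ord1 k); apply/polyP => n.
have V : vexp L 0 (fun=> 0 : 'cV[C]_d) (fun=> 0) by exact: vexp0.
apply: etrans (principal_partE n i V) _.
by case: ifP; rewrite !mxE coef0.
Qed.

Lemma CJcomb_surj n X : M X ->
  (forall m j, (n <= m)%N -> (principal_part L X j 0)`_m = 0) -> exists p, X = CJcomb p.
Proof.
have [M0 MD MZ] := Mweak_CJ_module; have [_ lin _] := bijL.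
elim: n X => [|n IH] X MX X0.
  exists 0; have -> : CJcomb 0 = fun=> 0.
    by apply: funext => tau; rewrite /CJcomb big1// => j _; rewrite mxE horner0 scale0r.
  apply: (principal_part_inj bijL MX M0); rewrite principal_part0.
  by apply/matrixP => j k; rewrite (ord1 k); apply/polyP => m; rewrite X0// mxE coef0.
(* Chosen so that [CJcomb r] has the same coefficient as [X] at the highest pole order. *)
pose r : 'cV[{poly C}]_d := \col_j ((principal_part L X j 0)`_n *: 'X^n).
have sr j : (size (r j 0%R) <= n.+1)%N.
  by rewrite mxE (leq_trans (size_scale_leq _ _))// size_polyXn.
have rn j : (r j 0)`_n = (principal_part L X j 0)`_n.
  by rewrite mxE coefZ coefXn eqxx mulr1.
have [A HA A0] := CJcomb_leading sr; have MG := CJcomb_Mweak r.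
pose Y tau := (-1) *: CJcomb r tau + X tau.
have MY : M Y.
  have := MD _ _ (MZ (- 1) _ MG) MX; congr Mweak; apply: funext => tau.
  by rewrite hornerN hornerC.
have [m j nm|p Yp] := IH Y MY.
  rewrite /Y lin// !mxE coefD coefCM.
  apply: etrans (congr1 (fun c => -1 * c + (principal_part L X j 0)`_m) (principal_partE m j HA)) _.
  case: leqP => mn.
    have -> : m = n by apply/eqP; rewrite eqn_leq mn nm.
    by rewrite subnn A0 rn mulN1r addNr.
  by rewrite mulr0 add0r X0.
exists (p + r); apply: funext => tau; rewrite CJcombD -Yp /Y scaleN1r addrC addrA subrr add0r//.
Qed.

(** The leading vector of a vanishing combination is 0, so the degree bound drops by one. *)
Lemma CJcomb_inj n (p : 'cV[{poly C}]_d) : (forall j, (size (p j 0%R) <= n)%N) ->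
  (forall tau, upper tau -> CJcomb p tau = 0) -> p = 0.
Proof.
elim: n => [|n IH] sp p0.
  apply/matrixP => j k; rewrite (ord1 k) mxE.
  by apply/eqP; rewrite -size_poly_leq0.
apply: (IH _ p0) => j; have [A HA A0] := CJcomb_leading sp.
have c0 : (p j 0)`_n = 0.
  rewrite -A0; apply: (lexp_coef0 (HA j 0)) => tau /p0 ->.
  by rewrite mxE.
rewrite leqNgt; apply/negP => sn.
have /eqP := c0; rewrite (_ : n = (size (p j 0%R)).-1); last first.
  by have := sp j; case: (size _) sn => // k; rewrite !ltnS => a b; apply/eqP; rewrite eqn_leq a b.
rewrite -/(lead_coef _) lead_coef_eq0 => /eqP pj.
by rewrite pj size_poly0 in sn.
Qed.

Lemma Mweak_CJ_free : CJ_freely_generated M (fun j => B j).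
Proof.
split=> [j|X MX]; first by have [] := XjnP bijL j 0.
have [_ [N [A HA]]] := Mweak_form bijL MX.
have [m j Nm|p Xp] := @CJcomb_surj N.+1 X MX.
  by apply: etrans (principal_partE m j HA) _; rewrite leqNgt Nm.
exists p; split=> // q Xq; apply/eqP; rewrite -subr_eq0; apply/eqP.
have sz j : (size ((p - q)%R j 0%R) <= \sum_k size ((p - q)%R k 0%R))%N.
  by rewrite (bigD1 j)//= leq_addr.
apply: (CJcomb_inj sz) => tau _; rewrite CJcombD CJcombN.
have -> : CJcomb q tau = X tau by rewrite Xq.
by rewrite Xp subrr.
Qed.

End FreeModule.

(** * The differential equation of the fundamental matrix *)

Section DifferentialEquation.
Variables (R : realType) (d : nat).
Local Notation C := (cplx R).
Variables (rho : 'M[int]_2 -> 'M[C]_d) (w : C) (L : 'M[C]_d).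
Hypothesis bijL : bijective_exponent rho w L.
Implicit Types (tau : C).
Local Notation form := (form rho w L).
Local Notation Xi := (Xi rho w L).
Local Notation chi := (chi rho w L).

Lemma modf_kleinJ : modf 0 (@kleinJ R).
Proof.
have := @modf_kleinJ_poly R 'X; congr modf.
by apply: funext => tau; rewrite hornerX.
Qed.

Definition E46_coef : nat -> C := cauchy_prod (cauchy_prod (e4c R) (e6c R)) (invDelta_coef R).

Lemma lexp_E46 : lexp (- 1%:R) E46_coef (fun tau => E4 tau * E6 tau / Delta tau).
Proof.
have := lexpM (lexpM (@lexp_E4 R) (@lexp_E6 R)) (@lexp_invDelta R).
by rewrite !add0r.
Qed.

Lemma E46_coef0 : E46_coef 0 = 1.
Proof. by rewrite /E46_coef !cauchy_prod0 invDelta_coef0 /e4c /e6c /eis_coef /=; ring. Qed.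

Lemma E46_coef1 : E46_coef 1 = - 240%:R.
Proof.
rewrite /E46_coef !cauchy_prod1 !cauchy_prod0 invDelta_coef0 invDelta_coef1.
rewrite /e4c /e6c /eis_coef !sigma1; ring.
Qed.

Lemma exponent_diag i j : L i j = L i i * (i == j)%:R.
Proof.
have [[/is_diag_mxP dL _] _ _] := bijL; case: eqVneq => [->|ij]; first by rewrite mulr1.
by rewrite mulr0 dL.
Qed.

Local Notation Lw := (L - (w / 12%:R)%:M).
Local Notation chiw := (chi + (2%:R * w)%:M).

(** In the coefficient of [q], [2 w] is the product of [- w / 12] with the coefficient [- 24] of
    [E2], and the summand [chi] comes from differentiating [q]. *)
Lemma Dw_Xi_coef A : A 0%N = 1%:M -> A 1%N = chi ->
  Dw_coef L 0 w A 0 = Lw /\ Dw_coef L 0 w A 1 = Lw *m chi + chiw.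
Proof.
move=> A0 A1; have e20 : e2c R 0 = 1 by [].
have e21 : e2c R 1 = - 24 by rewrite /e2c /eis_coef sigma1 mulr1.
split; apply/matrixP => i j.
  rewrite !mxE cauchy_prod0 A0 e20 [L i j]exponent_diag !mxE.
  by case: (i == j); rewrite ?mulr0n ?mulr1n; ring.
rewrite mxE cauchy_prod1 A0 A1 e20 e21 mulmxBl mul_scalar_mx.
have -> : (L *m chi) = \matrix_(i, j) (L i i * chi i j).
  apply/matrixP => k l; rewrite !mxE (bigD1 k)//= big1 ?addr0// => m mk.
  by rewrite exponent_diag eq_sym (negbTE mk) mulr0 mul0r.
rewrite ![in RHS]mxE [(1%:M : 'M[C]_d) i j]mxE.
by case: (i == j); rewrite ?mulr0n ?mulr1n; field.
Qed.

Lemma lie_mx_addr_scalar (A B : 'M[C]_d) (c : C) : lie_mx A (B + c%:M) = lie_mx A B.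
Proof. by rewrite /lie_mx mulmxDr mulmxDl scalar_mxC opprD addrACA subrr addr0. Qed.

Lemma Xi_ode tau : upper tau ->
  (E4 tau * E6 tau / Delta tau) *: Dw w Xi tau
  = Xi tau *m ((kleinJ tau - 984%:R) *: Lw + chiw + lie_mx Lw chiw).
Proof.
move=> t0; have [A [HA A0 A1]] := Xi_vexp bijL; have fX := Xi_form bijL.
(* The part of the right-hand factor without [J]; it multiplies an expansion without pole. *)
pose K := chiw + lie_mx Lw chiw - 984%:R *: Lw.
have fD : form 0 (fun tau => (Delta tau)^-1 *: (E4 tau *: (E6 tau *: Dw w Xi tau))).
  apply: form_divDelta; apply: (formM (@modf_E4 R)); apply: (formM (@modf_E6 R)).
  by have := form_Dw fX; rewrite addr0.
have fR := formD (formM modf_kleinJ (form_mulmx Lw fX)) (form_mulmx K fX).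
have f0 := formD fD (formZ (-1) fR).
have [D0 D1] := Dw_Xi_coef A0 A1.
have HD := vexpM lexp_E46 (vexp_Dw w HA).
have HJ := vexpM (lexp_kleinJ R : lexp (- 1%:R) _ _) (vexp_mulmx Lw HA).
have HK := vexp_shift 1 (vexp_mulmx K HA).
have H := vexpD HD (vexpZ (-1) (vexpD HJ HK)).
have {}H := vexp_eq (G := fun tau => (Delta tau)^-1 *: (E4 tau *: (E6 tau *: Dw w Xi tau))
  + -1 *: (kleinJ tau *: (Xi tau *m Lw) + Xi tau *m K)) _ H.
have := form_principal0 bijL f0 (H _) => /(_ _ _ tau t0) F0.
have fE x : (Delta x)^-1 *: (E4 x *: (E6 x *: Dw w Xi x)) = (E4 x * E6 x / Delta x) *: Dw w Xi x.
  by rewrite !scalerA; congr (_ *: _); move: (Delta x)^-1 (E4 x) (E6 x) => a b c; ring.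
suff : (Delta tau)^-1 *: (E4 tau *: (E6 tau *: Dw w Xi tau))
  + -1 *: (kleinJ tau *: (Xi tau *m Lw) + Xi tau *m K) = 0.
  rewrite fE scaleN1r => /eqP; rewrite subr_eq0 => /eqP ->.
  rewrite scalemxAr -mulmxDr /K; congr (_ *m _).
  move: Lw chiw (lie_mx _ _) => Z Q P.
  by apply/matrixP => i j; rewrite !mxE; ring.
apply: F0 => [x x0|[|[|//]] _]; first by rewrite fE.
- apply/matrixP => i j; rewrite !mxE !cauchy_prod0 D0 A0 E46_coef0 kleinJ_coef0.
  by rewrite mul1mx; move: (Lw i j) => l; ring.
(* Constant terms: [- 240 Lw] on the left against [(744 - 984) Lw] on the right, while the
   commutator exchanges [chi Lw] for [Lw chi]. *)
- rewrite /=; apply/matrixP => i j.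
  rewrite [LHS]mxE [X in X + _]mxE [X in _ + X]mxE [X in _ + _ * X]mxE [X in _ * (X + _)]mxE.
  rewrite !cauchy_prod1 D0 D1 A0 A1 E46_coef0 E46_coef1 kleinJ_coef0 kleinJ_coef1.
  rewrite !mul1mx [RHS]mxE /K lie_mx_addr_scalar /lie_mx.
  clear; move: chiw Lw (Lw *m chi) (chi *m Lw) => Q Z P P'.
  by rewrite !mxE; ring.
Qed.

End DifferentialEquation.

(** * Matrices annihilated by a product of distinct linear factors *)

Section AnnihilatedMatrices.
Variables (F : fieldType) (d : nat).
Implicit Types (A : 'M[F]_d) (rs : seq F).

Lemma diagonalizable_annihilated A rs : uniq rs ->
  \big[mulmx/1%:M]_(r <- rs) (A - r%:M) = 0 -> diagonalizable A.
Proof.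
case: d A => [|n] A urs A0; first by exists 1%:M; rewrite ?unitmx1//; apply/is_diag_mxP => -[].
apply/diagonalizableP; exists rs => //; rewrite dvd_mxminpoly rmorph_prod; apply/eqP.
rewrite -[RHS]A0; apply: eq_bigr => r _.
by rewrite rmorphB /= horner_mx_X horner_mx_C.
Qed.

Lemma eigenvalue_annihilated A rs : \big[mulmx/1%:M]_(r <- rs) (A - r%:M) = 0 ->
  forall a, eigenvalue A a -> a \in rs.
Proof.
move=> A0 a /eigenvalueP[v vA v0].
have H : v *m \big[mulmx/1%:M]_(r <- rs) (A - r%:M) = \prod_(r <- rs) (a - r) *: v.
  elim: (rs) => [|r s IH]; first by rewrite !big_nil mulmx1 scale1r.
  rewrite !big_cons mulmxA mulmxBr vA mul_mx_scalar -scalerBl -scalemxAl IH scalerA.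
  by rewrite mulrC.
move/eqP: H; rewrite A0 mulmx0 eq_sym scaler_eq0 (negbTE v0) orbF prodf_seq_eq0.
by move=> /hasP[r rin]; rewrite /= subr_eq0 => /eqP ->.
Qed.

End AnnihilatedMatrices.

(** * Rules for the Serre derivative *)

Section SerreDerivative.
Variables (R : realType) (d m : nat).
Local Notation C := (cplx R).
Local Notation T := (twopii R).
Implicit Types (tau s : C) (L : 'M[C]_d) (F G : C -> 'M[C]_(d, m)).

Lemma mxderive_cder n (F : C -> 'M[C]_(d, n)) tau i j l : cder (fun z => F z i j) tau l -> mxderive F tau i j = l.
Proof. by move=> /cder_derive1 <-; rewrite mxE. Qed.

Lemma Dw_eq s L N A F G tau : vexp L N A F -> (forall x, upper x -> F x = G x) -> upper tau ->
  Dw s F tau = Dw s G tau.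
Proof.
move=> HF FG t0; apply/matrixP => i j.
have E x : upper x -> F x i j = G x i j by move=> x0; rewrite FG.
have dG := mxderive_cder (cder_upper t0 E (vexp_cder i j HF t0)).
apply: etrans (DwE s F tau i j) (etrans _ (esym (DwE s G tau i j))).
exact: (f_equal2 (fun a b => T^-1 * a - s / 12 * E2 tau * b) (esym dG) (E _ t0)).
Qed.

Lemma Dw_mulmx p s L N A F (B : 'M[C]_(m, p)) tau : vexp L N A F -> upper tau ->
  Dw s (fun x => F x *m B) tau = Dw s F tau *m B.
Proof.
move=> HF t0; apply/matrixP => i j.
have dF : mxderive (fun x => F x *m B) tau i j = (mxderive F tau *m B) i j.
  have := cder_sum (index_enum 'I_m) (fun k : 'I_m => cderZ (B k j) (vexp_cder i k HF t0)).
  move=> H; apply: (@mxderive_cder p).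
  have -> : (fun z => (F z *m B) i j) = fun x => \sum_k B k j * F x i k.
    by apply: funext => x; rewrite mxE; apply: eq_bigr => k _; rewrite mulrC.
  by apply: cder_eq H _; rewrite [RHS]mxE; apply: eq_bigr => k _; rewrite mulrC.
rewrite DwE dF.
have -> : Dw s F tau *m B = T^-1 *: (mxderive F tau *m B) - (s / 12 * E2 tau) *: (F tau *m B).
  by rewrite /Dw mulmxBl -!scalemxAl.
by move: (mxderive F tau *m B) (F tau *m B) => P Q; rewrite !mxE.
Qed.

Lemma DwM s s' (phi : C -> C) l L N A F tau : cder phi tau (T * l) ->
  vexp L N A F -> upper tau ->
  Dw (s + s') (fun x => phi x *: F x) tau =
  (l - s / 12 * E2 tau * phi tau) *: F tau + phi tau *: Dw s' F tau.
Proof.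
move=> dphi HF t0; have T0 := twopii_neq0 R; apply/matrixP => i j.
have dF : mxderive (fun x => phi x *: F x) tau i j =
    T * l * F tau i j + phi tau * mxderive F tau i j.
  apply: mxderive_cder.
  have -> : (fun z => (phi z *: F z) i j) = fun z => phi z * F z i j.
    by apply: funext => z; rewrite mxE.
  exact: cderM dphi (vexp_cder i j HF t0).
rewrite DwE dF; have := DwE s' F tau i j.
move: (Dw s' F tau) (mxderive F tau i j) => P f' PE; rewrite !mxE PE.
by move: (F tau i j) (phi tau) (E2 tau) => f p e; field.
Qed.

End SerreDerivative.

(** * Elimination for the residue matrices *)

Section ConstantFactor.
Variables (R : realType) (d : nat).
Local Notation C := (cplx R).
Variables (rho : 'M[int]_2 -> 'M[C]_d) (w : C) (L : 'M[C]_d).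
Hypothesis bijL : bijective_exponent rho w L.
Local Notation Xi := (Xi rho w L).

(* Multiplication by J - c raises the pole order by one, whereas Xi B is holomorphic
   at the cusp: so W has no principal part. *)
Lemma kleinJ_factor_eq0 (W : C -> 'M[C]_d) (B : 'M[C]_d) (c : C) : form rho w L 0 W ->
  (forall tau, upper tau -> (kleinJ tau - c) *: W tau = Xi tau *m B) -> B = 0.
Proof.
move=> fW WB; have [_ [N [Wc HW]]] := fW; have [A [HA A0 _]] := Xi_vexp bijL.
have [|a Ha a0] := @lexp_kleinJ_poly R ('X - c%:P) 1; first by rewrite size_XsubC.
have a1 : a 0%N != 0 by rewrite a0 coefB coefX coefC subr0 oner_eq0.
have HB := vexp_mulmx B HA.
have W0 n : (n <= N)%N -> Wc n = 0.
  move=> nN; apply/matrixP => i j; rewrite [RHS]mxE.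
  apply: (cauchy_prod_eq0 (b := fun n => Wc n i j) (K := N.+1) a1) => // k kN.
  have H1 : vexp L (1 + N) (fun n => \matrix_(i, j) cauchy_prod a (fun n => Wc n i j) n)
      (fun tau => Xi tau *m B).
    by apply: vexp_eq (vexpM Ha HW) => tau t0; rewrite hornerXsubC WB.
  (* At pole order [1 + N] the expansion of [Xi B] starts at index [1 + N], so all coefficients of
     the product of index at most [N] vanish. *)
  have := vexp_unique H1 (vexp_shift (1 + N) HB) k => /matrixP/(_ i j).
  by rewrite mxE leqNgt kN mxE.
have F0 := form_principal0 bijL fW HW W0.
apply/matrixP => i j; have := lexp_coef0 (HB i j) _ 0%N.
rewrite A0 mul1mx => -> => [|tau t0]; first by rewrite mxE.
by rewrite -WB// F0// scaler0 mxE.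
Qed.

End ConstantFactor.

Section EliminationChains.
Variables (F : fieldType) (d : nat).
Implicit Types (X A P Q U V W : 'M[F]_d) (c e dl J : F).

(** The algebra at one point, with [e] for [E_6] and [dl] for [Delta]: the two factors [e] gained
    combine into [dl (J - c)]. The longer chain below has [E_4] for [e] and gains three. *)
Lemma elimination_chain2 X A P U V c e dl J : dl != 0 -> e ^+ 2 = dl * (J - c) ->
  dl *: (X *m A) = e *: U -> (c * dl) *: (U *m P) = e *: V ->
  (J - c) *: (dl^-1 *: V) = X *m (c *: (A *m P)).
Proof.
move=> dl0 e2 H1 H2; apply: (scalerI (expf_neq0 2 dl0)).
have E1 : dl *: (X *m A *m P) = e *: (U *m P) by rewrite scalemxAl H1 -scalemxAl.
have -> : dl ^+ 2 *: ((J - c) *: (dl^-1 *: V)) = e ^+ 2 *: V.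
  by rewrite e2 !scalerA; congr (_ *: _); field.
rewrite -scalemxAr mulmxA expr2 -[LHS]scalerA -H2 [e *: _]scalerA mulrC -[LHS]scalerA -E1.
by rewrite !scalerA; congr (_ *: _); ring.
Qed.

Lemma elimination_chain3 X A P Q U V W c e dl J : dl != 0 -> e ^+ 3 = dl * J ->
  dl *: (X *m A) = e *: U -> (c * dl) *: (U *m P) = e *: V -> (c * dl) *: (V *m Q) = e *: W ->
  J *: (dl^-1 *: (dl^-1 *: W)) = X *m (c ^+ 2 *: (A *m P *m Q)).
Proof.
move=> dl0 e3 H1 H2 H3; apply: (scalerI (expf_neq0 3 dl0)).
have E1 : dl *: (X *m A *m P *m Q) = e *: (U *m P *m Q) by rewrite 2!scalemxAl H1 -!scalemxAl.
have E2 : (c * dl) *: (U *m P *m Q) = e *: (V *m Q) by rewrite scalemxAl H2 -scalemxAl.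
have -> : dl ^+ 3 *: (J *: (dl^-1 *: (dl^-1 *: W))) = e ^+ 3 *: W.
  by rewrite e3 !scalerA; congr (_ *: _); field.
rewrite -scalemxAr !mulmxA.
have -> : e ^+ 3 *: W = e ^+ 2 *: (e *: W) by rewrite scalerA -exprSr.
rewrite -H3 scalerA.
have -> : (e ^+ 2 * (c * dl)) *: (V *m Q) = (e * (c * dl)) *: (e *: (V *m Q)).
  by rewrite scalerA; congr (_ *: _); ring.
rewrite -E2 scalerA.
have -> : (e * (c * dl) * (c * dl)) *: (U *m P *m Q) = (c * dl) ^+ 2 *: (e *: (U *m P *m Q)).
  by rewrite scalerA; congr (_ *: _); ring.
by rewrite -E1 !scalerA; congr (_ *: _); ring.
Qed.

End EliminationChains.

Section ResidueRelations.
Variables (R : realType) (d : nat).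
Local Notation C := (cplx R).
Local Notation T := (twopii R).
Variables (rho : 'M[int]_2 -> 'M[C]_d) (L : 'M[C]_d).
Hypothesis bijL : bijective_exponent rho 0 L.
Implicit Types (tau : C).
Local Notation form := (form rho 0 L).
Local Notation X := (Xi rho 0 L).
Local Notation K := (chi rho 0 L + lie_mx L (chi rho 0 L)).
Local Notation A2 := (- (31%:R / 72%:R) *: L - 1728%:R^-1 *: K).
Local Notation A3 := (- (41%:R / 72%:R) *: L + 1728%:R^-1 *: K).

Lemma form_Serre k m (F : C -> 'M[C]_(d, m)) : form k F -> form k.+2 (Dw k%:R F).
Proof. by move=> /form_Dw; rewrite add0r. Qed.

Lemma Xi_ode0 tau : upper tau ->
  (E4 tau * E6 tau) *: Dw 0 X tau
  = Delta tau *: ((kleinJ tau - 984%:R) *: (X tau *m L) + X tau *m K).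
Proof.
move=> t0; have := Xi_ode bijL t0; have D0 := Delta_neq0 t0.
rewrite mul0r mulr0 raddf0 subr0 addr0 -addrA mulmxDr -scalemxAr => <-.
by rewrite scalerA [Delta tau * _]mulrC divfK.
Qed.

Lemma kleinJ_Delta tau : upper tau -> Delta tau * kleinJ tau = E4 tau ^+ 3.
Proof. by move=> t0; rewrite mulrC divfK// Delta_neq0. Qed.

Lemma E6_sqr tau : upper tau -> E6 tau ^+ 2 = Delta tau * (kleinJ tau - 1728).
Proof.
move=> t0; rewrite mulrBr (kleinJ_Delta t0) [_ * 1728]mulrC.
by apply/eqP; rewrite eq_sym subr_eq addrC -subr_eq (discE t0).
Qed.

(** Obtained by solving the equation of [Xi] for [Delta Xi K]: as [984 + 744 = 1728],
    [1728 Delta Xi A2] becomes [E6 (E6 Xi L - E4 D Xi)]. In the same way [1728 Delta Xi A3] is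
    [E4 (E6 D Xi - E4^2 Xi L)], whence [U3] of weight 8. *)
Definition U2 tau := (1728^-1 * E6 tau) *: (X tau *m L) + (- (1728^-1 * E4 tau)) *: Dw 0 X tau.

Definition U3 tau := (1728^-1 * E6 tau) *: Dw 0 X tau + (- (1728^-1 * E4 tau ^+ 2)) *: (X tau *m L).

Lemma U2_form : form 6 U2.
Proof.
have fX := Xi_form bijL; have fD := form_Serre fX.
have H := formD (formZ 1728^-1 (formM (@modf_E6 R) (form_mulmx L fX)))
  (formZ (- 1728^-1) (formM (@modf_E4 R) fD)).
apply: form_eq H => tau _; rewrite /U2.
move: (Dw 0 X tau) (X tau *m L) (E4 tau) (E6 tau) (1728^-1) => D XL e f c.
by apply/matrixP => i j; rewrite !mxE; ring.
Qed.

Lemma U3_form : form 8 U3.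
Proof.
have fX := Xi_form bijL; have fD := form_Serre fX.
have H := formD (formZ 1728^-1 (formM (@modf_E6 R) fD))
  (formZ (- 1728^-1) (formM (@modf_E4 R) (formM (@modf_E4 R) (form_mulmx L fX)))).
apply: form_eq H => tau _; rewrite /U3.
move: (Dw 0 X tau) (X tau *m L) (E4 tau) (E6 tau) (1728^-1) => D XL e f c.
by apply/matrixP => i j; rewrite !mxE; ring.
Qed.

Lemma U2_A2 tau : upper tau -> Delta tau *: (X tau *m A2) = E6 tau *: U2 tau.
Proof.
move=> t0; have := Xi_ode0 t0; have := kleinJ_Delta t0; have := discE t0.
rewrite /U2 mulmxBr -!scalemxAr.
move: (X tau *m L) (X tau *m K) (Dw 0 X tau) => XL XK D.
move: (Delta tau) (kleinJ tau) (E4 tau) (E6 tau) => dl J e f H1 H2 H.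
apply/matrixP => i j; have := congr1 (fun M : 'M[C]_d => M i j) H; rewrite !mxE.
move: (XL i j) (XK i j) (D i j) => l k x Hx.
have -> : f * (1728^-1 * f * l + - (1728^-1 * e) * x) = 1728^-1 * (f ^+ 2 * l - e * f * x) by ring.
have -> : f ^+ 2 = e ^+ 3 - 1728 * dl by rewrite -H1; ring.
by rewrite Hx -H2; field.
Qed.

Lemma U3_A3 tau : upper tau -> Delta tau *: (X tau *m A3) = E4 tau *: U3 tau.
Proof.
move=> t0; have := Xi_ode0 t0; have := kleinJ_Delta t0.
have -> : X tau *m A3 = - (41 / 72) *: (X tau *m L) + 1728^-1 *: (X tau *m K).
  by rewrite mulmxDr -!scalemxAr.
rewrite /U3.
move: (X tau *m L) (X tau *m K) (Dw 0 X tau) => XL XK D.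
move: (Delta tau) (kleinJ tau) (E4 tau) (E6 tau) => dl J e f H2 H.
apply/matrixP => i j; have := congr1 (fun M : 'M[C]_d => M i j) H; rewrite !mxE.
move: (XL i j) (XK i j) (D i j) => l k x Hx.
have -> : e * (1728^-1 * f * x + - (1728^-1 * e ^+ 2) * l) = 1728^-1 * (e * f * x - e ^+ 3 * l) by ring.
by rewrite Hx -H2; field.
Qed.

Lemma Serre_eq s k (F G : C -> 'M[C]_d) tau : form k F ->
  (forall x, upper x -> F x = G x) -> upper tau -> Dw s F tau = Dw s G tau.
Proof. by move=> [_ [N [A HF]]]; exact: Dw_eq HF. Qed.

Lemma Serre_mulmx s k (F : C -> 'M[C]_d) (B : 'M[C]_d) tau : form k F -> upper tau ->
  Dw s (fun x => F x *m B) tau = Dw s F tau *m B.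
Proof. by move=> [_ [N [A HF]]]; exact: Dw_mulmx HF. Qed.

(* The Serre derivatives of Delta, E6 and E4 are 0, - E4^2 / 2 and - E6 / 3. *)
Lemma Serre_Delta s k (F : C -> 'M[C]_d) tau : form k F -> upper tau ->
  Dw (12 + s) (fun x => Delta x *: F x) tau = Delta tau *: Dw s F tau.
Proof.
move=> [_ [N [A HF]]] t0; rewrite (DwM 12 s (cder_Delta t0) HF t0) divff ?pnatr_eq0// mul1r subrr.
by rewrite scale0r add0r.
Qed.

Lemma Serre_E6 s k (F : C -> 'M[C]_d) tau : form k F -> upper tau ->
  Dw (6 + s) (fun x => E6 x *: F x) tau =
  - (E4 tau ^+ 2 / 2) *: F tau + E6 tau *: Dw s F tau.
Proof.
move=> [_ [N [A HF]]] t0; rewrite (DwM 6 s (cder_E6 t0) HF t0).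
apply: (congr1 (fun c => c *: F tau + E6 tau *: Dw s F tau)).
by move: (E2 tau) (E4 tau) (E6 tau) => g e f; field.
Qed.

Lemma Serre_E4 s k (F : C -> 'M[C]_d) tau : form k F -> upper tau ->
  Dw (4 + s) (fun x => E4 x *: F x) tau =
  - (E6 tau / 3) *: F tau + E4 tau *: Dw s F tau.
Proof.
move=> [_ [N [A HF]]] t0; rewrite (DwM 4 s (cder_E4 t0) HF t0).
apply: (congr1 (fun c => c *: F tau + E4 tau *: Dw s F tau)).
by move: (E2 tau) (E4 tau) (E6 tau) => g e f; field.
Qed.

(** Origin of [1/2]: the Serre derivative of [Delta Xi A = E6 U] contains [- (E4^2 / 2) U]. In
    [1728 Delta U A] this becomes [(E4^3 / 2) U], and [E4^3 = 1728 Delta + E6^2] leaves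
    [1728 Delta (1/2) U] modulo [E6]. *)
Lemma A2_annihilated : A2 *m (A2 - (1 / 2)%:M) = 0.
Proof.
(* The relation with [U2] is all that is kept of the explicit matrix. *)
have := U2_A2; move: (A2) => A U2A; pose P := A - (1 / 2)%:M.
rewrite -/P.
have fX := Xi_form bijL; have fU := U2_form; have fT := form_Serre fU.
have fXA := form_mulmx A fX.
pose Z tau := (- E4 tau) *: Dw 6 U2 tau + (E6 tau / 2) *: U2 tau + Delta tau *: (X tau *m L *m A).
have fZ : form 12 Z.
  have H := formD (formD (formZ (-1) (formM (@modf_E4 R) fT))
    (formZ 2^-1 (formM (@modf_E6 R) fU)))
    (formM (@modf_Delta R) (form_mulmx A (form_mulmx L fX))).
  apply: form_eq H => tau _; rewrite /Z.
  move: (X tau *m L *m A) (Dw 6 U2 tau) (U2 tau) (Delta tau) (E4 tau) (E6 tau) => XLA T U dl e f.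
  by apply/matrixP => i j; rewrite !mxE; ring.
have S2 tau : upper tau -> Delta tau *: (Dw 0 X tau *m A) =
    - (E4 tau ^+ 2 / 2) *: U2 tau + E6 tau *: Dw 6 U2 tau.
  move=> t0; rewrite -(Serre_mulmx 0 A fX t0) -(Serre_Delta 0 fXA t0) -(Serre_E6 6 fU t0).
  have -> : 12 + 0 = 6 + 6 :> C by ring.
  by apply: (Serre_eq _ (formM (@modf_Delta R) fXA)) => // x x0; exact: U2A.
have UP tau : U2 tau *m P = U2 tau *m A - (1 / 2) *: U2 tau.
  by rewrite /P mulmxBr mul_mx_scalar.
have S4 tau : upper tau -> (1728 * Delta tau) *: (U2 tau *m P) = E6 tau *: Z tau.
  move=> t0; have := S2 _ t0; have := discE t0; rewrite UP /Z.
  have : U2 tau *m A = (1728^-1 * E6 tau) *: (X tau *m L *m A) + (- (1728^-1 * E4 tau)) *: (Dw 0 X tau *m A).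
    by rewrite /U2 mulmxDl -!scalemxAl.
  move: (U2 tau *m A) (X tau *m L *m A) (Dw 0 X tau *m A) (U2 tau) (Dw 6 U2 tau) => UA XLA DA U T.
  move: (Delta tau) (E4 tau) (E6 tau) => dl e f -> H1 H.
  apply/matrixP => i j; have := congr1 (fun M : 'M[C]_d => M i j) H; rewrite !mxE.
  move: (XLA i j) (DA i j) (U i j) (T i j) => xla da u th Hx.
  have -> : 1728 * dl * (1728^-1 * f * xla + - (1728^-1 * e) * da - 1 / 2 * u)
    = dl * f * xla - e * (dl * da) - (1728 * dl) / 2 * u by field.
  by rewrite Hx -H1; field.
have main tau : upper tau ->
    (kleinJ tau - 1728) *: ((Delta tau)^-1 *: Z tau) = X tau *m (1728 *: (A *m P)).
  move=> t0; exact: elimination_chain2 (Delta_neq0 t0) (E6_sqr t0) (U2A _ t0) (S4 _ t0).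
have fW : form 0 (fun tau => (Delta tau)^-1 *: Z tau) := form_divDelta (k := 0) fZ.
have := kleinJ_factor_eq0 bijL fW main.
by move=> /eqP; rewrite scaler_eq0 pnatr_eq0 => /eqP.
Qed.

(** Origin of [1/3]: the Serre derivative of [E4] is [- E6 / 3], and [- E6^2 / 3] equals
    [1728 Delta / 3] modulo [E4]. At the second step [V] itself contributes [- E4^2 / 3] times
    [U P], and [- (E4^3 + E6^2) / 3] again leaves [1728 Delta / 3], now after [P]: hence [2/3]. *)
Lemma A3_annihilated : A3 *m (A3 - (1 / 3)%:M) *m (A3 - (2 / 3)%:M) = 0.
Proof.
have := U3_A3; move: (A3) => A U3A; pose P := A - (1 / 3)%:M; pose Q := A - (2 / 3)%:M.
rewrite -/P -/Q.
have fX := Xi_form bijL; have fU := U3_form; have fT := form_Serre fU.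
have fXA := form_mulmx A fX; have fXLA := form_mulmx A (form_mulmx L fX).
have fE4 := @modf_E4 R; have fE6 := @modf_E6 R; have fD := @modf_Delta R.
pose V tau := (- (E4 tau ^+ 2 / 3)) *: U3 tau + E6 tau *: Dw 8 U3 tau
  + (- (Delta tau * E4 tau)) *: (X tau *m L *m A).
have fV : form 16 V.
  have H := formD (formD (formZ (- 3^-1) (formM fE4 (formM fE4 fU))) (formM fE6 fT))
    (formZ (-1) (formM fD (formM fE4 fXLA))).
  apply: form_eq H => tau _; rewrite /V.
  move: (X tau *m L *m A) (Dw 8 U3 tau) (U3 tau) (Delta tau) (E4 tau) (E6 tau) => XLA T U dl e f.
  by apply/matrixP => i j; rewrite !mxE; ring.
have T2 tau : upper tau -> Delta tau *: (Dw 0 X tau *m A) =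
    - (E6 tau / 3) *: U3 tau + E4 tau *: Dw 8 U3 tau.
  move=> t0; rewrite -(Serre_mulmx 0 A fX t0) -(Serre_Delta 0 fXA t0) -(Serre_E4 8 fU t0).
  have -> : 12 + 0 = 4 + 8 :> C by ring.
  by apply: (Serre_eq _ (formM fD fXA)) => // x x0; exact: U3A.
have UP tau : U3 tau *m P = U3 tau *m A - (1 / 3) *: U3 tau.
  by rewrite /P mulmxBr mul_mx_scalar.
have T4 tau : upper tau -> (1728 * Delta tau) *: (U3 tau *m P) = E4 tau *: V tau.
  move=> t0; have := T2 _ t0; have := discE t0; rewrite UP /V.
  have : U3 tau *m A = (1728^-1 * E6 tau) *: (Dw 0 X tau *m A) + (- (1728^-1 * E4 tau ^+ 2)) *: (X tau *m L *m A).
    by rewrite /U3 mulmxDl -!scalemxAl.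
  move: (U3 tau *m A) (X tau *m L *m A) (Dw 0 X tau *m A) (U3 tau) (Dw 8 U3 tau) => UA XLA DA U T.
  move: (Delta tau) (E4 tau) (E6 tau) => dl e f -> H1 H.
  apply/matrixP => i j; have := congr1 (fun M : 'M[C]_d => M i j) H; rewrite !mxE.
  move: (XLA i j) (DA i j) (U i j) (T i j) => xla da u th Hx.
  have -> : 1728 * dl * (1728^-1 * f * da + - (1728^-1 * e ^+ 2) * xla - 1 / 3 * u)
    = f * (dl * da) - e ^+ 2 * dl * xla - (1728 * dl) / 3 * u by field.
  by rewrite Hx -H1; field.
have fUP := form_mulmx P fU.
have T5 tau : upper tau -> (1728 * Delta tau) *: (Dw 8 U3 tau *m P) =
    - (E6 tau / 3) *: V tau + E4 tau *: Dw 16 V tau.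
  move=> t0; rewrite -(Serre_mulmx 8 P fU t0) [1728 * _]mulrC -scalerA.
  rewrite -(Serre_E4 16 fV t0).
  have H := Serre_Delta 8 (formZ 1728 fUP) t0.
  have -> : 1728 *: Dw 8 (fun x => U3 x *m P) tau = Dw 8 (fun x => 1728 *: (U3 x *m P)) tau.
    have E x : upper x -> U3 x *m (1728 *: P) = 1728 *: (U3 x *m P) by rewrite -scalemxAr.
    rewrite -(Serre_eq 8 (form_mulmx (1728 *: P) fU) E t0).
    by rewrite !(Serre_mulmx _ _ fU t0) -scalemxAr.
  rewrite -H; have -> : 12 + 8 = 4 + 16 :> C by ring.
  apply: (Serre_eq _ (formM fD (formZ 1728 fUP)) _ t0) => x x0.
  by rewrite scalerA mulrC T4.
have fTV := form_Serre fV.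
pose W tau := (- (2 / 3 * E4 tau ^+ 2)) *: V tau + E6 tau *: Dw 16 V tau
  + (- (1728 * Delta tau ^+ 2)) *: (X tau *m L *m A *m P).
have fW : form 24 W.
  have H := formD (formD (formZ (- (2 / 3)) (formM fE4 (formM fE4 fV))) (formM fE6 fTV))
    (formZ (- 1728) (formM fD (formM fD (form_mulmx P fXLA)))).
  apply: form_eq H => tau _; rewrite /W.
  move: (X tau *m L *m A *m P) (Dw 16 V tau) (V tau) (Delta tau) (E4 tau) (E6 tau).
  move=> XLAP T v dl e f.
  by apply/matrixP => i j; rewrite !mxE; ring.
have T7 tau : upper tau -> (1728 * Delta tau) *: (V tau *m Q) = E4 tau *: W tau.
  move=> t0; have := T5 _ t0; have := T4 _ t0; have := discE t0.
  (* The next relation is derived from [P], so [Q] is seen as [P] shifted by another [1/3]. *)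
  have -> : V tau *m Q = V tau *m P - (1 / 3) *: V tau.
    rewrite /P /Q !mulmxBr !mul_mx_scalar -addrA -opprD -scalerDl.
    by apply: (congr1 (fun c => V tau *m A - c *: V tau)); field.
  have -> : V tau *m P = (- (E4 tau ^+ 2 / 3)) *: (U3 tau *m P) + E6 tau *: (Dw 8 U3 tau *m P)
      + (- (Delta tau * E4 tau)) *: (X tau *m L *m A *m P).
    have comb (a b c : C) (M1 M2 M3 : 'M[C]_d) : (a *: M1 + b *: M2 + c *: M3) *m P =
      a *: (M1 *m P) + b *: (M2 *m P) + c *: (M3 *m P) by rewrite !mulmxDl -!scalemxAl.
    exact: comb.
  rewrite /W.
  move: (U3 tau *m P) (Dw 8 U3 tau *m P) (X tau *m L *m A *m P) (V tau) (Dw 16 V tau).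
  move=> UP' TP XLAP v T.
  move: (Delta tau) (E4 tau) (E6 tau) => dl e f H1 H4 H5.
  apply/matrixP => i j; have := congr1 (fun M : 'M[C]_d => M i j) H5.
  have := congr1 (fun M : 'M[C]_d => M i j) H4; rewrite !mxE.
  move: (UP' i j) (TP i j) (XLAP i j) (v i j) (T i j) => up tp xlap vv th H4' H5'.
  have -> : 1728 * dl * (- (e ^+ 2 / 3) * up + f * tp + - (dl * e) * xlap - 1 / 3 * vv)
    = - (e ^+ 2 / 3) * (1728 * dl * up) + f * (1728 * dl * tp) - 1728 * dl * dl * e * xlap
      - (1728 * dl) / 3 * vv by field.
  by rewrite H4' H5' -{2}H1; field.
have main tau : upper tau -> (kleinJ tau - 0) *: ((Delta tau)^-1 *: ((Delta tau)^-1 *: W tau)) =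
    X tau *m (1728 ^+ 2 *: (A *m P *m Q)).
  move=> t0; rewrite subr0; have e3 := esym (kleinJ_Delta t0).
  exact: elimination_chain3 (Delta_neq0 t0) e3 (U3A _ t0) (T4 _ t0) (T7 _ t0).
have fW0 : form 0 (fun tau => (Delta tau)^-1 *: ((Delta tau)^-1 *: W tau)).
  by apply: form_divDelta; apply: form_divDelta.
have := kleinJ_factor_eq0 bijL fW0 main.
by move=> /eqP; rewrite scaler_eq0 expf_eq0 pnatr_eq0 => /eqP.
Qed.

End ResidueRelations.

(** * The Fuchsian equation along a branch of the inverse of [J] *)

Section BranchEquation.
Variables (R : realType) (d : nat).
Local Notation C := (cplx R).
Local Notation T := (twopii R).
Implicit Types (tau z : C).

Lemma nbhs_cmod z (A : set C) : nbhs z A ->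
  exists2 r : R, 0 < r & forall x, cmod (x - z) < r -> A x.
Proof.
move=> /nbhs_ballP[e /= e0 He]; have [eE r0] := ofreal_gt0 e0.
exists (complex.Re e) => // x xz; apply: He.
by rewrite /ball /= eE normCE ofreal_lt cmodC.
Qed.

Lemma continuous_ccont (t : C -> C) z : {for z, continuous t} -> ccont t z.
Proof.
move=> ct e e0; have o0 : 0 < ofreal e by rewrite -ofreal0 ofreal_lt.
have H : nbhs (t z) [set y | cmod (y - t z) < e].
  apply/nbhs_ballP; exists (ofreal e) => // y.
  by rewrite /ball /= normCE ofreal_lt cmodC.
by have /nbhs_cmod[r r0 Hr] := ct _ H; exists r.
Qed.

Lemma cder_kleinJ tau : upper tau ->
  cder (@kleinJ R) tau (T * - (E4 tau ^+ 2 * E6 tau / Delta tau)).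
Proof.
move=> t0; have D0 := Delta_neq0 t0.
apply: cder_eq (cderM (cderX 3 (cder_E4 t0)) (cderV D0 (cder_Delta t0))) _.
rewrite /=; move: (E2 tau) (E4 tau) (E6 tau) (Delta tau) D0 => g e f dl D0.
by field.
Qed.

(** Partial fractions: [(1728 z - 984) / (z (z - 1))] is [744 / (z - 1) + 984 / z]. Division by
    [- 1728], the sign coming from the derivative of [J], gives the coefficients of the residues. *)
Lemma branch_algebra (T x y e f dl z l k : C) : T != 0 -> e != 0 -> f != 0 -> dl != 0 ->
  z != 0 -> z - 1 != 0 -> e ^+ 3 = dl * (1728 * z) -> f ^+ 2 = dl * (1728 * (z - 1)) ->
  y = T^-1 * x -> e * f * y = dl * ((1728 * z - 984) * l + k) ->
  x * (1728^-1 * (T * - (e ^+ 2 * f / dl)))^-1 =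
  (z - 1)^-1 * (- (31 / 72) * l - 1728^-1 * k) + z^-1 * (- (41 / 72) * l + 1728^-1 * k).
Proof.
move=> T0 e0 f0 dl0 z0 z1 e3 f2 yx H.
have -> : x = T * y by rewrite yx mulVKf.
have -> : T * y * (1728^-1 * (T * - (e ^+ 2 * f / dl)))^-1 = - 1728 * dl * (e * f * y) / (e ^+ 3 * f ^+ 2).
  by field; rewrite T0 e0 f0 dl0.
by rewrite H e3 f2; field; rewrite dl0 z0 z1.
Qed.

Variables (rho : 'M[int]_2 -> 'M[C]_d) (L : 'M[C]_d).
Hypothesis bijL : bijective_exponent rho 0 L.
Local Notation X := (Xi rho 0 L).
Local Notation K := (chi rho 0 L + lie_mx L (chi rho 0 L)).
Local Notation A2 := (- (31%:R / 72%:R) *: L - 1728%:R^-1 *: K).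
Local Notation A3 := (- (41%:R / 72%:R) *: L + 1728%:R^-1 *: K).

(** Away from [z = 0] and [z = 1] neither [E4] nor [E6] vanishes at [t z], so the derivative of [J]
    is nonzero there and the continuous branch [t] is differentiable. *)
Lemma Xi_branch_ode (U : set C) (t : C -> C) z i j : is_tau_branch U t -> U z ->
  is_derive z 1 (fun y => X (t y) i j) ((X (t z) *m ((z - 1)^-1 *: A2 + z^-1 *: A3)) i j).
Proof.
move=> [oU U01 ct tU] Uz; apply/cderP.
have [z0 z1] := U01 _ Uz; have [t0 Jz] := tU _ Uz.
have [r r0 Hr] := nbhs_cmod (open_nbhs_nbhs (conj oU Uz)).
have D0 := Delta_neq0 t0; have T0 := twopii_neq0 R.
have c0 : 1728 != 0 :> C by rewrite pnatr_eq0.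
have JE : kleinJ (t z) = 1728 * z by have := congr1 (fun x => x * 1728) Jz; rewrite (divfK c0) mulrC.
have e4 : E4 (t z) ^+ 3 = Delta (t z) * (1728 * z) by rewrite -JE kleinJ_Delta.
have e6 : E6 (t z) ^+ 2 = Delta (t z) * (1728 * (z - 1)).
  by rewrite (E6_sqr t0) JE (mulrBr 1728 z 1) mulr1.
have n4 : E4 (t z) != 0.
  by apply: contraTneq (mulf_neq0 D0 (mulf_neq0 c0 z0)) => E; rewrite -e4 E expr0n eqxx.
have z1' : z - 1 != 0 by rewrite subr_eq0.
have n6 : E6 (t z) != 0.
  by apply: contraTneq (mulf_neq0 D0 (mulf_neq0 c0 z1')) => E; rewrite -e6 E expr0n eqxx.
have dJ := cderZ 1728^-1 (cder_kleinJ t0).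
set l := _ * (T * _) in dJ.
have l0 : l != 0.
  apply: (mulf_neq0 (invr_neq0 c0)); apply: (mulf_neq0 T0); rewrite oppr_eq0.
  by apply: (mulf_neq0 (mulf_neq0 (expf_neq0 2 n4) n6)); exact: invr_neq0.
have dt : cder t z l^-1.
  apply: (cder_inverse r0 _ (continuous_ccont (ct _ Uz)) dJ l0) => x /Hr Ux.
  by have [_] := tU _ Ux; rewrite mulrC.
have [_ [N [A HX]]] := Xi_form bijL.
apply: cder_eq (cder_comp dt (vexp_cder i j HX t0)) _.
have ode := congr1 (fun M : 'M[C]_d => M i j) (Xi_ode0 bijL t0).
have := DwE 0 X (t z) i j; rewrite !mul0r subr0.
have -> : (X (t z) *m ((z - 1)^-1 *: A2 + z^-1 *: A3)) =
    (z - 1)^-1 *: (- (31 / 72) *: (X (t z) *m L) - 1728^-1 *: (X (t z) *m K)) +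
    z^-1 *: (- (41 / 72) *: (X (t z) *m L) + 1728^-1 *: (X (t z) *m K)).
  have lin (M N1 P : 'M[C]_d) (a b c e u v : C) :
      M *m (u *: (a *: N1 - b *: P) + v *: (c *: N1 + e *: P)) =
      u *: (a *: (M *m N1) - b *: (M *m P)) + v *: (c *: (M *m N1) + e *: (M *m P)).
    by rewrite mulmxDr -!scalemxAr mulmxBr mulmxDr -!scalemxAr.
  exact: lin.
move: ode; rewrite JE.
move: (X (t z) *m L) (X (t z) *m K) (Dw 0 X (t z)) (mxderive X (t z) i j) => XL XK D x.
rewrite !mxE => ode DE.
exact: branch_algebra T0 n4 n6 D0 z0 z1' e4 e6 DE ode.
Qed.

End BranchEquation.

Theorem theorem3p3 (R : realType) (d : nat) (w : cplx R)
    (rho : 'M[int]_2 -> 'M[cplx R]_d) (Lambda : 'M[cplx R]_d)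
    (adm : admissible rho w) (rhoT : is_diag_mx (rho Tmx))
    (bijL : bijective_exponent rho w Lambda) :
  let Xi := Xi rho w Lambda in
  let chi := chi rho w Lambda in
  let Lambdaw := Lambda - (w / 12%:R)%:M in
  let chiw := chi + (2%:R * w)%:M in
  let A2 := - (31%:R / 72%:R) *: Lambda
            - 1728%:R^-1 *: (chi + lie_mx Lambda chi) in
  let A3 := - (41%:R / 72%:R) *: Lambda
            + 1728%:R^-1 *: (chi + lie_mx Lambda chi) in
  [/\
    (* (a) *)
    CJ_module (Mweak rho w)
    /\ CJ_freely_generated (Mweak rho w) (fun j => Xjn rho w Lambda j 0),
    (* (b) *)
    [/\ has_qexp Lambda Xi (qcoef Lambda Xi),
        forall n : int, n < 0 -> qcoef Lambda Xi n = 0,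
        qcoef Lambda Xi 0 = 1%:M
      & forall tau, upper tau ->
          (E4 tau * E6 tau / Delta tau) *: Dw w Xi tau
          = Xi tau *m ((kleinJ tau - 984%:R) *: Lambdaw
                       + chiw + lie_mx Lambdaw chiw)]
  & (* (c) *)
    w = 0 ->
    [/\ forall U t, is_tau_branch U t ->
          forall z, U z -> forall i j,
            is_derive z 1 (fun y => Xi (t y) i j)
              ((Xi (t z) *m ((z - 1)^-1 *: A2 + z^-1 *: A3)) i j),
        diagonalizable A2 /\
        (forall a, eigenvalue A2 a -> a \in [:: 0; 1 / 2%:R])
      & diagonalizable A3 /\
        (forall a, eigenvalue A3 a -> a \in [:: 0; 1 / 3%:R; 2%:R / 3%:R])]].
Proof.
move=> Xi0 chi0 Lambdaw chiw A2 A3; split.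
- by split; [exact: (Mweak_CJ_module bijL) | exact: (Mweak_CJ_free bijL)].
- have [A [HA A0 _]] := Xi_vexp bijL; have HZ := vexp_zcoef HA.
  rewrite /Xi0 (qcoefE HZ); split=> // [n n0|tau t0].
  + by rewrite /zcoef addr0 ifF//; apply/negbTE; rewrite -ltNge.
  + exact: Xi_ode.
move=> w0; rewrite /A2 /A3 /Xi0 /chi0.
clear Xi0 chi0 Lambdaw chiw A2 A3; subst w.
have B2 := A2_annihilated bijL; have B3 := A3_annihilated bijL.
split=> [U t Ut z Uz i j||]; first exact: Xi_branch_ode Ut Uz.
- have H : \big[mulmx/1%:M]_(r <- [:: 0; 1 / 2%:R])
      ((- (31%:R / 72%:R) *: Lambda - 1728%:R^-1 *: (Defs.chi rho 0 Lambda
        + lie_mx Lambda (Defs.chi rho 0 Lambda))) - r%:M) = 0.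
    by rewrite !big_cons big_nil mulmx1 [0%:M]raddf0 subr0.
  split; last exact: eigenvalue_annihilated H.
  apply: diagonalizable_annihilated H.
  by rewrite /= inE andbT eq_sym mulf_neq0 ?oner_neq0// invr_neq0// pnatr_eq0.
- have H : \big[mulmx/1%:M]_(r <- [:: 0; 1 / 3%:R; 2%:R / 3%:R])
      ((- (41%:R / 72%:R) *: Lambda + 1728%:R^-1 *: (Defs.chi rho 0 Lambda
        + lie_mx Lambda (Defs.chi rho 0 Lambda))) - r%:M) = 0.
    by rewrite !big_cons big_nil mulmx1 [0%:M]raddf0 subr0 mulmxA.
  split; last exact: eigenvalue_annihilated H.
  apply: diagonalizable_annihilated H.
  have t0 : 3%:R^-1 != 0 :> cplx R by rewrite invr_neq0// pnatr_eq0.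
  rewrite /= !inE andbT negb_or -andbA; apply/and3P; split.
  + by rewrite eq_sym mulf_neq0 ?oner_neq0.
  + by rewrite eq_sym mulf_neq0 ?pnatr_eq0.
  + by rewrite (inj_eq (mulIf t0)) (eqr_nat _ 1 2).
Qed.
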